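(* Let $G=(V,\mathcal E,T)$ be a temporal graph with $n=|V|$ and $m=|\mathcal E|$, and fix either the non-strict or the strict setting. (i) For passive walks, the betweenness centralities $B(v,t)$ of all temporal nodes $(v,t)\in V\times[T]$ can be computed in $O(n^2T+nmT)$ time. This holds for each of the following costs: shortest walks, shortest $k$-restless walks (any $k\in\mathbb N$), and shortest foremost walks. (ii) For active walks, the betweenness centralities $B(v,t)$ of all temporal nodes can be computed in $O(n^2T^2+nmT)$ time. This holds for the cost of shortest walks and for the cost of shortest $k$-restless walks.
   Context: **Temporal graphs and walks.** - A temporal graph is $G=(V,\mathcal E,T)$, where $V$ is a finite node set, $T\in\mathbb N$, $[T]=\{1,\dots,T\}$, and $\mathcal E\subseteq V\times V\times[T]$ is a set of temporal arcs with no self-loops. Pairs $(v,t)\in V\times[T]$ are temporal nodes. - A walk is a sequence $W=(e_1,\dots,e_r)$ with $r\ge1$ and $e_i=(u_i,v_i,t_i)\in\mathcal E$, such that $u_{i+1}=v_i$ for $1\le i<r$. - In the non-strict setting, $t_i\le t_{i+1}$; in the strict setting, $t_i<t_{i+1}$. - $W$ is an $s$–$z$ walk if $u_1=s$ and $v_r=z$. - $\mathrm{len}(W)=r$ and $\mathrm{arr}(W)=t_r$. - For $k\in\mathbb N\cup\{\infty\}$, $W$ is $k$-restless if $t_{i+1}-t_i\le k$ for all $i$ (no condition when $k=\infty$). **Visited temporal nodes.** - Passive walks: $\mathrm{Vis}(W)=\{(u_1,t_1)\}\cup\{(v_i,t_i):1\le i\le r\}$. - Active walks: $\mathrm{Vis}(W)=\{(u_1,t_1)\}\cup\{(v_i,t):1\le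 i<r,\ t_i\le t\le t_{i+1}\}\cup\{(v_r,t):t_r\le t\le T\}$. The last set corresponds to extending the walk on its final node up to time $T$. **Costs and optimal walk sets**, for $s\neq z$: - Shortest ($k=\infty$) or shortest $k$-restless: $\mathcal W^\star_{sz}$ is the set of $k$-restless $s$–$z$ walks of minimum length. - Shortest foremost: $\mathcal W^\star_{sz}$ is the set of $s$–$z$ walks minimizing $n\cdot\mathrm{arr}(W)+\mathrm{len}(W)$. **Counts and betweenness.** - $\sigma_{sz}=|\mathcal W^\star_{sz}|$. - $\sigma_{sz}(v,t)=|\{W\in\mathcal W^\star_{sz}:(v,t)\in\mathrm{Vis}(W)\}|$. - $\delta_{sz}(v,t)=\sigma_{sz}(v,t)/\sigma_{sz}$ if $\sigma_{sz}>0$, and $\delta_{sz}(v,t)=0$ otherwise. - $B(v,t)=\sum_{s,z\in V,\ s\ne v\ne z,\ s\neq z}\delta_{sz}(v,t)$. **Model of computation.** Running time is counted in a RAM model with unit-cost arithmetic operations. *)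

(* Defs.v *)
From mathcomp Require Import all_boot all_order all_algebra.
From Stdlib Require Import ClassicalEpsilon.
Set Implicit Arguments. Unset Strict Implicit. Unset Printing Implicit Defensive.
Import Order.TTheory GRing.Theory Num.Theory.

Definition arc := (nat * nat * nat)%type.
Definition src (e : arc) : nat := e.1.1.
Definition dst (e : arc) : nat := e.1.2.
Definition tim (e : arc) : nat := e.2.
Definition arc0 : arc := (0, 0, 0).

Definition wf_tgraph (n T : nat) (E : seq arc) : bool :=
  uniq E && all (fun e => [&& src e < n, dst e < n, src e != dst e & 0 < tim e <= T]) E.

Inductive cost_kind := Shortest | ShortestRestless of nat | ShortestForemost.

Definition restless_bound (ck : cost_kind) : option nat :=
  if ck is ShortestRestless k then Some k else None.

Definition step_ok (strict : bool) (k : option nat) (e e' : arc) : bool :=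
  [&& dst e == src e',
      (if strict then tim e < tim e' else tim e <= tim e') &
      (if k is Some k0 then tim e' - tim e <= k0 else true)].

Definition is_walk (strict : bool) (k : option nat) (E : seq arc) (W : seq arc) : bool :=
  [&& W != [::], all (fun e => e \in E) W &
      all (fun p => step_ok strict k p.1 p.2) (zip W (behead W))].

Definition is_sz_walk strict k E (s z : nat) (W : seq arc) : bool :=
  [&& is_walk strict k E W, src (head arc0 W) == s & dst (last arc0 W) == z].

Definition walk_cost (n : nat) (ck : cost_kind) (W : seq arc) : nat :=
  if ck is ShortestForemost then n * tim (last arc0 W) + size W else size W.

Fixpoint words (E : seq arc) (r : nat) : seq (seq arc) :=
  match r with
  | 0 => [:: [::]]
  | r'.+1 => [seq x :: w | x <- E, w <- words E r']
  end.

Definition words_upto (E : seq arc) (c : nat) : seq (seq arc) :=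
  flatten [seq words E r | r <- iota 1 c].

Section Counts.
Variables (strict : bool) (ck : cost_kind) (n T : nat) (E : seq arc).

Definition valid_sz (s z : nat) (W : seq arc) : bool :=
  is_sz_walk strict (restless_bound ck) E s z W.

(* since cost >= length, every walk of cost c is among words_upto E c *)
Definition has_walk_cost (s z c : nat) : bool :=
  has (fun W => valid_sz s z W && (walk_cost n ck W == c)) (words_upto E c).

Definition optcost (s z : nat) : option nat :=
  match excluded_middle_informative (exists c, has_walk_cost s z c) with
  | left h => Some (ex_minn h)
  | right _ => None
  end.

(* sigma_{sz}: number of optimal s-z walks (all have length <= optimal cost) *)
Definition sigma (s z : nat) : nat :=
  if optcost s z is Some c then
    count (fun W => valid_sz s z W && (walk_cost n ck W == c)) (words_upto E c)
  else 0.

Inductive walk_mode := Passive | Active.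

Definition visits (md : walk_mode) (W : seq arc) (x t : nat) : bool :=
  ((src (head arc0 W) == x) && (tim (head arc0 W) == t)) ||
  (if md is Passive then has (fun e => (dst e == x) && (tim e == t)) W
   else has (fun p => (dst p.1 == x) && (tim p.1 <= t <= tim p.2)) (zip W (behead W))
        || ((dst (last arc0 W) == x) && (tim (last arc0 W) <= t <= T))).

Definition sigma_at (md : walk_mode) (s z x t : nat) : nat :=
  if optcost s z is Some c then
    count (fun W => [&& valid_sz s z W, walk_cost n ck W == c & visits md W x t])
          (words_upto E c)
  else 0.

Definition delta (md : walk_mode) (s z x t : nat) : rat :=
  if 0 < sigma s z then ((sigma_at md s z x t)%:R / (sigma s z)%:R)%R else 0%R.

Definition betweenness (md : walk_mode) (v t : nat) : rat :=
  (\sum_(s < n) \sum_(z < n | [&& (s : nat) != v, (z : nat) != v & (s : nat) != z])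
      delta md s z v t)%R.
End Counts.

Inductive instr :=
  | IConst of nat & rat
  | IAdd of nat & nat & nat
  | ISub of nat & nat & nat
  | IMul of nat & nat & nat
  | IDiv of nat & nat & nat        (* division by 0 gives 0 *)
  | ILoad of nat & nat
  | IStore of nat & nat
  | IJle of nat & nat & nat
  | IHalt.

Definition program := seq instr.
Definition memory := nat -> rat.

Definition addr (q : rat) : nat := absz (numq q).
Definition upd (m : memory) (a : nat) (x : rat) : memory :=
  fun j => if j == a then x else m j.

(* run for at most [fuel] steps (each executed instruction, including the final
   halt, costs one step); Some m' iff the program halts within [fuel] steps.
   A program counter outside the program halts. *)
Fixpoint exec (P : program) (fuel pc : nat) (m : memory) : option memory :=
  match fuel with
  | 0 => None
  | f.+1 =>
    match nth IHalt P pc with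
    | IHalt => Some m
    | IConst d q => exec P f pc.+1 (upd m d q)
    | IAdd d a b => exec P f pc.+1 (upd m d (m a + m b)%R)
    | ISub d a b => exec P f pc.+1 (upd m d (m a - m b)%R)
    | IMul d a b => exec P f pc.+1 (upd m d (m a * m b)%R)
    | IDiv d a b => exec P f pc.+1 (upd m d (m a / m b)%R)
    | ILoad d a => exec P f pc.+1 (upd m d (m (addr (m a))))
    | IStore a s => exec P f pc.+1 (upd m (addr (m a)) (m s))
    | IJle a b l => exec P f (if (m a <= m b)%R then l else pc.+1) m
    end
  end.

Definition encode (n T : nat) (E : seq arc) (k : nat) : memory :=
  fun a =>
    if a == 0 then (n%:R)%R else if a == 1 then (T%:R)%R
    else if a == 2 then ((size E)%:R)%R else if a == 3 then (k%:R)%R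
    else if (4 <= a < 4 + 3 * size E) then
      let e := nth arc0 E ((a - 4) %/ 3) in
      let j := (a - 4) %% 3 in
      (if j == 0 then (src e)%:R else if j == 1 then (dst e)%:R else (tim e)%:R)%R
    else 0%R.

Definition out_addr (n T m v t : nat) : nat := 4 + 3 * m + v * T + t.-1.

Inductive cost_class := CShortest | CRestless | CForemost.

Definition mk_cost (cls : cost_class) (k : nat) : cost_kind :=
  match cls with
  | CShortest => Shortest
  | CRestless => ShortestRestless k
  | CForemost => ShortestForemost
  end.

Definition computes_within (P : program) (md : walk_mode) (strict : bool)
    (cls : cost_class) (bound : nat -> nat -> nat -> nat) : Prop :=
  forall (n T : nat) (E : seq arc) (k : nat), wf_tgraph n T E ->
    exists m' : memory,
      exec P (bound n (size E) T) 0 (encode n T E k) = Some m' /\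
      forall v t, v < n -> 0 < t <= T ->
        m' (out_addr n T (size E) v t)
        = betweenness strict (mk_cost cls k) n T E md v t.

(* Main.v *)
(* Optimal walks to z are shortest paths to the cheapest temporal nodes of z, in
   the digraph on the temporal nodes in which an arc (u, v, t) leads to (v, t) from
   every (u, t') at which it may be waited for; nodes are numbered 1, ..., nT, with
   0 standing for the source.
   For each source, a breadth-first search gives the distances and the numbers
   of shortest walks, and Brandes' backward accumulation gives the dependencies.
   Scanning only the arcs leaving the current vertex bounds one search by
   O(nT + mT).

   For passive walks, a shortest walk visits a temporal node at most once, and the
   dependencies are summed directly.  For active walks, the time intervals spent
   waiting at a vertex are added up by difference arrays; a walk that waits at v
   until time t and then goes round a cycle of arcs at time t is counted twice at
   (v, t).  These cycles are the 0-restless shortest walks from v to (v, t),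
   counted by a first series of searches, so that the excess can be subtracted.

   The algorithm is written in a small language of for-loops over arrays, which
   is compiled to the machine with a slowdown bounded by the code size. *)
Require Import Defs.
From mathcomp Require Import all_boot all_order all_algebra.
From mathcomp Require Import zify.
Set Implicit Arguments. Unset Strict Implicit. Unset Printing Implicit Defensive.
Import Order.TTheory GRing.Theory Num.Theory.
(* mathcomp's path.arc would otherwise hide the type of temporal arcs. *)
Import Defs.

(** * Executions of the machine *)

(** The cost enters only through the ends of walks: among the walks reaching a given temporal node
    the cheapest are the shortest, so one distance computation serves all costs. Summing [delta]
    over the targets then turns the contribution of a source into a single sum over shortest walks,
    weighted by [1 / sigma] at an optimal end and by 0 elsewhere. An optimal walk does not meet its
    last vertex earlier, so excluding [z] from the visited vertices is harmless.

    For active walks, a visit is a union of events. Each closed waiting interval is split into the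
    temporal node where it starts and a half-open rest; arriving at [(v,t)] and waiting through [t]
    then each happen at most once per walk, and the walks on which both happen factor through
    [(v,t)]. Counting them compares all times [t' < t] at each vertex for each source, whence the
    term [n^2 T^2].

    On the machine, the input lies in cells needed as registers and the output area cuts across the
    arrays. Both are relocated by hand-written code, and nothing is assumed about memory outside the
    loaded input. *)

Definition reach (P : program) pc (m : memory) k pc' m' :=
  forall f, exec P (k + f) pc m = exec P f pc' m'.

(** A Hoare triple with a step budget. Since [reach] quantifies over the fuel that remains,
    executions can be concatenated by adding their budgets. *)
Definition runs P pc m pc' (Q : memory -> Prop) b :=
  exists k m', [/\ k <= b, reach P pc m k pc' m' & Q m'].

Lemma runs_done P pc m (Q : memory -> Prop) b : Q m -> runs P pc m pc Q b.
Proof. by move=> Qm; exists 0, m. Qed.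

Lemma runs_bind P pc m pc1 Q1 b1 pc2 Q2 b2 b :
    runs P pc m pc1 Q1 b1 ->
    (forall m1, Q1 m1 -> runs P pc1 m1 pc2 Q2 b2) -> b1 + b2 <= b ->
  runs P pc m pc2 Q2 b.
Proof.
move=> [k1 [m1 [le1 r1 q1]]] /(_ _ q1)[k2 [m2 [le2 r2 q2]]] leb.
exists (k1 + k2), m2; split=> // [|f]; first by rewrite (leq_trans _ leb) ?leq_add.
by rewrite -addnA r1 r2.
Qed.

Lemma runs_weaken P pc m pc' (Q Q' : memory -> Prop) b b' :
    runs P pc m pc' Q b -> (forall m', Q m' -> Q' m') -> b <= b' ->
  runs P pc m pc' Q' b'.
Proof.
move=> rQ QQ' leb; apply: (runs_bind (b2 := 0)) rQ _ _; last by rewrite addn0.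
by move=> m1 /QQ'; apply: runs_done.
Qed.

Definition step1 (i : instr) (pc : nat) (m : memory) : nat * memory :=
  match i with
  | IConst d q => (pc.+1, upd m d q)
  | IAdd d a b => (pc.+1, upd m d (m a + m b)%R)
  | ISub d a b => (pc.+1, upd m d (m a - m b)%R)
  | IMul d a b => (pc.+1, upd m d (m a * m b)%R)
  | IDiv d a b => (pc.+1, upd m d (m a / m b)%R)
  | ILoad d a => (pc.+1, upd m d (m (addr (m a))))
  | IStore a s => (pc.+1, upd m (addr (m a)) (m s))
  | IJle a b l => (if (m a <= m b)%R then l else pc.+1, m)
  | IHalt => (pc, m)
  end.

Lemma runs_step P pc m pc' Q b i :
    nth IHalt P pc = i -> i <> IHalt ->
    runs P (step1 i pc m).1 (step1 i pc m).2 pc' Q b ->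
  runs P pc m pc' Q b.+1.
Proof.
move=> Pi iNH [k [m' [lek rk qm]]]; exists k.+1, m'; split=> // f.
by rewrite -rk addSn /= Pi; case: (i) iNH.
Qed.

Fixpoint code_at (P : program) pc (c : seq instr) : Prop :=
  if c is i :: c' then nth IHalt P pc = i /\ code_at P pc.+1 c' else True.

Lemma code_at_cat P pc c1 c2 :
  code_at P pc (c1 ++ c2) <-> code_at P pc c1 /\ code_at P (pc + size c1) c2.
Proof.
elim: c1 pc => [|i c1 IH] pc /=; first by rewrite addn0; split=> // -[].
by rewrite IH addnS addSn; split=> [[? []]|[[]]].
Qed.

Lemma code_at_mid c1 c c2 : code_at (c1 ++ c ++ c2) (size c1) c.
Proof.
elim: c c1 => [|i c IH] c1 //=; split; first by rewrite nth_cat ltnn subnn.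
by have := IH (rcons c1 i); rewrite cat_rcons size_rcons.
Qed.

Arguments code_at : simpl never.

Lemma addr_nat k : addr (k%:R)%R = k.
Proof. by rewrite /addr -[(k%:R)%R]/((k%:Z)%:~R)%R numq_int. Qed.

Lemma upd_same m a x : upd m a x a = x.
Proof. by rewrite /upd eqxx. Qed.

Lemma upd_other m a b x : b <> a -> upd m a x b = m b.
Proof. by rewrite /upd => /eqP/negbTE->. Qed.

(** * A structured language with bounded loops *)

Inductive nexp :=
  | NC of nat | NV of nat | NA of nat & nexp
  | NAdd of nexp & nexp | NMul of nexp & nexp | NSub of nexp & nexp
  | NLe of nexp & nexp.

Inductive rexp :=
  | RN of nexp | RV of nat | RA of nat & nexp
  | RAdd of rexp & rexp | RSub of rexp & rexp
  | RMul of rexp & rexp | RDiv of rexp & rexp.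

Inductive cmd :=
  | Skip
  | NSet of nat & nexp
  | NPut of nat & nexp & nexp
  | RSet of nat & rexp
  | RPut of nat & nexp & rexp
  | Seq of cmd & cmd
  | If of nexp & cmd & cmd
  | For of nat & nexp & cmd.

Record state := State {
  nv : nat -> nat;
  na : nat -> nat -> nat;
  rv : nat -> rat;
  ra : nat -> nat -> rat
}.

Definition fupd A (f : nat -> A) i (x : A) : nat -> A :=
  fun j => if j == i then x else f j.

Definition set_nv st v x := State (fupd (nv st) v x) (na st) (rv st) (ra st).
Definition set_na st a i x :=
  State (nv st) (fupd (na st) a (fupd (na st a) i x)) (rv st) (ra st).
Definition set_rv st v x := State (nv st) (na st) (fupd (rv st) v x) (ra st).
Definition set_ra st a i x :=
  State (nv st) (na st) (rv st) (fupd (ra st) a (fupd (ra st a) i x)).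

Fixpoint neval st e : nat :=
  match e with
  | NC k => k
  | NV v => nv st v
  | NA a i => na st a (neval st i)
  | NAdd e1 e2 => neval st e1 + neval st e2
  | NMul e1 e2 => neval st e1 * neval st e2
  | NSub e1 e2 => neval st e1 - neval st e2
  | NLe e1 e2 => neval st e1 <= neval st e2
  end.

Fixpoint reval st r : rat :=
  match r with
  | RN e => (neval st e)%:R
  | RV v => rv st v
  | RA a i => ra st a (neval st i)
  | RAdd e1 e2 => reval st e1 + reval st e2
  | RSub e1 e2 => reval st e1 - reval st e2
  | RMul e1 e2 => reval st e1 * reval st e2
  | RDiv e1 e2 => reval st e1 / reval st e2
  end%R.

(** The index is set afresh before each pass, so a body that overwrites it does not change the
    number of passes. *)
Fixpoint loop v (f : state -> state) k st : state :=
  if k is k'.+1 then f (set_nv (loop v f k' st) v k') else st.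

Fixpoint run c st : state :=
  match c with
  | Skip => st
  | NSet v e => set_nv st v (neval st e)
  | NPut a i e => set_na st a (neval st i) (neval st e)
  | RSet v r => set_rv st v (reval st r)
  | RPut a i r => set_ra st a (neval st i) (reval st r)
  | Seq c1 c2 => run c2 (run c1 st)
  | If e c1 c2 => if 0 < neval st e then run c1 st else run c2 st
  | For v e c1 => loop v (run c1) (neval st e) st
  end.

(* Number of loop iterations: up to the factor [size (code c)], this is the
   running time of the compiled command. *)
Fixpoint ticks c st : nat :=
  match c with
  | Seq c1 c2 => ticks c1 st + ticks c2 (run c1 st)
  | If e c1 c2 => if 0 < neval st e then ticks c1 st else ticks c2 st
  | For v e c1 =>
      \sum_(0 <= i < neval st e) (ticks c1 (set_nv (loop v (run c1) i st) v i)).+1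
  | _ => 0
  end.

(** * Compilation *)

(* Memory is split into 32 interleaved infinite banks: bank 0 holds the natural
   variables, banks 1-20 the natural arrays, 21-27 the rational arrays, 28 the
   rational variables, 29 the temporaries, 30 and 31 the counters and bounds of
   the active loops, indexed by nesting depth. *)
Definition cell bank i := i * 32 + bank.
Notation tmp := (cell 29).
Notation ctr := (cell 30).
Notation bnd := (cell 31).

Lemma cell_eq b i b' i' : b < 32 -> b' < 32 ->
  (cell b i == cell b' i') = (b == b') && (i == i').
Proof. by rewrite /cell => hb hb'; apply/eqP/andP => [|[/eqP-> /eqP->]] //; lia. Qed.

Lemma cell_neq b i b' i' : b < 32 -> b' < 32 -> b != b' \/ i != i' ->
  cell b i <> cell b' i'.
Proof. by move=> hb hb' h; apply/eqP; rewrite cell_eq //; case: h => /negbTE-> //; rewrite andbF. Qed.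

(** Turns the index in [tmp t] into the address [32 i + bank]; instructions have no literal
    operands, so each constant passes through [tmp t.+1]. *)
Definition load_code bank t :=
  [:: IConst (tmp t.+1) 32%:R; IMul (tmp t) (tmp t) (tmp t.+1);
      IConst (tmp t.+1) bank%:R; IAdd (tmp t) (tmp t) (tmp t.+1)]%R.

Lemma size_load_code bank t : size (load_code bank t) = 4. Proof. by []. Qed.

(** The result lands in [tmp t]; temporaries below [t] hold pending operands, those above are
    scratch. Moves are additions of 0. Cells are rational, so the truncation in [NSub] takes a
    comparison with 0 and a conditional jump. *)
Fixpoint ncode e t pc : seq instr :=
  match e with
  | NC k => [:: IConst (tmp t) k%:R]
  | NV v => [:: IConst (tmp t) 0; IAdd (tmp t) (tmp t) (cell 0 v)]
  | NA a i => ncode i t pc ++ load_code a.+1 t ++ [:: ILoad (tmp t) (tmp t)]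
  | NAdd e1 e2 =>
      let c1 := ncode e1 t pc in
      c1 ++ ncode e2 t.+1 (pc + size c1) ++ [:: IAdd (tmp t) (tmp t) (tmp t.+1)]
  | NMul e1 e2 =>
      let c1 := ncode e1 t pc in
      c1 ++ ncode e2 t.+1 (pc + size c1) ++ [:: IMul (tmp t) (tmp t) (tmp t.+1)]
  | NSub e1 e2 =>
      let c1 := ncode e1 t pc in
      let c2 := ncode e2 t.+1 (pc + size c1) in
      c1 ++ c2 ++ [:: ISub (tmp t) (tmp t) (tmp t.+1); IConst (tmp t.+1) 0;
                      IJle (tmp t.+1) (tmp t) (pc + size c1 + size c2).+4;
                      IConst (tmp t) 0]
  | NLe e1 e2 =>
      let c1 := ncode e1 t pc in
      let c2 := ncode e2 t.+1 (pc + size c1) in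
      c1 ++ c2 ++ [:: IConst (tmp t.+2) 1;
                      IJle (tmp t) (tmp t.+1) (pc + size c1 + size c2).+3;
                      IConst (tmp t.+2) 0; IConst (tmp t) 0;
                      IAdd (tmp t) (tmp t) (tmp t.+2)]
  end%R.

Fixpoint rcode r t pc : seq instr :=
  match r with
  | RN e => ncode e t pc
  | RV v => [:: IConst (tmp t) 0; IAdd (tmp t) (tmp t) (cell 28 v)]
  | RA a i => ncode i t pc ++ load_code (a + 21) t ++ [:: ILoad (tmp t) (tmp t)]
  | RAdd e1 e2 =>
      let c1 := rcode e1 t pc in
      c1 ++ rcode e2 t.+1 (pc + size c1) ++ [:: IAdd (tmp t) (tmp t) (tmp t.+1)]
  | RSub e1 e2 =>
      let c1 := rcode e1 t pc in
      c1 ++ rcode e2 t.+1 (pc + size c1) ++ [:: ISub (tmp t) (tmp t) (tmp t.+1)]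
  | RMul e1 e2 =>
      let c1 := rcode e1 t pc in
      c1 ++ rcode e2 t.+1 (pc + size c1) ++ [:: IMul (tmp t) (tmp t) (tmp t.+1)]
  | RDiv e1 e2 =>
      let c1 := rcode e1 t pc in
      c1 ++ rcode e2 t.+1 (pc + size c1) ++ [:: IDiv (tmp t) (tmp t) (tmp t.+1)]
  end%R.

Definition move_code dst t := [:: IConst (tmp t.+1) 0%R; IAdd dst (tmp t) (tmp t.+1)].

(** Jump targets are absolute, so the start address [pc] is a parameter; the nesting depth [d]
    selects a private counter and bound for each active loop. [IJle] on a cell and itself is an
    unconditional jump. *)
Fixpoint code c d pc : seq instr :=
  match c with
  | Skip => [::]
  | NSet v e => ncode e 0 pc ++ move_code (cell 0 v) 0
  | RSet v r => rcode r 0 pc ++ move_code (cell 28 v) 0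
  | NPut a i e =>
      let c1 := ncode i 0 pc in
      c1 ++ load_code a.+1 0 ++ ncode e 1 (pc + size c1).+4 ++ [:: IStore (tmp 0) (tmp 1)]
  | RPut a i r =>
      let c1 := ncode i 0 pc in
      c1 ++ load_code (a + 21) 0 ++ rcode r 1 (pc + size c1).+4 ++ [:: IStore (tmp 0) (tmp 1)]
  | Seq c1 c2 => let k1 := code c1 d pc in k1 ++ code c2 d (pc + size k1)
  | If e c1 c2 =>
      let k := ncode e 0 pc in
      let k1 := code c1 d (pc + size k).+2 in
      let pc2 := ((pc + size k).+2 + size k1).+2 in
      let k2 := code c2 d pc2 in
      k ++ [:: IConst (tmp 1) 0; IJle (tmp 0) (tmp 1) pc2] ++ k1
        ++ [:: IConst (tmp 0) 0; IJle (tmp 0) (tmp 0) (pc2 + size k2)] ++ k2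
  | For v e c1 =>
      let k := ncode e 0 pc in
      let pc1 := (pc + size k).+3 in
      let k1 := code c1 d.+1 pc1.+3 in
      k ++ move_code (bnd d) 0 ++ [:: IConst (ctr d) 0]
        ++ [:: IJle (bnd d) (ctr d) (pc1.+3 + size k1).+3;
               IConst (tmp 0) 0; IAdd (cell 0 v) (ctr d) (tmp 0)] ++ k1
        ++ [:: IConst (tmp 0) 1; IAdd (ctr d) (ctr d) (tmp 0);
               IJle (tmp 0) (tmp 0) pc1]
  end%R.

Fixpoint wf_nexp e : bool :=
  match e with
  | NC _ | NV _ => true
  | NA a i => (a < 20) && wf_nexp i
  | NAdd e1 e2 | NMul e1 e2 | NSub e1 e2 | NLe e1 e2 => wf_nexp e1 && wf_nexp e2
  end.

Fixpoint wf_rexp r : bool :=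
  match r with
  | RN e => wf_nexp e
  | RV _ => true
  | RA a i => (a < 7) && wf_nexp i
  | RAdd e1 e2 | RSub e1 e2 | RMul e1 e2 | RDiv e1 e2 => wf_rexp e1 && wf_rexp e2
  end.

Fixpoint wf_cmd c : bool :=
  match c with
  | Skip => true
  | NSet _ e => wf_nexp e
  | NPut a i e => [&& a < 20, wf_nexp i & wf_nexp e]
  | RSet _ r => wf_rexp r
  | RPut a i r => [&& a < 7, wf_nexp i & wf_rexp r]
  | Seq c1 c2 => wf_cmd c1 && wf_cmd c2
  | If e c1 c2 => [&& wf_nexp e, wf_cmd c1 & wf_cmd c2]
  | For _ e c1 => wf_nexp e && wf_cmd c1
  end.

Definition enc (st : state) (m : memory) : Prop :=
  [/\ forall v, m (cell 0 v) = ((nv st v)%:R)%R,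
      forall a i, a < 20 -> m (cell a.+1 i) = ((na st a i)%:R)%R,
      forall v, m (cell 28 v) = rv st v
    & forall a i, a < 7 -> m (cell (a + 21) i) = ra st a i].

Definition same_upto t (m m' : memory) := forall a, (forall t', t <= t' -> a <> tmp t') -> m' a = m a.

Lemma same_upto_trans t m1 m2 m3 :
  same_upto t m1 m2 -> same_upto t m2 m3 -> same_upto t m1 m3.
Proof. by move=> h12 h23 a ha; rewrite h23 // h12. Qed.

Lemma same_uptoS t m m' : same_upto t.+1 m m' -> same_upto t m m'.
Proof. by move=> h a ha; apply: h => t' /ltnW; apply: ha. Qed.

Lemma same_upto_upd t t' m x : t <= t' -> same_upto t m (upd m (tmp t') x).
Proof. by move=> le a ha; rewrite upd_other //; apply: ha. Qed.

Lemma same_upto_cell t m m' b i : same_upto t m m' -> b < 32 -> b != 29 ->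
  m' (cell b i) = m (cell b i).
Proof. by move=> h hb hb'; apply: h => t' _; apply: cell_neq => //; left. Qed.

Lemma same_upto_tmp t t' m m' : same_upto t m m' -> t' < t -> m' (tmp t') = m (tmp t').
Proof.
by move=> h lt; apply: h => u le; apply: cell_neq => //; right; apply/eqP; lia.
Qed.

Lemma enc_same st m t m' : enc st m -> same_upto t m m' -> enc st m'.
Proof.
case=> h1 h2 h3 h4 h; split=> [v|a i ha|v|a i ha].
- by rewrite (same_upto_cell _ h).
- by rewrite (same_upto_cell _ h) ?h2 //; lia.
- by rewrite (same_upto_cell _ h).
- by rewrite (same_upto_cell _ h) ?h4 //; lia.
Qed.

Lemma tmp_neq t t' : t != t' -> tmp t <> tmp t'.
Proof. by move=> h; apply: cell_neq => //; right. Qed.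

Lemma cell_addr b i : addr ((i%:R * 32%:R + b%:R)%R : rat) = cell b i.
Proof. by rewrite -natrM -natrD addr_nat. Qed.

Lemma runs_load_code P pc m bank t i pc' Q b :
    code_at P pc (load_code bank t) -> m (tmp t) = (i%:R)%R ->
    (forall m', same_upto t m m' -> m' (tmp t) = (i%:R * 32%:R + bank%:R)%R ->
       runs P pc.+4 m' pc' Q b) ->
  runs P pc m pc' Q b.+4.
Proof.
case=> c0 [c1 [c2 [c3 _]]] mt h.
do 4![apply: runs_step; [by eassumption | by [] | rewrite /=]].
have ntt : tmp t <> tmp t.+1 by apply: tmp_neq; lia.
have ntt' : tmp t.+1 <> tmp t by apply: tmp_neq; lia.
apply: h => [a ha|]; last first.
  by rewrite !(upd_same, upd_other _ _ ntt, upd_other _ _ ntt') mt.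
by rewrite !upd_other //; apply: ha.
Qed.

#[local] Opaque load_code.

Lemma runs_end P pc pc' m (Q : memory -> Prop) b :
  pc = pc' -> Q m -> runs P pc m pc' Q b.
Proof. by move=> ->; apply: runs_done. Qed.

Lemma runs_code P i c pc pc0 m pc' Q b :
    code_at P pc0 (i :: c) -> pc0 = pc -> i <> IHalt ->
    (code_at P pc.+1 c -> runs P (step1 i pc m).1 (step1 i pc m).2 pc' Q b) ->
  runs P pc m pc' Q b.+1.
Proof. by case=> ci cc <- iNH h; apply: runs_step ci iNH (h cc). Qed.

Lemma code_at_behead P pc i c : code_at P pc (i :: c) -> code_at P pc.+1 c.
Proof. by case. Qed.

(** The second operand is evaluated one temporary higher, so the first survives. *)
Lemma runs_binary P pc m t (c1 c2 : seq instr) x1 x2 pc' Q b :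
    runs P pc m (pc + size c1)
      (fun m1 => m1 (tmp t) = x1 /\ same_upto t m m1) (size c1) ->
    (forall m1, same_upto t m m1 ->
       runs P (pc + size c1) m1 (pc + size c1 + size c2)
         (fun m2 => m2 (tmp t.+1) = x2 /\ same_upto t.+1 m1 m2) (size c2)) ->
    (forall m2, m2 (tmp t) = x1 -> m2 (tmp t.+1) = x2 -> same_upto t m m2 ->
       runs P (pc + size c1 + size c2) m2 pc' Q b) ->
  runs P pc m pc' Q (size c1 + (size c2 + b)).
Proof.
move=> h1 h2 h3; apply: runs_bind h1 _ (leqnn _) => m1 [e1 s1].
apply: runs_bind (h2 _ s1) _ (leqnn _) => m2 [e2 s2].
apply: h3 => //; first by rewrite (same_upto_tmp s2).
exact: same_upto_trans s1 (same_uptoS s2).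
Qed.

Lemma same_upto_upd2 t t' m m' x :
  t <= t' -> same_upto t m m' -> same_upto t m (upd m' (tmp t') x).
Proof. by move=> le s; apply: same_upto_trans s (same_upto_upd _ _ le). Qed.

Ltac tmp_solve :=
  rewrite /=;
  repeat (rewrite upd_same || (rewrite upd_other; last by apply: cell_neq => //; (by left) || (right; lia))).

Lemma ncode_ok P st e t pc m :
    wf_nexp e -> enc st m -> code_at P pc (ncode e t pc) ->
  runs P pc m (pc + size (ncode e t pc))
    (fun m' => m' (tmp t) = ((neval st e)%:R)%R /\ same_upto t m m')
    (size (ncode e t pc)).
Proof.
elim: e t pc m => [k|v|a i IHi|e1 IH1 e2 IH2|e1 IH1 e2 IH2|e1 IH1 e2 IH2|e1 IH1 e2 IH2]
  t pc m /=.
- move=> _ _ c0; apply: (runs_code c0) => // _.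
  apply: runs_end => /=; first by rewrite addn1.
  by rewrite upd_same; split=> //; apply: same_upto_upd.
- move=> _ em c0; apply: (runs_code c0) => // {}c0; apply: (runs_code c0) => // {}c0.
  apply: runs_end => /=; first by rewrite addn2.
  tmp_solve; case: em => -> _ _ _; rewrite add0r; split=> //.
  by do 2![apply: same_upto_upd2 => //].
- case/andP=> ha wi em; rewrite !code_at_cat => -[c1 [c2 c3]].
  rewrite !size_cat size_load_code /= addnA.
  apply: runs_bind (IHi _ _ _ wi em c1) _ (leqnn _) => m1 [e1 s1].
  apply: (runs_load_code c2 e1) => m2 s2 e2.
  apply: (runs_code c3) => // [|_]; first by rewrite ?size_load_code; lia.
  apply: runs_end => /=; first by lia.
  rewrite e2 cell_addr; have s12 := same_upto_trans s1 s2; tmp_solve; split.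
    by case: (enc_same em s12) => _ -> .
  exact: same_upto_upd2.
- case/andP=> w1 w2 em; rewrite !code_at_cat !size_cat => -[c1 [c2 /= c3]].
  apply: runs_binary (IH1 _ _ _ w1 em c1) _ _ => [m1 /(enc_same em) em1|m2 x1 x2 s2].
    exact: IH2 c2.
  apply: (runs_code c3) => // {}c3; apply: runs_end => /=; first by lia.
  by tmp_solve; rewrite x1 x2 natrD; split=> //; apply: same_upto_upd2.
- case/andP=> w1 w2 em; rewrite !code_at_cat !size_cat => -[c1 [c2 /= c3]].
  apply: runs_binary (IH1 _ _ _ w1 em c1) _ _ => [m1 /(enc_same em) em1|m2 x1 x2 s2].
    exact: IH2 c2.
  apply: (runs_code c3) => // {}c3; apply: runs_end => /=; first by lia.
  by tmp_solve; rewrite x1 x2 natrM; split=> //; apply: same_upto_upd2.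
- case/andP=> w1 w2 em; rewrite !code_at_cat !size_cat => -[c1 [c2 /= c3]].
  apply: runs_binary (IH1 _ _ _ w1 em c1) _ _ => [m1 /(enc_same em) em1|m2 x1 x2 s2].
    exact: IH2 c2.
  apply: (runs_code c3) => // {}c3; apply: (runs_code c3) => // {}c3.
  apply: (runs_code c3) => // {}c3; rewrite /=; tmp_solve; rewrite x1 x2 subr_ge0 ler_nat.
  case: leqP => le12.
    apply: runs_end; first by lia.
    tmp_solve; rewrite natrB //; split=> //.
    by do 2![apply: same_upto_upd2 => //].
  apply: (runs_code c3) => // _; apply: runs_end => /=; first by lia.
  tmp_solve; split; first by rewrite (eqP (ltnW le12)).
  by do 3![apply: same_upto_upd2 => //].
- case/andP=> w1 w2 em; rewrite !code_at_cat !size_cat => -[c1 [c2 /= c3]].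
  apply: runs_binary (IH1 _ _ _ w1 em c1) _ _ => [m1 /(enc_same em) em1|m2 x1 x2 s2].
    exact: IH2 c2.
  have le2 : t <= t.+2 by lia.
  apply: (runs_code c3) => // {}c3; apply: (runs_code c3) => // {}c3.
  rewrite /=; tmp_solve; rewrite x1 x2 ler_nat.
  case: leqP => le12.
    move/code_at_behead: c3 => c3.
    apply: (runs_code c3) => // {}c3; apply: (runs_code c3) => // {}c3.
    apply: runs_end => /=; first by lia.
    by tmp_solve; rewrite add0r; split=> //; do 3![apply: same_upto_upd2 => //].
  apply: (runs_code c3) => // {}c3.
  apply: (runs_code c3) => // {}c3; apply: (runs_code c3) => // {}c3.
  apply: runs_end => /=; first by lia.
  by tmp_solve; rewrite add0r; split=> //; do 4![apply: same_upto_upd2 => //].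
Qed.

Lemma rcode_ok P st r t pc m :
    wf_rexp r -> enc st m -> code_at P pc (rcode r t pc) ->
  runs P pc m (pc + size (rcode r t pc))
    (fun m' => m' (tmp t) = reval st r /\ same_upto t m m')
    (size (rcode r t pc)).
Proof.
elim: r t pc m => [e|v|a i|e1 IH1 e2 IH2|e1 IH1 e2 IH2|e1 IH1 e2 IH2|e1 IH1 e2 IH2]
  t pc m /=; first exact: ncode_ok.
- move=> _ em c0; apply: (runs_code c0) => // {}c0; apply: (runs_code c0) => // {}c0.
  apply: runs_end => /=; first by rewrite addn2.
  tmp_solve; case: em => _ _ -> _; rewrite add0r; split=> //.
  by do 2![apply: same_upto_upd2 => //].
- case/andP=> ha wi em; rewrite !code_at_cat => -[c1 [c2 c3]].
  rewrite !size_cat size_load_code /= addnA.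
  apply: runs_bind (ncode_ok wi em c1) _ (leqnn _) => m1 [e1 s1].
  apply: (runs_load_code c2 e1) => m2 s2 e2.
  apply: (runs_code c3) => // [|_]; first by rewrite ?size_load_code; lia.
  apply: runs_end => /=; first by lia.
  rewrite e2 cell_addr; have s12 := same_upto_trans s1 s2; tmp_solve; split.
    by case: (enc_same em s12) => _ _ _ -> .
  exact: same_upto_upd2.
all: case/andP=> w1 w2 em; rewrite !code_at_cat !size_cat => -[c1 [c2 /= c3]].
all: apply: runs_binary (IH1 _ _ _ w1 em c1) _ _ => [m1 /(enc_same em) em1|m2 x1 x2 s2];
  first exact: IH2 c2.
all: apply: (runs_code c3) => // {}c3; apply: runs_end => /=; first by lia.
all: by tmp_solve; rewrite x1 x2; split=> //; apply: same_upto_upd2.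
Qed.

(** What a command at depth [d] owes to the loops around it. *)
Definition keeps d (m m' : memory) :=
  forall d', d' < d -> m' (ctr d') = m (ctr d') /\ m' (bnd d') = m (bnd d').

Lemma keeps_trans d m1 m2 m3 : keeps d m1 m2 -> keeps d m2 m3 -> keeps d m1 m3.
Proof. by move=> h12 h23 d' lt; case: (h23 _ lt) (h12 _ lt) => -> ->. Qed.

Lemma keeps_same d t m m' : same_upto t m m' -> keeps d m m'.
Proof. by move=> s d' _; rewrite !(same_upto_cell _ s). Qed.

Lemma keeps_upd d m b i x : b < 30 -> keeps d m (upd m (cell b i) x).
Proof.
by move=> hb d' _; rewrite !upd_other //; apply: cell_neq => //; (left; lia) || lia.
Qed.

Lemma keepsS d m m' : keeps d.+1 m m' -> keeps d m m'.
Proof. by move=> h d' lt; apply: h; apply: ltnW. Qed.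

Lemma keeps_loopreg d b m x : 29 < b < 32 -> keeps d m (upd m (cell b d) x).
Proof.
by move=> hb d' lt; rewrite !upd_other //; apply: cell_neq => //; (right; lia) || lia.
Qed.

Lemma upd_cell m b i x b' i' : b < 32 -> b' < 32 ->
  upd m (cell b i) x (cell b' i') = if (b' == b) && (i' == i) then x else m (cell b' i').
Proof. by move=> hb hb'; rewrite /upd cell_eq. Qed.

Lemma upd_bank m b i x b' i' : b < 32 -> b' < 32 -> b' != b ->
  upd m (cell b i) x (cell b' i') = m (cell b' i').
Proof. by move=> hb hb' h; apply/upd_other/cell_neq => //; left. Qed.

Lemma enc_set_nv st m v x :
  enc st m -> enc (set_nv st v x) (upd m (cell 0 v) (x%:R)%R).
Proof.
case=> h1 h2 h3 h4; split=> [w|a i ha|w|a i ha] /=.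
- by rewrite upd_cell //= /fupd; case: eqP.
- by rewrite upd_bank ?h2 //; lia.
- by rewrite upd_bank.
- by rewrite upd_bank ?h4 //; lia.
Qed.

Lemma enc_set_rv st m v x : enc st m -> enc (set_rv st v x) (upd m (cell 28 v) x).
Proof.
case=> h1 h2 h3 h4; split=> [w|a i ha|w|a i ha] /=.
- by rewrite upd_bank.
- by rewrite upd_bank ?h2 //; lia.
- by rewrite upd_cell //= /fupd; case: eqP.
- by rewrite upd_bank ?h4 //; lia.
Qed.

Lemma enc_set_na st m a i x : a < 20 ->
  enc st m -> enc (set_na st a i x) (upd m (cell a.+1 i) (x%:R)%R).
Proof.
move=> la [h1 h2 h3 h4]; split=> [w|a' i' ha|w|a' i' ha] /=.
- by rewrite upd_bank ?h1 //; lia.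
- rewrite upd_cell ?h2 //; [|lia|lia]; rewrite /fupd eqSS.
  by case: (a' =P a) => [->|//]; case: eqP.
- by rewrite upd_bank ?h3 //; lia.
- by rewrite upd_bank ?h4 //; lia.
Qed.

Lemma enc_set_ra st m a i x : a < 7 ->
  enc st m -> enc (set_ra st a i x) (upd m (cell (a + 21) i) x).
Proof.
move=> la [h1 h2 h3 h4]; split=> [w|a' i' ha|w|a' i' ha] /=.
- by rewrite upd_bank ?h1 //; lia.
- by rewrite upd_bank ?h2 //; lia.
- by rewrite upd_bank ?h3 //; lia.
- rewrite upd_cell ?h4 //; [|lia|lia]; rewrite /fupd eqn_add2r.
  by case: (a' =P a) => [->|//]; case: eqP.
Qed.

Lemma enc_loopreg st m b d x : 29 < b < 32 -> enc st m -> enc st (upd m (cell b d) x).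
Proof.
move=> hb [h1 h2 h3 h4]; split=> [w|a' i' ha|w|a' i' ha] /=.
- by rewrite upd_bank ?h1 //; lia.
- by rewrite upd_bank ?h2 //; lia.
- by rewrite upd_bank ?h3 //; lia.
- by rewrite upd_bank ?h4 //; lia.
Qed.

Lemma runs_move P pc m dst t pc' Q b :
    code_at P pc (move_code dst t) -> tmp t <> dst -> tmp t.+1 <> dst ->
    (forall m1, same_upto t m m1 -> runs P pc.+2 (upd m1 dst (m (tmp t))) pc' Q b) ->
  runs P pc m pc' Q b.+2.
Proof.
move=> c nt nt1 h; apply: (runs_code c) => // {}c; apply: (runs_code c) => // _.
rewrite /=; have -> : (upd m (tmp t.+1) 0 (tmp t) + upd m (tmp t.+1) 0 (tmp t.+1))%R = m (tmp t).
  by tmp_solve; rewrite addr0.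
by apply: h; apply: same_upto_upd.
Qed.

#[local] Opaque move_code.

Lemma size_move_code dst t : size (move_code dst t) = 2. Proof. by []. Qed.

(** Control moves backwards only at the end of a loop pass. Hence each instruction runs at most once
    per pass, and once more for the part outside the loops; this is the product of code size and
    [ticks] plus one. *)
Lemma code_ok P c st d pc m :
    wf_cmd c -> enc st m -> code_at P pc (code c d pc) ->
  runs P pc m (pc + size (code c d pc))
    (fun m' => enc (run c st) m' /\ keeps d m m')
    (size (code c d pc) * (ticks c st).+1).
Proof.
elim: c st d pc m => [|v e|a i e|v r|a i r|c1 IH1 c2 IH2|e c1 IH1 c2 IH2|v e c1 IH1]
  st d pc m /=.
- by move=> _ em _; apply: runs_end; rewrite ?addn0.
- move=> we em; rewrite code_at_cat muln1 !size_cat size_move_code => -[k1 k2].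
  apply: runs_bind (ncode_ok we em k1) _ (leqnn _) => m1 [e1 s1].
  apply: (runs_move k2) => [||m2 s2]; [by apply: cell_neq => //; left|by apply: cell_neq => //; left|].
  apply: runs_end; first by lia.
  have s12 := same_upto_trans s1 s2; rewrite e1; split.
    exact/enc_set_nv/(enc_same em s12).
  by apply: keeps_trans (keeps_same s12) _; apply: keeps_upd.
- case/and3P=> ha wi we em; rewrite !code_at_cat muln1 !size_cat size_load_code.
  case=> k1 [k2 [k3 k4]].
  apply: runs_bind (ncode_ok wi em k1) _ (leqnn _) => m1 [e1 s1].
  apply: (runs_load_code k2 e1) => m2 s2 e2.
  have s12 := same_upto_trans s1 s2.
  move: k3 k4; rewrite ?size_load_code addn4 => k3 k4.
  apply: runs_bind (ncode_ok we (enc_same em s12) k3) _ (leqnn _) => m3 [e3 s3].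
  apply: (runs_code k4) => // _; apply: runs_end; first by rewrite /=; lia.
  have s13 := same_upto_trans s12 (same_uptoS s3).
  rewrite /= (same_upto_tmp s3) // e2 cell_addr e3; split.
    by apply: enc_set_na => //; apply: enc_same em s13.
  by apply: keeps_trans (keeps_same s13) _; apply: keeps_upd; lia.
- move=> we em; rewrite code_at_cat muln1 !size_cat size_move_code => -[k1 k2].
  apply: runs_bind (rcode_ok we em k1) _ (leqnn _) => m1 [e1 s1].
  apply: (runs_move k2) => [||m2 s2]; [by apply: cell_neq => //; left|by apply: cell_neq => //; left|].
  apply: runs_end; first by lia.
  have s12 := same_upto_trans s1 s2; rewrite e1; split.
    exact/enc_set_rv/(enc_same em s12).
  by apply: keeps_trans (keeps_same s12) _; apply: keeps_upd.
- case/and3P=> ha wi we em; rewrite !code_at_cat muln1 !size_cat size_load_code.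
  case=> k1 [k2 [k3 k4]].
  apply: runs_bind (ncode_ok wi em k1) _ (leqnn _) => m1 [e1 s1].
  apply: (runs_load_code k2 e1) => m2 s2 e2.
  have s12 := same_upto_trans s1 s2.
  move: k3 k4; rewrite ?size_load_code addn4 => k3 k4.
  apply: runs_bind (rcode_ok we (enc_same em s12) k3) _ (leqnn _) => m3 [e3 s3].
  apply: (runs_code k4) => // _; apply: runs_end; first by rewrite /=; lia.
  have s13 := same_upto_trans s12 (same_uptoS s3).
  rewrite /= (same_upto_tmp s3) // e2 cell_addr e3; split.
    by apply: enc_set_ra => //; apply: enc_same em s13.
  by apply: keeps_trans (keeps_same s13) _; apply: keeps_upd; lia.
- case/andP=> w1 w2 em; rewrite code_at_cat size_cat addnA => -[k1 k2].
  apply: runs_bind (IH1 _ _ _ _ w1 em k1) _ _ => [m1 [em1 s1]|].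
    apply: runs_weaken (IH2 _ _ _ _ w2 em1 k2) _ (leqnn _) => m2 [em2 s2].
    by split=> //; apply: keeps_trans s1 s2.
  by rewrite mulnDl leq_add // leq_mul // ltnS ?leq_addl ?leq_addr.
- case/and3P=> we w1 w2 em; rewrite code_at_cat !(size_cat, size_load_code) /= size_cat /=.
  set pce := pc + size (ncode e 0 pc); set s1 := size (code c1 d pce.+2).
  set pc2 := (pce.+2 + s1).+2; set s2 := size (code c2 d pc2).
  case=> k0 kt; move: (kt) => /code_at_behead/code_at_behead.
  rewrite code_at_cat => -[k1 kj]; move: (kj) => /code_at_behead/code_at_behead k2.
  rewrite (_ : pc + (_ + _) = pc2 + s2); last by rewrite /pc2 /pce; lia.
  case: ifP => [e_gt0|/negbT e_le0].
    apply: (@runs_weaken _ _ _ _ (fun m' => enc (run c1 st) m' /\ keeps d m m') _ (size (ncode e 0 pc) + (s1 * (ticks c1 st).+1 + 2).+2)).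
    - apply: runs_bind (ncode_ok we em k0) _ (leqnn _) => m1 [e1 d1].
      apply: (runs_code kt) => // {}kt; apply: (runs_code kt) => // _.
      rewrite /=; tmp_solve; rewrite e1 (_ : (_ <= 0)%R = false) ?ler_nat; last first.
        by rewrite lern0; apply/negbTE; lia.
      have d2 : same_upto 0 m (upd m1 (tmp 1) 0%R) by apply: same_upto_upd2.
      apply: runs_bind (IH1 _ _ _ _ w1 (enc_same em d2) k1) _ (leqnn _) => m2 [em2 kp2].
      apply: (runs_code kj) => // {}kj; apply: (runs_code kj) => // _.
      rewrite /=. have d3 : same_upto 0 m2 (upd m2 (tmp 0) 0%R) by apply: same_upto_upd.
      apply: runs_end => //.
      split; first exact: enc_same em2 d3.
      by apply: keeps_trans (keeps_same d2) (keeps_trans kp2 (keeps_same d3)).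
    - by [].
    - nia.
  apply: (@runs_weaken _ _ _ _ (fun m' => enc (run c2 st) m' /\ keeps d m m') _ (size (ncode e 0 pc) + (s2 * (ticks c2 st).+1).+2)).
  - apply: runs_bind (ncode_ok we em k0) _ (leqnn _) => m1 [e1 d1].
    apply: (runs_code kt) => // {}kt; apply: (runs_code kt) => // _.
    rewrite /=; tmp_solve; rewrite e1 (_ : (_ <= 0)%R = true) ?ler_nat; last first.
      by rewrite lern0; lia.
    have d2 : same_upto 0 m (upd m1 (tmp 1) 0%R) by apply: same_upto_upd2.
    apply: runs_weaken (IH2 _ _ _ _ w2 (enc_same em d2) k2) _ (leqnn _) => m2 [em2 kp2].
    by split=> //; apply: keeps_trans (keeps_same d2) kp2.
  - by [].
  - nia.
- case/andP=> we w1 em; rewrite !code_at_cat !(size_cat, size_move_code) /= size_cat /=.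
  set pce := pc + size (ncode e 0 pc); set sb := size (code c1 d.+1 pce.+3.+3).
  rewrite addn2; case=> k0 [km ki]; move: (ki) => /code_at_behead kt.
  move: (kt) => /code_at_behead/code_at_behead/code_at_behead.
  rewrite code_at_cat => -[kb ke].
  set pc' := pc + _; set pcE := (pce.+3.+3 + sb).+3 in kt *.
  have pcE_eq : pcE = pc' by rewrite /pcE /pc' /pce; lia.
  set N := neval st e.
  (* [W i] is the number of ticks left from pass [i] on. The 9 added to [sb] below counts the loop's
     own instructions: 2 to store the bound, 1 to clear the counter, 3 before and 3 after the
     body. *)
  pose W i := \sum_(i <= j < N) (ticks c1 (set_nv (loop v (run c1) j st) v j)).+1.
  have key r i m' : i + r = N -> enc (loop v (run c1) i st) m' -> keeps d m m' ->
      m' (ctr d) = (i%:R)%R -> m' (bnd d) = (N%:R)%R ->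
      runs P pce.+3 m' pc' (fun m2 => enc (loop v (run c1) N st) m2 /\ keeps d m m2)
        ((sb + 9) * W i).+1.
    elim: r i m' => [|r IHr] i m' ir em' km' ci bi.
      apply: (runs_code kt) => // _; rewrite /= ci bi ler_nat -ir addn0 leqnn.
      by apply: runs_end => //; rewrite -[i]addn0 ir.
    have ltiN : i < N by rewrite -ir -addSnnS leq_addr.
    set si := set_nv (loop v (run c1) i st) v i.
    have -> : W i = (ticks c1 si).+1 + W i.+1 by rewrite /W big_ltn.
    apply: (@runs_weaken _ _ _ _ (fun m2 => enc (loop v (run c1) N st) m2 /\ keeps d m m2) _ ((sb * (ticks c1 si).+1 +
              ((sb + 9) * W i.+1).+4).+3)) => //; last by move: (W _); nia.
    apply: (runs_code kt) => // {}kt'; rewrite /= ci bi ler_nat leqNgt ltiN /=.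
    apply: (runs_code kt') => // {}kt'; apply: (runs_code kt') => // _.
    rewrite /= upd_same upd_bank // ci addr0; set m2 := upd _ _ _.
    have em2 : enc si m2 by apply: enc_set_nv; apply: (enc_same em'); apply: (@same_upto_upd 0).
    have ck : m2 (ctr d) = (i%:R)%R by rewrite /m2 !upd_bank.
    have bk : m2 (bnd d) = (N%:R)%R by rewrite /m2 !upd_bank.
    have km2 : keeps d m m2.
      by apply: keeps_trans km' _ => d' _; rewrite /m2 !upd_bank.
    apply: runs_bind (IH1 _ _ _ _ w1 em2 kb) _ (leqnn _) => m3 [em3 k3].
    have [ck3 bk3] := k3 _ (ltnSn d).
    do 3![apply: (runs_code ke) => // {}ke].
    rewrite /=; tmp_solve; apply: IHr.
    - by rewrite addSnnS.
    - by apply: enc_loopreg => //; apply: (enc_same em3); apply: (@same_upto_upd 0).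
    - apply: keeps_trans km2 _; apply: keeps_trans (keepsS k3) _.
      by move=> d' ltd; rewrite !upd_other //; apply: cell_neq => //; by [left|right; lia].
    - by rewrite upd_same ck3 ck natr1.
    - by rewrite !upd_bank // bk3 bk.
  apply: (@runs_weaken _ _ _ _ (fun m2 => enc (loop v (run c1) N st) m2 /\ keeps d m m2) _ (size (ncode e 0 pc) + (2 + (1 + ((sb + 9) * W 0).+1)))).
  - apply: runs_bind (ncode_ok we em k0) _ (leqnn _) => m1 [e1 d1].
    apply: (runs_move km) => [||m2 d2]; [by apply: cell_neq => //; left..|].
    apply: (runs_code ki) => [|//|_]; first by rewrite /pce; lia.
    rewrite /= e1 -/N; set m3 := upd _ _ _.
    have em3 : enc st m3.
      by do 2![apply: enc_loopreg => //]; apply: enc_same (enc_same em d1) d2.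
    have kp3 : keeps d m m3.
      apply: keeps_trans (keeps_same d1) (keeps_trans (keeps_same d2) _).
      by apply: (@keeps_trans _ _ (upd m2 (bnd d) (N%:R)%R)); apply: keeps_loopreg.
    have c3 : m3 (ctr d) = (0%:R)%R by rewrite /m3 upd_same.
    have b3 : m3 (bnd d) = (N%:R)%R by rewrite /m3 upd_bank // upd_same.
    exact: key (add0n _) em3 kp3 c3 b3.
  - by [].
  - by rewrite -/(W 0); move: (W 0); nia.
Qed.

(** * Shortest walks in a digraph *)

Section Walks.
Variables (succ : nat -> seq nat) (N : nat).
Hypothesis succN : forall x y, y \in succ x -> 0 < y <= N.

Notation edge := (fun x y => y \in succ x).

Fixpoint walks r x : seq (seq nat) :=
  if r is r'.+1 then [seq y :: p | y <- succ x, p <- walks r' y] else [:: [::]].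

Definition nwalks r x y := count (fun p => last x p == y) (walks r x).

Lemma mem_walks r x p : (p \in walks r x) = (size p == r) && path edge x p.
Proof.
elim: r x p => [|r IH] x p /=; first by rewrite inE; case: p.
apply/allpairsPdep/idP => [[y [q [yx + ->]]]|]; first by rewrite IH /= eqSS yx.
by case: p => // y q /= /and3P[szq yx pq]; exists y, q; rewrite IH yx -eqSS szq.
Qed.

Lemma sum_walksS r x (V : nmodType) (P : pred (seq nat)) (F : seq nat -> V) :
  (\sum_(p <- walks r.+1 x | P p) F p =
   \sum_(y <- succ x) \sum_(p <- walks r y | P (y :: p)) F (y :: p))%R.
Proof. by rewrite big_mkcond big_allpairs_dep; apply: eq_bigr => y _; rewrite -big_mkcond. Qed.

Lemma sum_walksD i j x (V : nmodType) (P : pred (seq nat)) (F : seq nat -> V) :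
  (\sum_(p <- walks (i + j) x | P p) F p =
   \sum_(p <- walks i x) \sum_(q <- walks j (last x p) | P (p ++ q)) F (p ++ q))%R.
Proof.
elim: i x P F => [|i IH] x P F; first by rewrite big_seq1.
rewrite addSn sum_walksS (sum_walksS i x xpredT).
by apply: eq_bigr => y _; rewrite IH.
Qed.

Lemma nwalks_gt0 r x y :
  reflect (exists p, [/\ size p = r, path edge x p & last x p = y]) (0 < nwalks r x y).
Proof.
rewrite -has_count; apply: (iffP hasP) => [[p]|[p [sp pp lp]]].
  by rewrite mem_walks => /andP[/eqP sp pp] /eqP lp; exists p.
by exists p; [rewrite mem_walks sp pp eqxx | apply/eqP].
Qed.

Lemma nwalksE r x y : nwalks r x y = \sum_(p <- walks r x | last x p == y) 1.
Proof. by rewrite sum1_count. Qed.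

Lemma nwalksS r x y : nwalks r.+1 x y = \sum_(z <- succ x) nwalks r z y.
Proof. by rewrite nwalksE (sum_walksS r x); apply: eq_bigr => z _; rewrite nwalksE. Qed.

(* [D] is one plus the distance from the root [0], and is 0 off the reachable part;
   [S] counts the shortest walks from the root. *)
Record shortest_data (D S : nat -> nat) : Prop := ShortestData {
  dist_le : forall p, path edge 0 p -> 0 < D (last 0 p) <= (size p).+1;
  count_shortest : forall y, 0 < D y -> S y = nwalks (D y).-1 0 y;
  dist_attained : forall y, 0 < D y -> 0 < S y
}.

Section Weighted.
Variables (D S : nat -> nat) (tau : nat -> rat).
Hypothesis DS : shortest_data D S.

Lemma dist0 : D 0 = 1.
Proof. by have := dist_le DS (isT : path edge 0 [::]); case: (D 0) => [|[]]. Qed.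

Lemma dist_walk y : 0 < D y ->
  exists p, [/\ size p = (D y).-1, path edge 0 p & last 0 p = y].
Proof. by move=> Dy; apply/nwalks_gt0; rewrite -(count_shortest DS) ?(dist_attained DS). Qed.

Lemma dist_path x q : 0 < D x -> path edge x q -> 0 < D (last x q) <= D x + size q.
Proof.
move=> Dx xq; have [p [sp p0 lp]] := dist_walk Dx.
have := dist_le DS (p := p ++ q); rewrite cat_path p0 lp last_cat lp => /(_ xq).
by rewrite size_cat sp; case: (D x) Dx => // k _; rewrite addSn.
Qed.

Lemma dist_edge x y : 0 < D x -> y \in succ x -> 0 < D y <= (D x).+1.
Proof. by move=> Dx yx; have := dist_path Dx (q := [:: y]); rewrite /= yx addn1; apply. Qed.

Lemma last_path_le x q : x <= N -> path edge x q -> last x q <= N.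
Proof.
by elim: q x => //= y q IH x _ /andP[/succN/andP[_ yN]]; apply: IH.
Qed.

Lemma dist_gt0_le x : 0 < D x -> x <= N.
Proof. by case/dist_walk=> p [_ p0 <-]; apply: last_path_le. Qed.

Local Open Scope ring_scope.

(* Weighted sum over the walks of length less than [L] out of [x] that continue
   shortest walks to [x] as shortest walks. *)
Definition wsum L x (F : seq nat -> rat) : rat :=
  \sum_(0 <= j < L) \sum_(q <- walks j x | D (last x q) == (D x + j)%N)
    tau (last x q) * F q.

(** An edge out of [x] raises the distance by at most one, so after a first edge with [D b] other
    than [(D x).+1] no continuation can reach the required distance. Only tight edges remain. *)
Lemma wsumS L x F : (0 < D x)%N ->
  wsum L.+1 x F = tau x * F [::] +
    \sum_(b <- succ x | D b == (D x).+1) wsum L b (fun q => F (b :: q)).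
Proof.
move=> Dx; rewrite /wsum big_nat_recl // big_cons big_nil addn0 eqxx addr0.
congr (_ + _); rewrite [RHS]exchange_big /=; apply: eq_bigr => j _.
rewrite sum_walksS [RHS]big_mkcond /= [LHS]big_seq [RHS]big_seq.
apply: eq_bigr => b bx; have /andP[Db1 Db2] := dist_edge Dx bx.
case: eqP => [->|/eqP nDb]; first by rewrite addSnnS.
rewrite big_seq_cond big1 // => q /andP[]; rewrite mem_walks => /andP[/eqP <- bq].
by have := dist_path Db1 bq; move=> /=; lia.
Qed.

Lemma eq_wsum L x F G :
  (forall q, path edge x q -> D (last x q) = (D x + size q)%N ->
     tau (last x q) != 0 -> F q = G q) ->
  wsum L x F = wsum L x G.
Proof.
move=> FG; apply: eq_bigr => j _; rewrite big_seq_cond [RHS]big_seq_cond.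
apply: eq_bigr => q /andP[]; rewrite mem_walks => /andP[/eqP szq xq] /eqP e.
have [->|nz] := eqVneq (tau (last x q)) 0; first by rewrite !mul0r.
by rewrite FG // szq.
Qed.

Lemma wsumD L x F G : wsum L x (fun q => F q + G q) = wsum L x F + wsum L x G.
Proof.
rewrite -big_split; apply: eq_bigr => j _; rewrite -big_split.
by apply: eq_bigr => q _; rewrite mulrDr.
Qed.

Lemma wsumZ L x a F : wsum L x (fun q => a * F q) = a * wsum L x F.
Proof.
rewrite mulr_sumr; apply: eq_bigr => j _; rewrite mulr_sumr.
by apply: eq_bigr => q _; rewrite mulrCA.
Qed.

Variable B : nat.
Hypothesis leDB : forall x, (D x <= B)%N.

(** Distances are at most [B], so every tight continuation of a reached [x] is shorter than this. *)
Definition fuel x := (B.+1 - D x)%N.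

Lemma fuelS x : (0 < D x)%N -> fuel x = (B - D x)%N.+1.
Proof. by rewrite /fuel => _; rewrite subSn. Qed.

Lemma fuel_succ x b : D b = (D x).+1 -> fuel b = (B - D x)%N.
Proof. by rewrite /fuel => ->; rewrite subSS. Qed.

(** The weight of all shortest continuations, the empty one included. [hval x - tau x] is Brandes'
    dependency of [x] divided by the number of shortest walks to [x]. *)
Definition hval x := wsum (fuel x) x (fun=> 1).

Lemma hvalE x : (0 < D x)%N ->
  hval x = tau x + \sum_(b <- succ x | D b == (D x).+1) hval b.
Proof.
move=> Dx; rewrite /hval fuelS // wsumS // mulr1; congr (_ + _).
by apply: eq_bigr => b /eqP/fuel_succ->.
Qed.

(** Tight edges increase [D], so the backward recursion is well founded and has one solution. This
    identifies the array computed by the backward pass. *)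
Lemma hval_unique U :
    (forall x, (0 < D x)%N -> U x = \sum_(b <- succ x | D b == (D x).+1) (tau b + U b)) ->
  forall x, (0 < D x)%N -> tau x + U x = hval x.
Proof.
move=> UE x; move: {2}(fuel x) (erefl (fuel x)) => k.
elim: k x => [|k IH] x; first by move=> + Dx; rewrite fuelS.
move=> fx Dx; rewrite hvalE // UE //; congr (_ + _).
apply: eq_bigr => b /eqP Db; apply: IH; last by rewrite Db.
by rewrite (fuel_succ Db); move: fx; rewrite fuelS // => -[].
Qed.

Definition npairs (R : rel nat) x q := count (fun ab => R ab.1 ab.2) (zip (x :: q) q).

Lemma npairs_cons R x y q : npairs R x (y :: q) = (R x y + npairs R y q)%N.
Proof. by []. Qed.

Lemma npairs_cat R x p q : npairs R x (p ++ q) = (npairs R x p + npairs R (last x p) q)%N.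
Proof. by elim: p x => [|y p IH] x //; rewrite cat_cons !npairs_cons IH addnA. Qed.

(** A shortcut to an intermediate node would shorten the whole walk. *)
Lemma dist_prefix p k : path edge 0 p -> D (last 0%N p) = (size p).+1 ->
  (k <= size p)%N -> D (last 0%N (take k p)) = k.+1.
Proof.
move=> + + lek; rewrite -{1 2 3}(cat_take_drop k p) cat_path last_cat size_cat.
case/andP=> pt pd De; have /andP[D1 D2] := dist_le DS pt.
have /andP[_] := dist_path D1 pd; rewrite De size_takel // in D2 *; lia.
Qed.

Lemma sum_shortest_last i (f : nat -> rat) :
  \sum_(p <- walks i 0 | D (last 0%N p) == i.+1) f (last 0%N p) =
  \sum_(0 <= a < N.+1 | D a == i.+1) (S a)%:R * f a.
Proof.
transitivity (\sum_(p <- walks i 0) \sum_(0 <= a < N.+1 | D a == i.+1)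
    if last 0%N p == a then f a else 0).
  rewrite big_mkcond big_seq [RHS]big_seq; apply: eq_bigr => p.
  rewrite mem_walks => /andP[/eqP szp p0].
  have lp : (last 0%N p < N.+1)%N by rewrite ltnS last_path_le.
  rewrite big_mkcond (bigD1_seq (last 0%N p)) ?iota_uniq ?mem_index_iota //= eqxx.
  by rewrite big1 ?addr0 // => a /negbTE; rewrite eq_sym => ->; case: ifP.
rewrite exchange_big; apply: eq_bigr => a /eqP Da.
rewrite -big_mkcond /= (count_shortest DS) ?Da // big_const_seq.
by rewrite iter_addr_0 mulr_natl.
Qed.

Lemma sum_shortest_S i (f : nat -> rat) :
  \sum_(p <- walks i 0 | D (last 0%N p) == i.+1)
     \sum_(b <- succ (last 0%N p) | D b == i.+2) f b =
  \sum_(p <- walks i.+1 0 | D (last 0%N p) == i.+2) f (last 0%N p).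
Proof.
rewrite -[in RHS](addn1 i) sum_walksD addn1 big_mkcond big_seq [RHS]big_seq.
apply: eq_bigr => p; rewrite mem_walks => /andP[/eqP szp p0].
rewrite sum_walksS; under [RHS]eq_bigr do rewrite big_cons big_nil addr0 last_cat /=.
rewrite -big_mkcond /=; case: eqP => // /eqP nDp.
have /andP[Dp1 Dp2] := dist_le DS p0.
rewrite big_seq_cond big1 // => b /andP[bp /eqP Db].
have := dist_edge Dp1 bp; rewrite Db /= ltnS => le1; exfalso; move: nDp Dp2; rewrite szp; lia.
Qed.

Lemma sum_shortest_ends (f : nat -> rat) :
  \sum_(0 <= k < B) \sum_(p <- walks k 0 | D (last 0%N p) == k.+1) f (last 0%N p) =
  \sum_(0 <= a < N.+1 | (0 < D a)%N) (S a)%:R * f a.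
Proof.
under eq_bigr do rewrite sum_shortest_last.
under eq_bigr do rewrite big_mkcond.
rewrite exchange_big [RHS]big_mkcond; apply: eq_bigr => a _ /=.
case: ifP => Da; last by rewrite big1 // => i _; case: eqP => // Dai; rewrite Dai in Da.
rewrite (bigD1_seq (D a).-1) ?iota_uniq ?mem_index_iota //=; last first.
  by have := leDB a; lia.
rewrite prednK // eqxx big1 ?addr0 // => i ni; case: eqP => // Dai.
by move: ni; rewrite Dai eqxx.
Qed.

Lemma wsum_ends :
  wsum B 0 (fun=> 1) = \sum_(0 <= a < N.+1 | (0 < D a)%N) (S a)%:R * tau a.
Proof.
rewrite -sum_shortest_ends; apply: eq_bigr => k _; rewrite dist0 add1n.
by apply: eq_bigr => p _; rewrite mulr1.
Qed.

(** By linearity each tight edge [(a, b)] in [R] counts once for every shortest walk to [a], with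
    the weight of all continuations from [b]. *)
Lemma wsum_npairs R :
  wsum B 0 (fun p => (npairs R 0 p)%:R) =
  \sum_(0 <= a < N.+1 | (0 < D a)%N) (S a)%:R *
    \sum_(b <- succ a | D b == (D a).+1) (R a b)%:R * hval b.
Proof.
(* [cc x] collects the pairs met after [x], and [ee x] below those formed by the first edge after
   [x]. Peeling off one layer at a time trades [cc] for [ee]; the layer beyond [B] is empty. *)
pose cc x := wsum (fuel x) x (fun q => (npairs R x q)%:R).
pose ee a := \sum_(b <- succ a | D b == (D a).+1) (R a b)%:R * hval b.
have ccE x : (0 < D x)%N -> cc x = ee x + \sum_(b <- succ x | D b == (D x).+1) cc b.
  move=> Dx; rewrite /cc fuelS // wsumS // mulr0 add0r -big_split.
  apply: eq_bigr => b /eqP Db; rewrite /hval /cc (fuel_succ Db) -wsumZ /= -wsumD.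
  by apply: eq_bigr => j _; apply: eq_bigr => q _; rewrite npairs_cons natrD mulr1.
have fuel0 : fuel 0 = B by rewrite /fuel dist0 subSS subn0.
have unroll i : wsum B 0 (fun p => (npairs R 0 p)%:R) =
    \sum_(0 <= k < i) \sum_(p <- walks k 0 | D (last 0%N p) == k.+1) ee (last 0%N p)
    + \sum_(p <- walks i 0 | D (last 0%N p) == i.+1) cc (last 0%N p).
  elim: i => [|i ->].
    by rewrite big_geq // big_cons big_nil dist0 eqxx add0r addr0 /cc fuel0.
  rewrite big_nat_recr //= -addrA; congr (_ + _).
  rewrite -sum_shortest_S -big_split; apply: eq_bigr => p /eqP Dp.
  by rewrite ccE ?Dp.
rewrite (unroll B) [X in _ + X]big_seq_cond [X in _ + X]big1 ?addr0; last first.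
  by move=> p /andP[_ /eqP Dp]; have := leDB (last 0%N p); rewrite Dp ltnn.
exact: sum_shortest_ends.
Qed.

(** A shortest walk can meet [x] only at position [(D x).-1], where it splits into a shortest walk
    to [x] and a nonempty continuation; subtracting [tau x] discards the empty one. A factor [G]
    that depends on the prefix alone is carried along. *)
Lemma wsum_through x (G : seq nat -> rat) : (0 < D x)%N ->
  wsum B 0 (fun p => ((D x <= size p)%N && (last 0%N (take (D x).-1 p) == x))%:R
                       * G (take (D x).-1 p)) =
  (\sum_(p <- walks (D x).-1 0 | last 0%N p == x) G p) * (hval x - tau x).
Proof.
move=> Dx; set i := (D x).-1; have Di : D x = i.+1 by rewrite /i; lia.
have leiB : (i < B)%N by rewrite -Di.
have -> : hval x - tau x = \sum_(1 <= j < B - i) \sum_(q <- walks j x | D (last x q) == (D x + j)%N)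
    tau (last x q).
  rewrite /hval /wsum /fuel Di subSS big_ltn; last by lia.
  rewrite big_cons big_nil addn0 Di eqxx addr0 mulr1 addrC addKr.
  by apply: eq_bigr => j _; apply: eq_bigr => q _; rewrite mulr1.
rewrite /wsum (big_cat_nat (n := i.+1)) //= [X in X + _]big_nat_cond [X in X + _]big1 ?add0r.
  rewrite mulr_sumr -[X in \sum_(X <= _ < _) _]add1n big_addn; apply: eq_big_nat => j.
  case/andP=> j1 jB; rewrite addnC sum_walksD mulr_suml [RHS]big_mkcond big_seq [RHS]big_seq.
  apply: eq_bigr => p; rewrite mem_walks => /andP[/eqP szp p0].
  case: ifP => [/eqP lp|lp]; last first.
    by rewrite big1 // => q _; rewrite take_size_cat // lp andbF mul0r mulr0.
  rewrite lp mulr_sumr big_mkcond [RHS]big_mkcond big_seq [RHS]big_seq.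
  apply: eq_bigr => q; rewrite mem_walks => /andP[/eqP szq xq].
  rewrite last_cat lp dist0 Di (_ : (1 + _)%N = (i.+1 + j)%N); last by lia.
  case: ifP => // _.
  rewrite size_cat szp take_size_cat // lp eqxx (_ : (i < i + size q)%N); last by lia.
  by rewrite /= mul1r mulrC.
move=> j /andP[/andP[_ ji] _]; rewrite big_seq_cond big1 // => p /andP[].
rewrite mem_walks => /andP[/eqP szp _] _; rewrite (_ : (D x <= _)%N = false) ?mul0r ?mulr0 //.
by apply/negbTE; rewrite -ltnNge szp Di.
Qed.
End Weighted.
End Walks.

(** * Breadth-first search *)

Lemma lt0b (b : bool) : (0 < b) = b. Proof. by case: b. Qed.

Section BFS.
Variables (succ : nat -> seq nat) (N : nat).
Hypothesis succN : forall x y, y \in succ x -> 0 < y <= N.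
Hypothesis succ_uniq : forall x, uniq (succ x).

(* Invariant after the first [i] elements of the queue [q] have been processed. *)
Record bfs_inv i (D S : nat -> nat) (q : seq nat) : Prop := BfsInv {
  bfs_uniq : uniq q;
  bfs_mem : forall y, (y \in q) = (0 < D y);
  bfs_bound : forall y, y \in q -> y <= N;
  bfs_root : D 0 = 1;
  bfs_sorted : pairwise [rel a b | D a <= D b] q;
  bfs_level : forall x y, x \in q -> y \in drop i q -> D x <= (D y).+1;
  bfs_edge : forall x y, x \in take i q -> y \in succ x -> 0 < D y <= (D x).+1;
  bfs_count : forall y, S y =
    (y == 0) + \sum_(x <- take i q | (y \in succ x) && (D y == (D x).+1)) S x;
  bfs_pred : forall y, y \in q -> y != 0 ->
    exists2 x, x \in take i q & (y \in succ x) && (D y == (D x).+1)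
}.

Lemma bfs_inv0 (D S : nat -> nat) :
    (forall y, D y = (y == 0)) -> (forall y, S y = (y == 0)) ->
  bfs_inv 0 D S [:: 0].
Proof.
move=> DE SE; split=> //.
- by move=> y; rewrite inE DE lt0b.
- by move=> y; rewrite inE => /eqP->.
- by move=> x y; rewrite !inE => /eqP-> /eqP->.
- by move=> y; rewrite SE big_nil addn0.
- by move=> y; rewrite inE => ->.
Qed.

(** The search loop always makes [N.+1] passes; those after the queue is exhausted do nothing. *)
Lemma bfs_inv_idle i D S q : size q <= i -> bfs_inv i D S q -> bfs_inv i.+1 D S q.
Proof.
move=> le [u m b r so l e c p].
have tE : take i.+1 q = take i q by rewrite !take_oversize // ltnW.
by split=> //; rewrite ?tE // => x y xq; rewrite drop_oversize ?inE // leqW.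
Qed.

Lemma bfs_inv_step i D S q D' S' : i < size q -> bfs_inv i D S q ->
    let x := nth 0 q i in
    (forall y, D' y = if (D y == 0) && (y \in succ x) then (D x).+1 else D y) ->
    (forall y, S' y = if (y \in succ x) && (D' y == (D x).+1) then S y + S x else S y) ->
  bfs_inv i.+1 D' S' (q ++ [seq y <- succ x | D y == 0]).
Proof.
move=> lti [u m b r so l e c p] x DE SE.
set new := [seq y <- succ x | D y == 0].
have xq : x \in q by apply: mem_nth.
have Dx : 0 < D x by rewrite -m.
have xd : x \in drop i q by rewrite (drop_nth 0 lti) mem_head.
have D'q y : y \in q -> D' y = D y.
  by rewrite m DE => /lt0n_neq0/negbTE->.
have D'new y : y \in new -> D' y = (D x).+1.
  by rewrite mem_filter DE => /andP[-> ->].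
have takeE : take i.+1 (q ++ new) = rcons (take i q) x.
  by rewrite takel_cat // (take_nth 0 lti).
have dropE : drop i.+1 (q ++ new) = drop i.+1 q ++ new.
  rewrite drop_cat; case: ltngtP => // h; last by rewrite h subnn drop0 drop_size.
  by move: lti; rewrite ltnNge -ltnS h.
have dropS y : y \in drop i.+1 q -> y \in drop i q.
  by rewrite (drop_nth 0 lti) inE => ->; rewrite orbT.
have take_sub y : y \in take i q -> y \in q by apply: mem_take.
have Dtake y : y \in take i q -> D y <= D x.
  move=> yt; move: so; rewrite -{1}(cat_take_drop i q) pairwise_cat => /andP[/allrelP].
  by move=> h _; apply: h.
have S'E y : y \in q -> D y <= D x -> S' y = S y.
  by move=> yq le; rewrite SE D'q // (ltn_eqF (_ : D y < (D x).+1)) ?andbF.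
split.
- rewrite cat_uniq u filter_uniq // andbT; apply/hasPn => y.
  by rewrite mem_filter m -eqn0Ngt => /andP[].
- move=> y; rewrite mem_cat m mem_filter DE.
  by case: (D y =P 0) => [->|/eqP Dy] //=; [case: ifP | rewrite orbF].
- move=> y; rewrite mem_cat => /orP[/b //|]; rewrite mem_filter => /andP[_ /succN].
  by case/andP.
- by rewrite D'q ?m ?r.
- rewrite pairwise_cat; apply/and3P; split.
  + apply/allrelP => y z yq zn /=; rewrite D'q // D'new //; exact: l.
  + rewrite (eq_in_pairwise (P := mem q) (r' := [rel a b | D a <= D b])); [by []| |by apply/allP].
    by move=> y z yq zq /=; rewrite !D'q.
  + apply/(pairwiseP 0) => k1 k2 h1 h2 _ /=; rewrite !D'new ?mem_nth //.
- move=> y z yq; rewrite dropE mem_cat => zd.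
  have Dz : D x <= D' z.
    case/orP: zd => [zd|/D'new->] //; rewrite D'q ?(mem_drop zd) //.
    move: so; rewrite -{1}(cat_take_drop i q) pairwise_cat (drop_nth 0 lti) /= => /and4P[_ _].
    by move=> /allP/(_ _ zd).
  move: yq; rewrite mem_cat => /orP[yq|/D'new->]; last by rewrite ltnS.
  rewrite D'q //; case/orP: zd => [zd|/D'new->]; last by apply: leqW; apply: l.
  by rewrite D'q ?(mem_drop zd) //; apply: l => //; apply: dropS.
- move=> y z; rewrite takeE mem_rcons inE => /orP[/eqP->|yt] zy.
    rewrite DE zy andbT D'q //; case: (D z =P 0) => [_|/eqP]; first by rewrite leqnn.
    by rewrite -lt0n -m => zq; rewrite zq l.
  have /andP[Dz1 Dz2] := e y z yt zy; rewrite (D'q y) ?take_sub //.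
  by rewrite D'q ?m ?Dz1.
- move=> y; rewrite takeE -cats1 big_cat big_cons big_nil /= addn0 (D'q x xq) (S'E x xq (leqnn _)) SE.
  have -> : \sum_(z <- take i q | (y \in succ z) && (D' y == (D' z).+1)) S' z =
            \sum_(z <- take i q | (y \in succ z) && (D y == (D z).+1)) S z.
    rewrite big_mkcond [RHS]big_mkcond big_seq [RHS]big_seq; apply: eq_bigr => z zt.
    rewrite (D'q z) ?take_sub // S'E ?take_sub ?Dtake //.
    by case zy: (y \in succ z) => //=; rewrite D'q // m; case/andP: (e _ _ zt zy).
  by rewrite c; case: ifP; rewrite ?addn0 ?addnA.
- move=> y; rewrite mem_cat takeE => /orP[yq|yn] y0.
    have [z zt /andP[zy /eqP Dy]] := p y yq y0; exists z.
      by rewrite mem_rcons inE zt orbT.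
    by rewrite zy (D'q y yq) (D'q z (take_sub z zt)) Dy eqxx.
  exists x; first by rewrite mem_rcons mem_head.
  by rewrite D'new // (D'q x xq) eqxx andbT; move: yn; rewrite mem_filter => /andP[].
Qed.
Lemma bfs_size i D S q : bfs_inv i D S q -> size q <= N.+1.
Proof.
case=> u _ b _ _ _ _ _ _; rewrite -(size_iota 0 N.+1); apply: uniq_leq_size => // y.
by rewrite mem_iota => /b.
Qed.

Lemma nwalksSr r x y :
  nwalks succ r.+1 x y = \sum_(p <- walks succ r x) (y \in succ (last x p)).
Proof.
rewrite nwalksE -[r.+1]addn1 sum_walksD; apply: eq_bigr => p _.
rewrite sum_walksS -count_uniq_mem // -sum1_count [RHS]big_mkcond.
by apply: eq_bigr => z _; rewrite big_mkcond big_seq1 last_cat.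
Qed.

(** Induction on the distance. The last edge of a shortest walk to [y] is tight: its tail cannot be
    nearer to the root, for then [y] would be nearer as well, nor farther than the walk leading to
    it is long. So the sum over tight predecessors counts exactly these walks. *)
Lemma bfs_shortest D S q : bfs_inv N.+1 D S q -> shortest_data succ D S.
Proof.
move=> inv; have szq := bfs_size inv; case: inv => u m b r so l e c p.
rewrite take_oversize // in e c p.
have dle w : path (fun x y => y \in succ x) 0 w -> 0 < D (last 0 w) <= (size w).+1.
  elim/last_ind: w => [|w y IH]; first by rewrite /= r.
  rewrite rcons_path last_rcons size_rcons => /andP[/IH /andP[D1 D2] yw].
  have /andP[-> h] : 0 < D y <= (D (last 0 w)).+1 by apply: e; rewrite ?m.
  exact: leq_trans h _.
have main k y : D y = k.+1 -> S y = nwalks succ k 0 y /\ 0 < S y.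
  elim/ltn_ind: k y => k IH y Dy.
  have [y0|y0] := eqVneq y 0.
    move: Dy; rewrite y0 r => -[<-]; rewrite c eqxx big_seq_cond big1 ?addn0 //.
    by move=> x /and3P[xq _]; rewrite r eqSS => /eqP Dx0; move: xq; rewrite m -Dx0.
  have yq : y \in q by rewrite m Dy.
  have [x xq /andP[yx Dyx]] := p y yq y0.
  have [k' Dx] : exists k', D x = k'.+1 by exists (D x).-1; rewrite prednK // -m.
  have {}kE : k = k'.+1 by move: Dyx; rewrite Dy Dx eqSS => /eqP.
  have [_ Sx] : S x = nwalks succ k' 0 x /\ 0 < S x by apply: IH; rewrite ?kE.
  split; last first.
    by rewrite c (negbTE y0) big_mkcond (bigD1_seq x) //= yx Dyx add0n ltn_addr.
  rewrite kE nwalksSr c (negbTE y0) add0n.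
  transitivity (\sum_(z <- q | (y \in succ z) && (D y == (D z).+1))
     \sum_(w <- walks succ k' 0) (last 0 w == z)).
    rewrite big_seq_cond [RHS]big_seq_cond; apply: eq_bigr => z /and3P[zq _ /eqP Dyz].
    have [-> _] : S z = nwalks succ k' 0 z /\ 0 < S z.
      by apply: IH; [rewrite kE | apply: succn_inj; rewrite -Dyz Dy kE].
    by rewrite nwalksE big_mkcond.
  rewrite exchange_big big_seq [RHS]big_seq; apply: eq_bigr => w.
  rewrite mem_walks => /andP[/eqP szw pw]; have /andP[Dw1 Dw2] := dle _ pw.
  rewrite big_mkcond (bigD1_seq (last 0 w)) ?m //= eqxx big1 ?addn0; last first.
    by move=> z /negbTE; rewrite eq_sym => ->; case: ifP.
  case yw: (y \in succ (last 0 w)) => //=.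
  have /andP[_] : 0 < D y <= (D (last 0 w)).+1 by apply: e; rewrite ?m.
  by rewrite Dy kE eqSS ltnS -szw eqn_leq Dw2 => ->.
by split=> // y Dy; case: (main _ _ (esym (prednK Dy))).
Qed.
End BFS.

(** * Temporal walks as walks on temporal nodes *)

Definition node T v t := v * T + t.
Definition vtx T x := x.-1 %/ T.
Definition tme T x := (x.-1 %% T).+1.
Definition tgt T e := node T (dst e) (tim e).
Definition out (E : seq arc) u := [seq e <- E | src e == u].

(* The temporal node (v,t) is numbered [v * T + t]; the number 0 is left for the
   start of the walk at the source [s], from which every arc leaving [s] is allowed. *)
Definition ux T s x := if x == 0 then s else vtx T x.
Definition lo T d x := if x == 0 then 0 else tme T x + d.
Definition hi T K x := if x == 0 then T else tme T x + K.
Definition allowed T d K x e := lo T d x <= tim e <= hi T K x.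
Definition tsucc T E d K s x :=
  [seq tgt T e | e <- out E (ux T s x) & allowed T d K x e].

Section Nodes.
Variables (n T : nat) (E : seq arc).
Lemma vtx_node v t : 0 < t <= T -> vtx T (node T v t) = v.
Proof.
case: t => // t /= lt; rewrite /vtx /node addnS /= divnMDl ?divn_small ?addn0 //.
exact: leq_ltn_trans lt.
Qed.

Lemma tme_node v t : 0 < t <= T -> tme T (node T v t) = t.
Proof. by case: t => // t /= lt; rewrite /tme /node addnS /= modnMDl modn_small. Qed.

Lemma node_vtx x : 0 < x -> node T (vtx T x) (tme T x) = x.
Proof. by case: x => // x _; rewrite /node /vtx /tme /= addnS -divn_eq. Qed.

Lemma tme_bound x : 0 < T -> 0 < tme T x <= T.
Proof. by move=> T0; rewrite /tme /= ltn_mod. Qed.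

Lemma node_bound v t : v < n -> 0 < t <= T -> 0 < node T v t <= n * T.
Proof. by rewrite /node; nia. Qed.

Lemma vtx_bound x : 0 < x <= n * T -> vtx T x < n.
Proof. by case: x => // x /= lt; rewrite /vtx ltn_divLR //; case: T lt => //; rewrite muln0. Qed.

(** The temporal nodes of a vertex are numbered consecutively, so a function supported on [v] lives
    on one block of the range. *)
Lemma sum_vertex (V : nmodType) v (f : nat -> V) : v < n -> 0 < T -> f 0 = 0%R ->
    (forall a, 0 < a -> vtx T a != v -> f a = 0%R) ->
  (\sum_(0 <= a < (n * T).+1) f a = \sum_(1 <= t' < T.+1) f (node T v t'))%R.
Proof.
move=> vn ht f0 fv.
have h1 : (v * T + 1 <= (n * T).+1)%N by nia.
have h2 : (v * T + T.+1 <= (n * T).+1)%N by nia.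
rewrite (big_cat_nat (n := (v * T + 1)%N)) //= [X in (X + _)%R]big_nat_cond.
rewrite [X in (X + _)%R]big1 ?add0r; last first.
  move=> a /andP[/andP[_ av] _]; have [->//|a0] := posnP a; apply: fv => //.
  by rewrite neq_ltn /vtx ltn_divLR //; lia.
rewrite (big_cat_nat (n := (v * T + T.+1)%N)) //=; last by lia.
rewrite [X in (_ + X)%R]big_nat_cond [X in (_ + X)%R]big1 ?addr0; last first.
  move=> a /andP[/andP[av _] _]; have a0 : (0 < a)%N by lia.
  apply: fv => //; rewrite neq_ltn; apply/orP; right.
  by rewrite /vtx leq_divRL //; nia.
rewrite addnC big_addn (_ : (v * T + T.+1 - v * T)%N = T.+1); last by lia.
by apply: eq_bigr => t' _; rewrite /node addnC.
Qed.
Hypothesis wfE : wf_tgraph n T E.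

Lemma arcP e : e \in E -> [/\ src e < n, dst e < n, src e != dst e & 0 < tim e <= T].
Proof. by case/andP: wfE => _ /allP h /h /and4P. Qed.

Lemma vtx_tgt e : e \in E -> vtx T (tgt T e) = dst e.
Proof. by case/arcP=> _ _ _; apply: vtx_node. Qed.

Lemma tme_tgt e : e \in E -> tme T (tgt T e) = tim e.
Proof. by case/arcP=> _ _ _; apply: tme_node. Qed.

Lemma tgt_gt0 e : e \in E -> tgt T e != 0.
Proof. by case/arcP=> _ _ _ h; rewrite /tgt /node; lia. Qed.

Lemma tsucc_bound d K s x y : y \in tsucc T E d K s x -> 0 < y <= n * T.
Proof.
case/mapP=> e; rewrite !mem_filter => /and3P[_ _ /arcP[_ h _ ht]] ->.
exact: node_bound.
Qed.

(** An arc leaving a known vertex is determined by its head and time, so counting walks on temporal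
    nodes counts temporal walks. *)
Lemma tsucc_uniq d K s x : uniq (tsucc T E d K s x).
Proof.
case/andP: (wfE) => uE _; rewrite map_inj_in_uniq; first by rewrite !filter_uniq.
move=> e e'; rewrite !mem_filter => /and3P[_ /eqP se eE] /and3P[_ /eqP se' eE'] eq_tgt.
have := vtx_tgt eE; have := tme_tgt eE; rewrite eq_tgt vtx_tgt // tme_tgt //.
by case: e e' se se' {eE eE' eq_tgt} => [[a b] c] [[a' b'] c']; rewrite /src /dst /tim /= => -> -> -> ->.
Qed.

Lemma mem_tsucc d K s x y : y \in tsucc T E d K s x ->
  exists2 e, e \in E & [/\ y = tgt T e, src e = ux T s x & allowed T d K x e].
Proof.
case/mapP=> e; rewrite !mem_filter => /and3P[al /eqP se eE] ->.
by exists e.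
Qed.

Lemma tgt_tsucc d K s x e : e \in E -> src e = ux T s x -> allowed T d K x e ->
  tgt T e \in tsucc T E d K s x.
Proof. by move=> eE se al; apply: map_f; rewrite !mem_filter al se eqxx. Qed.

Section Words.
Variables (d K s : nat).
Notation succ := (tsucc T E d K s).

Fixpoint vfrom x (W : seq arc) : bool :=
  if W is e :: W' then
    [&& src e == ux T s x, allowed T d K x e & vfrom (tgt T e) W']
  else true.

(** [walks] lists targets in the order in which [words] lists arcs, so the sums agree term by term,
    with multiplicities. *)
Lemma sum_words r x (V : nmodType) (P : pred (seq nat)) (F : seq nat -> V) :
  (\sum_(W <- words E r | vfrom x W && P (map (tgt T) W)) F (map (tgt T) W) =
   \sum_(p <- walks succ r x | P p) F p)%R.
Proof.
elim: r x P F => [|r IH] x P F; first by rewrite !big_cons !big_nil.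
rewrite sum_walksS big_map big_filter big_filter_cond big_mkcond big_allpairs_dep.
rewrite [RHS]big_mkcond; apply: eq_bigr => e _ /=.
rewrite -big_mkcond; case: ifP => [/andP[-> ->]|nal] /=; first exact: IH.
by rewrite big1 // => W; rewrite andbA nal.
Qed.

Lemma words_mem r W : W \in words E r -> size W = r /\ {subset W <= E}.
Proof.
elim: r W => [|r IH] W /=; first by rewrite inE => /eqP->.
case/allpairsP=> -[e W'] /= [eE /IH[<- sW] ->]; split=> // e'.
by rewrite inE => /predU1P[->|/sW].
Qed.
End Words.

Section Cost.
Variables (strict : bool) (ck : cost_kind).

(** No waiting time exceeds [T], so [T] stands for an infinite bound. *)
Definition window := if ck is ShortestRestless k then k else T.
Definition weight := if ck is ShortestForemost then n else 0.

Lemma step_okE e e' : e \in E -> e' \in E ->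
  step_ok strict (restless_bound ck) e e' =
  (src e' == dst e) && allowed T strict window (tgt T e) e'.
Proof.
move=> eE e'E; rewrite /step_ok /allowed /lo /hi (negbTE (tgt_gt0 eE)) tme_tgt //.
rewrite eq_sym; congr (_ && _); congr (_ && _); first by case: strict; rewrite ?addn1 ?addn0.
rewrite /window; case: (ck) => [|k|] //=; rewrite ?leq_subLR //.
  by case: (arcP e'E) => _ _ _ /andP[_ h]; rewrite (leq_trans h) ?leq_addl.
by case: (arcP e'E) => _ _ _ /andP[_ h]; rewrite (leq_trans h) ?leq_addl.
Qed.

Lemma valid_szE s z W : W != [::] -> {subset W <= E} ->
  valid_sz strict ck E s z W = vfrom strict window s 0 W && (dst (last arc0 W) == z).
Proof.
case: W => // e W _ sub; rewrite /valid_sz /is_sz_walk /is_walk /=.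
have eE : e \in E by apply: sub; rewrite mem_head.
have -> : all (mem E) W by apply/allP => e' e'W; apply: sub; rewrite inE e'W orbT.
have -> : allowed T strict window 0 e by rewrite /allowed /=; case/arcP: eE => _ _ _ /andP[].
rewrite eE andbCA -!andbA /=; congr (_ && _); congr (_ && _).
elim: W e eE sub => //= e' W IH e eE sub.
have e'E : e' \in E by apply: sub; rewrite !inE eqxx orbT.
rewrite step_okE // {1}/ux (negbTE (tgt_gt0 eE)) vtx_tgt // IH ?andbA //.
by move=> a aW; apply: sub; rewrite inE aW orbT.
Qed.

Lemma walk_costE W : walk_cost n ck W = weight * tim (last arc0 W) + size W.
Proof. by rewrite /walk_cost /weight; case: ck. Qed.

Lemma sum_words_cost s z c (V : nmodType) (F : seq nat -> V) :
  (\sum_(W <- words_upto E c | valid_sz strict ck E s z W && (walk_cost n ck W == c))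
      F (map (tgt T) W) =
   \sum_(1 <= r < c.+1)
     \sum_(p <- walks (tsucc T E strict window s) r 0 |
             (vtx T (last 0%N p) == z) && (weight * tme T (last 0%N p) + r == c)%N) F p)%R.
Proof.
rewrite big_flatten big_map /= /index_iota subSS subn0 [LHS]big_seq [RHS]big_seq.
apply: eq_bigr => r; rewrite mem_iota => /andP[r1 _].
rewrite -sum_words big_mkcond [RHS]big_mkcond big_seq [RHS]big_seq.
apply: eq_bigr => W /words_mem[szW sub].
have W0 : W != [::] by case: (W) szW r1 => //= <-.
rewrite valid_szE // walk_costE szW -andbA.
have -> : last 0 (map (tgt T) W) = tgt T (last arc0 W).
  by case: (W) W0 => //= e W' _; rewrite last_map.
have lE : last arc0 W \in E by apply: sub; case: (W) W0 => // e W' _; rewrite /= mem_last.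
by rewrite vtx_tgt // tme_tgt.
Qed.
End Cost.
End Nodes.

(** * Betweenness as a weighted sum over shortest walks *)

Section Optimal.
Variables (n T : nat) (E : seq arc).
Hypothesis wfE : wf_tgraph n T E.
Variables (strict : bool) (ck : cost_kind) (s : nat).
Notation w := (weight n ck).
Notation succ := (tsucc T E strict (window T ck) s).
Notation edge := (fun x y => y \in succ x).
Variables (D S : nat -> nat) (B : nat).
Hypothesis DS : shortest_data succ D S.
Hypothesis leDB : forall x, D x <= B.

Let succN x y : y \in succ x -> 0 < y <= n * T.
Proof. exact: tsucc_bound. Qed.

Lemma has_walk_costP z c :
  reflect (exists p, [/\ p != [::], path edge 0 p, vtx T (last 0 p) = z
                       & w * tme T (last 0 p) + size p = c])
          (has_walk_cost strict ck n E s z c).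
Proof.
rewrite /has_walk_cost has_count -sum1_count.
rewrite (sum_words_cost wfE strict ck s z c (fun=> 1)).
apply: (iffP idP) => [|[p [p0 pp lp cp]]].
  rewrite lt0n sum_nat_seq_neq0 => /hasP[r]; rewrite mem_index_iota => /andP[r1 _] /=.
  rewrite sum_nat_seq_neq0 => /hasP[p]; rewrite mem_walks => /andP[/eqP szp pp].
  case/andP=> /andP[/eqP lp /eqP cp] _; exists p; split=> //; last by rewrite szp.
  by case: (p) szp r1 => //= <-.
rewrite (bigD1_seq (size p)) ?iota_uniq //=; last first.
  by rewrite mem_index_iota ltnS -cp leq_addl andbT; case: (p) p0.
rewrite addn_gt0; apply/orP; left; rewrite sum1_count -has_count; apply/hasP.
by exists p; [rewrite mem_walks eqxx | rewrite lp cp !eqxx].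
Qed.

(** Shifted by one like [D], with 0 for an unreachable target: the optimum becomes the least
    [w * tme T y + D y] over the reached temporal nodes [y] of [z]. *)
Definition optc z := if optcost strict ck n E s z is Some c then c.+1 else 0.

Lemma optcostP z :
  if optcost strict ck n E s z is Some c then
    has_walk_cost strict ck n E s z c /\
    forall c', has_walk_cost strict ck n E s z c' -> c <= c'
  else forall c, ~~ has_walk_cost strict ck n E s z c.
Proof.
rewrite /optcost; case: ClassicalEpsilon.excluded_middle_informative => [h|h].
  by case: ex_minnP => c hc mc; split.
by move=> c; apply/negP => hc; apply: h; exists c.
Qed.

Lemma optc_le y : 0 < y -> 0 < D y -> 0 < optc (vtx T y) <= w * tme T y + D y.
Proof.
move=> y0 Dy; have [p [szp pp lp]] := dist_walk DS Dy.
have hc : has_walk_cost strict ck n E s (vtx T y) (w * tme T y + (D y).-1).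
  apply/has_walk_costP; exists p; rewrite lp szp; split=> //.
  by case: (p) lp => // lp; move: y0; rewrite -lp.
rewrite /optc; have := optcostP (vtx T y); case: optcost => [c [_ /(_ _ hc)]|/(_ _)].
  by rewrite ltnS => h; rewrite -(prednK Dy) addnS ltnS.
by move/(_ (w * tme T y + (D y).-1)); rewrite hc.
Qed.

(** Walks with the same end have the same arrival time, so an optimal walk is a shortest one to its
    end. *)
Lemma optc_attained z : 0 < optc z ->
  exists y, [/\ 0 < y, 0 < D y, vtx T y = z & optc z = w * tme T y + D y].
Proof.
rewrite /optc; have := optcostP z; case: optcost => // c [hc mc] _.
case/has_walk_costP: (hc) => p [p0 pp lp cp].
have /andP[D1 D2] := dist_le DS pp.
have y0 : 0 < last 0 p.
  case: (p) p0 pp => //= y q _ /andP[/succN/andP[y0 _]].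
  elim: q y y0 => //= a q IH y y0 /andP[/succN/andP[a0 _]]; exact: IH.
have := optc_le y0 D1; rewrite lp {1 2}/optc.
have := optcostP z; case E1: optcost => [c'|]; last by move/(_ c); rewrite hc.
case=> hc' mc'; have cc' : c = c' by apply/eqP; rewrite eqn_leq mc // mc'.
rewrite /= -cc' => le; exists (last 0 p); split=> //.
apply/eqP; rewrite eqn_leq le /= -cp -addnS leq_add2l; exact: D2.
Qed.

Definition term z y := [&& 0 < y, 0 < D y, vtx T y == z & w * tme T y + D y == optc z].

Lemma path_last_gt0 p : path edge 0 p -> p != [::] -> 0 < last 0 p.
Proof.
case: p => //= y q /andP[/succN/andP[y0 _]] + _.
elim: q y y0 => //= a q IH y y0 /andP[/succN/andP[a0 _]]; exact: IH.
Qed.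

Local Open Scope ring_scope.

(** A walk attains the optimal cost exactly if it is shortest to its end [y] and [y] is an optimal
    end: neither [D y] nor [w * tme T y + D y] can go below its bound, so equality of the cost
    forces both. *)
Lemma sum_opt z c (F : seq nat -> rat) : optcost strict ck n E s z = Some c ->
  \sum_(W <- words_upto E c | valid_sz strict ck E s z W && (walk_cost n ck W == c))
      F (map (tgt T) W) =
  wsum succ D (fun y => (term z y)%:R) B 0 F.
Proof.
move=> oc; rewrite sum_words_cost // /wsum (dist0 DS).
have oz : optc z = c.+1 by rewrite /optc oc.
pose f r := \sum_(p <- walks succ r 0 |
  (vtx T (last 0%N p) == z) && (w * tme T (last 0%N p) + r == c)%N) F p.
pose g j := \sum_(q <- walks succ j 0 | D (last 0%N q) == (1 + j)%N)
  (term z (last 0%N q))%:R * F q.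
rewrite -[LHS]/(\sum_(1 <= r < c.+1) f r) -[RHS]/(\sum_(0 <= j < B) g j).
have gE r : (0 < r)%N -> g r = f r.
  move=> r0; rewrite /f /g big_mkcond [RHS]big_mkcond big_seq [RHS]big_seq.
  apply: eq_bigr => p; rewrite mem_walks => /andP[/eqP szp pp].
  have p0 : p != [::] by case: (p) szp r0 => // <-.
  have y0 := path_last_gt0 pp p0; have /andP[D1 D2] := dist_le DS pp.
  rewrite /term y0 D1 oz /=; case: (vtx T (last 0%N p) =P z) => [vz|_] /=; last by rewrite mul0r if_same.
  have /andP[_ le] := optc_le y0 D1; rewrite vz oz in le.
  have -> : (w * tme T (last 0 p) + r == c)%N =
      (D (last 0%N p) == (1 + r)%N) && (w * tme T (last 0%N p) + D (last 0%N p) == c.+1)%N.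
    rewrite szp in D2; move: D1 D2 le; set X := (w * _)%N; set Dy := D _ => D1 D2 le.
    by apply/eqP/andP => [h|[/eqP h1 /eqP h2]]; [split; apply/eqP; lia | lia].
  by case: eqP => // _ /=; case: eqP; rewrite ?mul1r ?mul0r.
have g0 : g 0%N = 0.
  by rewrite /g big_mkcond big_seq1 /term /= mul0r if_same.
have fbig r : (c < r)%N -> f r = 0.
  by move=> cr; rewrite /f big1 // => p /andP[_ /eqP]; lia.
have gbig r : (B <= r)%N -> g r = 0.
  by move=> Br; rewrite /g big1 // => p /eqP; have := leDB (last 0%N p); lia.
(* One sum ranges over the lengths [1, ..., c], the other over [0, ..., B - 1]. Both vanish outside,
   so they are compared on a common range. *)
pose M := maxn B c.+1.
have cM : (c.+1 <= M)%N by rewrite leq_maxr.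
have -> : \sum_(1 <= r < c.+1) f r = \sum_(1 <= r < M) f r.
  rewrite [RHS](big_cat_nat (n := c.+1)) //= [X in _ + X]big_nat_cond.
  by rewrite [X in _ + X]big1 ?addr0 // => r /andP[/andP[cr _] _]; apply: fbig.
have -> : \sum_(0 <= j < B) g j = \sum_(0 <= j < M) g j.
  rewrite [RHS](big_cat_nat (n := B)) ?leq_maxl //= [X in _ + X]big_nat_cond.
  by rewrite [X in _ + X]big1 ?addr0 // => r /andP[/andP[cr _] _]; apply: gbig.
rewrite [RHS]big_ltn ?g0 ?add0r; last exact: leq_trans cM.
by apply: eq_big_nat => r /andP[r0 _]; rewrite gE.
Qed.

Lemma term0 z y : optcost strict ck n E s z = None -> term z y = false.
Proof.
move=> oc; apply/negbTE/negP => /and4P[_ Dy _]; rewrite /optc oc addn_eq0.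
by rewrite (gtn_eqF Dy) andbF.
Qed.

Lemma sigma_wsum z :
  (sigma strict ck n E s z)%:R = wsum succ D (fun y => (term z y)%:R) B 0 (fun=> 1).
Proof.
rewrite /sigma; case oc: optcost => [c|]; last first.
  by rewrite /wsum big1 // => j _; rewrite big1 // => p _; rewrite term0 ?mul0r.
rewrite -(sum_opt (fun=> 1) oc) -sum1_count natr_sum.
by apply: eq_bigr => W _.
Qed.

Lemma sigmaE z :
  sigma strict ck n E s z = \sum_(0 <= y < (n * T).+1 | term z y) S y.
Proof.
apply/eqP; rewrite -(eqr_nat rat) sigma_wsum (wsum_ends succN _ DS leDB) natr_sum.
rewrite big_mkcond [X in _ == X]big_mkcond; apply/eqP/eq_bigr => y _.
by rewrite /term; case: (0 < D y)%N; rewrite ?andbF //=; case: ifP; rewrite ?mulr1 ?mulr0.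
Qed.

(** A walk ending at [y] serves the target [vtx T y] and no other, so one weight function covers all
    targets. Ends at the source weigh 0, as targets differ from [s]. *)
Definition tau y : rat :=
  if [&& (0 < y)%N, (0 < D y)%N, vtx T y != s
       & (w * tme T y + D y == optc (vtx T y))%N]
  then 1 / (sigma strict ck n E s (vtx T y))%:R else 0.

(** The departure from the source and the final stay are left out: they concern only the vertices
    [s] and [z], which [v] has to avoid. *)
Definition visp md v t (p : seq nat) :=
  if md is Passive then node T v t \in p
  else has (fun ab => (vtx T ab.1 == v) && (tme T ab.1 <= t <= tme T ab.2)%N) (zip p (behead p)).

Lemma visits_visp md v t z W : (0 < t <= T)%N -> v != s -> v != z ->
    valid_sz strict ck E s z W -> {subset W <= E} ->
  visits T md W v t = visp md v t (map (tgt T) W).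
Proof.
move=> ht vs vz vW sub; have W0 : W != [::] by case: (W) vW.
move: vW; rewrite /valid_sz /is_sz_walk => /and3P[_ /eqP hs /eqP hz].
rewrite /visits hs hz eq_sym (negbTE vs) (eq_sym z) (negbTE vz) /= orbF.
case: md => /=.
  apply/hasP/mapP => [[e eW /andP[/eqP de /eqP te]]|[e eW xe]].
    by exists e => //; rewrite /tgt de te.
  exists e => //; have eE := sub e eW.
  by rewrite -(vtx_tgt wfE eE) -(tme_tgt wfE eE) -xe vtx_node // tme_node // !eqxx.
elim: W sub {hs hz W0} => //= e [|e' W] IH sub //.
have eE : e \in E by apply: sub; rewrite mem_head.
have eE' : e' \in E by apply: sub; rewrite !inE eqxx orbT.
move: IH; rewrite /= => -> ; last by move=> a aW; apply: sub; rewrite inE aW orbT.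
by rewrite !(vtx_tgt wfE) // !(tme_tgt wfE).
Qed.

Lemma words_upto_sub c W : W \in words_upto E c -> {subset W <= E}.
Proof. by case/flattenP=> l /mapP[r _ ->] /words_mem[]. Qed.

Lemma delta_wsum md z v t : (0 < t <= T)%N -> v != s -> v != z ->
  delta strict ck n T E md s z v t =
  wsum succ D (fun y => (term z y)%:R / (sigma strict ck n E s z)%:R) B 0
       (fun p => (visp md v t p)%:R).
Proof.
move=> ht vs vz; rewrite /delta.
(* The case distinction disappears because division by 0 gives 0. *)
have -> : (if (0 < sigma strict ck n E s z)%N then
    (sigma_at strict ck n T E md s z v t)%:R / (sigma strict ck n E s z)%:R else 0) =
    ((sigma_at strict ck n T E md s z v t)%:R / (sigma strict ck n E s z)%:R : rat).
  by case: posnP => // ->; rewrite invr0 mulr0.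
set sg := (sigma _ _ _ _ _ _)%:R; rewrite /wsum.
transitivity (wsum succ D (fun y => (term z y)%:R) B 0 (fun p => (visp md v t p)%:R) / sg).
  congr (_ / sg); rewrite /sigma_at; case oc: optcost => [c|]; last first.
    by rewrite /wsum big1 // => j _; rewrite big1 // => p _; rewrite term0 ?mul0r.
  rewrite -(sum_opt _ oc) -sum1_count natr_sum big_mkcond [RHS]big_mkcond.
  rewrite big_seq [RHS]big_seq; apply: eq_bigr => W /words_upto_sub sub.
  rewrite andbA; case vW: (valid_sz _ _ _ _ _ _) => //=.
  rewrite (visits_visp _ ht vs vz vW sub); case: eqP => //= _.
  by case: visp.
rewrite mulr_suml; apply: eq_bigr => j _; rewrite mulr_suml; apply: eq_bigr => p _.
by rewrite mulrAC.
Qed.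

(** After exchanging the sums, each walk retains the single target at which it ends; the conditions
    on [z] become conditions on the last vertex, split between [tau] and the factor excluding
    [v]. *)
Lemma sum_delta md v t : (0 < t <= T)%N -> (s < n)%N ->
  \sum_(z < n | [&& s != v, (z : nat) != v & s != z])
     delta strict ck n T E md s z v t =
  if v == s then 0 else
  wsum succ D tau B 0 (fun p => (vtx T (last 0%N p) != v)%:R * (visp md v t p)%:R).
Proof.
move=> ht hs; case: (v =P s) => [->|/eqP vs]; first by rewrite big1 // => z; rewrite eqxx.
under eq_bigl do rewrite eq_sym vs /=.
under eq_bigr => z /andP[zv _] do rewrite delta_wsum // 1?eq_sym //.
rewrite exchange_big; apply: eq_bigr => j _; rewrite exchange_big.
rewrite big_seq_cond [RHS]big_seq_cond; apply: eq_bigr => p /andP[].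
rewrite mem_walks => /andP[_ pp] _ /=; rewrite mulrA -mulr_suml; congr (_ * _).
set y := last 0%N p.
have [y0|y0] := posnP y.
  by rewrite big1 ?/tau y0 ?mul0r // => z _; rewrite /term mul0r.
have yN : (y <= n * T)%N by apply: (last_path_le succN).
have vn : (vtx T y < n)%N by apply: vtx_bound; rewrite y0.
rewrite /tau y0 /=; have /andP[-> _] := dist_le DS pp => /=.
have [yv|yv] := eqVneq (vtx T y) v.
  rewrite mulr0 big1 // => z /andP[zv _]; rewrite /term yv eq_sym (negbTE zv).
  by rewrite !andbF mul0r.
have [ys|ys] := eqVneq (vtx T y) s.
  rewrite mul0r big1 // => z /andP[_ sz]; rewrite /term ys (negbTE sz).
  by rewrite !andbF mul0r.
rewrite mulr1 (bigD1 (Ordinal vn)) /=; last by rewrite yv eq_sym.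
rewrite big1 ?addr0; last first.
  move=> z /andP[_ zy]; rewrite /term [vtx T y == z](negbTE _) ?andbF ?mul0r //.
  by rewrite eq_sym.
rewrite /term y0 eqxx /=; have /andP[-> _] := dist_le DS pp => /=.
by case: eqP => _; rewrite ?mul1r ?mul0r.
Qed.
End Optimal.

(** * Visits to a temporal node as sums over shortest walks *)

Section Values.
Variables (n T : nat) (E : seq arc).
Hypothesis wfE : wf_tgraph n T E.
Variables (strict : bool) (ck : cost_kind) (s : nat).
Notation w := (weight n ck).
Notation K := (window T ck).
Notation succ := (tsucc T E strict K s).
Notation edge := (fun x y => y \in succ x).
Variables (D S : nat -> nat) (B : nat).
Hypothesis DS : shortest_data succ D S.
Hypothesis leDB : forall x, D x <= B.
Notation tau := (tau n T E strict ck s D).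

Let succN x y : y \in succ x -> 0 < y <= n * T.
Proof. exact: tsucc_bound. Qed.

Lemma edge_tme d k r (a b : nat) : 0 < a -> b \in tsucc T E d k r a ->
  0 < b /\ tme T a + d <= tme T b <= tme T a + k.
Proof.
move=> a0 ba; have /andP[b0 _] := tsucc_bound wfE ba; split=> //.
have [e eE [-> _]] := mem_tsucc ba; rewrite (tme_tgt wfE) // /allowed /lo /hi.
by rewrite (gtn_eqF a0).
Qed.

Lemma path_tme d k r (a : nat) (q : seq nat) : 0 < a -> path (fun x y => y \in tsucc T E d k r x) a q ->
  0 < last a q /\ tme T a <= tme T (last a q).
Proof.
elim: q a => [|b q IH] a a0 //= /andP[/(edge_tme a0)[b0 /andP[ab _]] bq].
have [-> le] := IH _ b0 bq; split=> //; apply: leq_trans le.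
exact: leq_trans (leq_addr _ _) ab.
Qed.

Lemma nth_belast (y : nat) (q : seq nat) i : i < size q -> nth 0 (belast y q) i = last y (take i q).
Proof. by elim: q y i => //= z q IH y [|i] //=; rewrite ltnS; apply: IH. Qed.

Lemma mem_belast (p : seq nat) (a : nat) : a \in belast 0 p ->
  exists2 i, i < size p & a = last 0 (take i p).
Proof.
move=> /(nthP 0)[i]; rewrite size_belast => ip <-; by exists i; rewrite ?nth_belast.
Qed.

(** An earlier temporal node of the last vertex would have a time no later and a smaller distance,
    hence be a strictly cheaper end. *)
Lemma tau_nonlast (p : seq nat) (a : nat) : path edge 0 p -> D (last 0 p) = (size p).+1 ->
    tau (last 0 p) != 0%R -> a \in belast 0 p -> 0 < a ->
  vtx T a != vtx T (last 0 p).
Proof.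
move=> pp Dp + /mem_belast[i ip ai] a0; rewrite /tau.
case: ifP => [/and4P[_ _ _ /eqP opt] _|_ /eqP//].
have Da : D a = i.+1 by rewrite ai; apply: (dist_prefix DS) => //; apply: ltnW.
have Da0 : 0 < D a by rewrite Da.
have /andP[_ le] := optc_le wfE DS a0 Da0; apply/eqP => va.
have /path_tme : path edge a (drop i p).
  by move: pp; rewrite -{1}(cat_take_drop i p) cat_path -ai => /andP[].
rewrite ai -last_cat cat_take_drop -ai => /(_ a0)[_ ta].
have := leq_mul (leqnn w) ta; rewrite va -opt Dp Da in le.
by move: le ip; move: (_ * _) (_ * _) => X Y; lia.
Qed.

Definition through x (p : seq nat) := (D x <= size p) && (last 0 (take (D x).-1 p) == x).

Lemma throughE (p : seq nat) (x : nat) : path edge 0 p -> D (last 0 p) = (size p).+1 -> 0 < D x ->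
  through x p = (x \in belast 0 p).
Proof.
move=> pp Dp Dx; apply/andP/idP => [[le /eqP xl]|/mem_belast[i ip xi]].
  have lt : (D x).-1 < size p by rewrite prednK.
  by rewrite -{1}xl -nth_belast // mem_nth // size_belast.
have Di : D x = i.+1 by rewrite xi; apply: (dist_prefix DS) => //; apply: ltnW.
by rewrite Di /= -xi.
Qed.

Lemma belast_dist (p : seq nat) (x : nat) : path edge 0 p -> D (last 0 p) = (size p).+1 ->
  x \in belast 0 p -> 0 < D x.
Proof.
move=> pp Dp /mem_belast[i ip ->]; rewrite (dist_prefix DS) //; exact: ltnW.
Qed.

Section Point.
Variables (v t : nat).
Hypotheses (vn : v < n) (ht : 0 < t <= T).
Notation x := (node T v t).

Let x_gt0 : 0 < x.
Proof. by have /andP[] := node_bound vn ht. Qed.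

Lemma mem_belast_node (p : seq nat) : vtx T (last 0 p) != v -> (x \in belast 0 p) = (x \in p).
Proof.
move=> lv; have := lastI 0 p; move/(congr1 (fun q => x \in q)).
rewrite inE (gtn_eqF x_gt0) mem_rcons inE /= => ->.
by case: (x =P last 0 p) lv => // <-; rewrite vtx_node ?eqxx.
Qed.

(** Open on the left: the time [tme T a] is accounted for by the visit to [a] itself. The condition
    [0 < a] excludes the root, which has no time. *)
Definition waits a b := [&& 0 < a, vtx T a == v & tme T a < t <= tme T b].

Lemma npairs_waits0 (a : nat) (p : seq nat) : 0 < a -> path edge a p -> t <= tme T a -> npairs waits a p = 0.
Proof.
elim: p a => [|b p IH] a a0 //= /andP[/(edge_tme a0)[b0 /andP[ab _]] bp] ta.
have tb : t <= tme T b by rewrite (leq_trans ta) // (leq_trans _ ab) ?leq_addr.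
by rewrite npairs_cons IH // /waits (ltnNge (tme T a)) ta !andbF.
Qed.

(** Times do not decrease along a walk: after a wait through [t], every later wait starts at [t] or
    afterwards. *)
Lemma npairs_waits_le1 (a : nat) (p : seq nat) : path edge a p -> npairs waits a p <= 1.
Proof.
elim: p a => [|b p IH] a //= /andP[ab bp]; rewrite npairs_cons.
case wab: (waits a b); last exact: IH.
case/and3P: wab => a0 _ /andP[_ tb]; have [b0 _] := edge_tme a0 ab.
by rewrite npairs_waits0.
Qed.

Lemma visp_active (p : seq nat) : path edge 0 p ->
  visp T Active v t p = (x \in belast 0 p) || (0 < npairs waits 0 p).
Proof.
pose Q a b := [&& 0 < a, vtx T a == v & tme T a <= t <= tme T b].
have QE a q : path edge a q ->
    has (fun ab => Q ab.1 ab.2) (zip (a :: q) q) = (x \in belast a q) || (0 < npairs waits a q).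
  elim: q a => [|b q IH] a //= /andP[ab bq]; rewrite IH // inE npairs_cons addn_gt0 lt0b.
  have -> : Q a b = (x == a) || waits a b.
    rewrite /Q /waits; case: posnP => [->|a0] /=; first by rewrite orbF (gtn_eqF x_gt0).
    have [_ /andP[tab _]] := edge_tme a0 ab.
    apply/idP/idP => [/and3P[/eqP va ta tb]|/orP[/eqP xa|/and3P[-> /ltnW-> //]]].
      rewrite va eqxx tb andbT /=; case: (ltngtP (tme T a) t) ta => // [_ _|tat _].
        by rewrite orbT.
      by rewrite -[x == a]/(node T v t == a) -va -tat node_vtx ?eqxx.
    rewrite -xa vtx_node // tme_node // eqxx leqnn /=; rewrite -xa tme_node // in tab.
    exact: leq_trans (leq_addr _ _) tab.
  by rewrite orbACA.
move=> pp; rewrite -QE //; case: p pp => // y p /= /andP[/succN/andP[y0 _]].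
elim: p y y0 => //= z p IH y y0 /andP[/succN/andP[z0 _] zp].
by rewrite /Q y0 /= -(IH z z0 zp).
Qed.

Local Open Scope ring_scope.

Variable U : nat -> rat.
Hypothesis UE : forall y, (0 < D y)%N ->
  U y = \sum_(b <- succ y | D b == (D y).+1) (tau b + U b).

Lemma hval_U y : (0 < D y)%N -> hval succ D tau B y = tau y + U y.
Proof. by move=> Dy; rewrite (hval_unique DS leDB UE). Qed.

Lemma wsum_through_U (G : seq nat -> rat) : (0 < D x)%N ->
  wsum succ D tau B 0 (fun p => (through x p)%:R * G (take (D x).-1 p)) =
  (\sum_(p <- walks succ (D x).-1 0 | last 0%N p == x) G p) * U x.
Proof. by move=> Dx; rewrite (wsum_through _ DS leDB) // hval_U // addrC addKr. Qed.

(** By [tau_nonlast], a walk of nonzero weight ending at [v] has no node of [v] before its end. So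
    the factor excluding such walks amounts to looking for [x] before the end only, and
    [wsum_through] applies with a constant factor. *)
Lemma passive_value :
  wsum succ D tau B 0
    (fun p => (vtx T (last 0%N p) != v)%:R * (visp T Passive v t p)%:R) =
  if (0 < D x)%N then (S x)%:R * U x else 0.
Proof.
case: ifP => Dx; last first.
  rewrite (@eq_wsum _ _ _ _ _ _ (fun=> 0 * 0)) ?wsumZ ?mul0r // => p pp + _.
  rewrite (dist0 DS) add1n => Dp; rewrite ?mul0r.
  case: eqP => [|/eqP lv]; rewrite ?mul0r // mul1r /= -mem_belast_node //.
  by case xb: (x \in _) => //; rewrite (belast_dist pp Dp xb) in Dx.
rewrite (count_shortest DS Dx) nwalksE natr_sum -wsum_through_U //.
apply: eq_wsum => p pp; rewrite (dist0 DS) add1n => Dp tp.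
rewrite mulr1 throughE //.
case: (vtx T (last 0%N p) =P v) => [lv|/eqP lv]; last by rewrite /= mul1r mem_belast_node.
rewrite mul0r; case xb: (x \in _) => //.
by have := tau_nonlast pp Dp tp xb x_gt0; rewrite lv vtx_node ?eqxx.
Qed.

(** Inclusion and exclusion for arriving at [x] and waiting through [t]. If both happen, the wait
    precedes the arrival, because no wait after [x] starts before [t]; so it is visible in the
    prefix up to [x], and the intersection factors by [wsum_through]. *)
Lemma active_value :
  wsum succ D tau B 0
    (fun p => (vtx T (last 0%N p) != v)%:R * (visp T Active v t p)%:R) =
  (if (0 < D x)%N then
     ((S x)%:R - \sum_(p <- walks succ (D x).-1 0 | last 0%N p == x) (npairs waits 0 p)%:R) * U x
   else 0)
  + \sum_(0 <= a < (n * T).+1 | (0 < D a)%N) (S a)%:R *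
      \sum_(b <- succ a | D b == (D a).+1) (waits a b)%:R * (tau b + U b).
Proof.
have -> : \sum_(0 <= a < (n * T).+1 | (0 < D a)%N) (S a)%:R *
      \sum_(b <- succ a | D b == (D a).+1) (waits a b)%:R * (tau b + U b) =
    wsum succ D tau B 0 (fun p => (npairs waits 0 p)%:R).
  rewrite (wsum_npairs succN _ DS leDB); apply: eq_bigr => a Da; congr (_ * _).
  by apply: eq_bigr => b /eqP Db; rewrite hval_U ?Db.
have main p : path edge 0%N p -> D (last 0%N p) = (size p).+1 -> tau (last 0%N p) != 0 ->
    (vtx T (last 0%N p) != v)%:R * (visp T Active v t p)%:R =
    ((x \in belast 0%N p) || (0 < npairs waits 0 p)%N)%:R :> rat.
  move=> pp Dp tp; rewrite visp_active //; case: eqP => [lv|_]; last by rewrite mul1r.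
  rewrite mul0r; case: orP => // -[xb|].
    by have := tau_nonlast pp Dp tp xb x_gt0; rewrite lv vtx_node ?eqxx.
  rewrite -has_count => /hasP[[a b] ab /and3P[a0 /eqP va _]].
  have ap : a \in belast 0%N p.
    have : a \in unzip1 (zip (0%N :: p) p) by apply/mapP; exists (a, b).
    by elim: (p) 0%N => //= c q IH y; rewrite !inE => /orP[->//|/IH->]; rewrite orbT.
  by have := tau_nonlast pp Dp tp ap a0; rewrite va lv eqxx.
case: ifP => Dx; last first.
  rewrite add0r; apply: eq_wsum => p pp; rewrite (dist0 DS) add1n => Dp tp; rewrite main //.
  case xb: (x \in _); first by rewrite (belast_dist pp Dp xb) in Dx.
  by have := npairs_waits_le1 pp; case: (npairs _ _ _) => [|[]].
rewrite mulrBl (count_shortest DS Dx) nwalksE natr_sum -!wsum_through_U //.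
rewrite -[X in _ - X]mul1r -mulNr -wsumZ -!wsumD.
apply: eq_wsum => p pp; rewrite (dist0 DS) add1n => Dp tp; rewrite main //.
rewrite throughE //; have := npairs_waits_le1 pp.
case xb: (x \in _); last by rewrite !mul0r mulr0 !add0r; case: (npairs _ _ _) => [|[]].
have -> : npairs waits 0 (take (D x).-1 p) = npairs waits 0 p.
  have thr : through x p by rewrite throughE.
  case/andP: thr => le /eqP lx.
  have nd : npairs waits x (drop (D x).-1 p) = 0%N.
    apply: npairs_waits0 => //; last by rewrite tme_node.
    by move: pp; rewrite -{1}(cat_take_drop (D x).-1 p) cat_path lx => /andP[].
  by rewrite -[in RHS](cat_take_drop (D x).-1 p) npairs_cat lx nd addn0.
by rewrite mulr1 mul1r mulN1r subrK.
Qed.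
End Point.
End Values.

(** * Walks that wait through a time and then return at that time *)

Section DoubleVisits.
Variables (n T : nat) (E : seq arc).
Hypothesis wfE : wf_tgraph n T E.
Variables (strict : bool) (K s : nat).
Notation succ := (tsucc T E strict K s).
Variables (D S : nat -> nat) (B : nat).
Hypothesis DS : shortest_data succ D S.
Hypothesis leDB : forall x, D x <= B.
Variables (v t : nat).
Hypotheses (vn : v < n) (ht : 0 < t <= T).
Notation x := (node T v t).
Notation succ0 := (tsucc T E strict 0 v).
Variables D0 S0 : nat -> nat.
Hypothesis DS0 : shortest_data succ0 D0 S0.

Let succN y z : z \in succ y -> 0 < z <= n * T.
Proof. exact: tsucc_bound. Qed.

Let x_gt0 : 0 < x.
Proof. by have /andP[] := node_bound vn ht. Qed.

Lemma sum_tsucc d k r y (f : nat -> nat) :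
  \sum_(z <- tsucc T E d k r y) f z =
  \sum_(e <- out E (ux T r y) | allowed T d k y e) f (tgt T e).
Proof. by rewrite big_map big_filter. Qed.

Lemma nwalks_tme d k r j y : 0 < y -> 0 < nwalks (tsucc T E d k r) j y x -> tme T y <= t.
Proof.
move=> y0 /nwalks_gt0[p [_ py lp]].
by have [_] := path_tme wfE y0 py; rewrite lp tme_node.
Qed.

Lemma nwalks0_tme d r j y : 0 < y -> 0 < nwalks (tsucc T E d 0 r) j y x -> tme T y = t.
Proof.
move=> y0 h; apply/eqP; rewrite eqn_leq (nwalks_tme y0 h) /=.
case/nwalks_gt0: h => p [_ + lp]; rewrite -(tme_node v ht) -lp.
elim: p y y0 {lp} => //= z p IH y y0 /andP[/(edge_tme wfE y0)[z0]].
by rewrite addn0 => /andP[_ le] /(IH z z0) h; apply: leq_trans le.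
Qed.

(* From time [t] on, only arcs at time [t] can lead back to time [t], whatever the
   waiting window is. *)
Lemma nwalks_same_time j y : 0 < y -> tme T y = t ->
  nwalks succ j y x = nwalks succ0 j y x.
Proof.
elim: j y => [//|j IH] y y0 ty; rewrite !nwalksS !sum_tsucc.
rewrite /ux (gtn_eqF y0) big_mkcond [RHS]big_mkcond big_seq [RHS]big_seq.
apply: eq_bigr => e; rewrite mem_filter => /andP[_ eE].
have te := tgt_gt0 wfE eE; rewrite -lt0n in te.
rewrite /allowed /lo /hi (gtn_eqF y0) ty addn0.
case: (ltngtP (tim e) t) => [lt|gt|et].
- by rewrite (leqNgt (t + _)) (leq_trans lt) ?leq_addr.
- have -> : nwalks succ j (tgt T e) x = 0.
    apply/eqP; rewrite -leqn0 leqNgt; apply/negP => /(nwalks_tme te).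
    by rewrite (tme_tgt wfE) // leqNgt gt.
  by rewrite if_same andbF.
- by rewrite et leq_addr ?leqnn IH ?(tme_tgt wfE).
Qed.

Variable t' : nat.
Hypotheses (t'_gt0 : 0 < t') (t't : t' < t).
Notation a := (node T v t').
Hypothesis Da : 0 < D a.

Let ht' : 0 < t' <= T.
Proof. by rewrite t'_gt0 (leq_trans (ltnW t't)) //; case/andP: ht. Qed.

Let a_gt0 : 0 < a.
Proof. by have /andP[] := node_bound vn ht'. Qed.

Let allowed_a e : tim e = t -> allowed T strict K a e = (t <= t' + K).
Proof.
move=> et; rewrite /allowed /lo /hi (gtn_eqF a_gt0) tme_node // et.
by rewrite (leq_trans _ t't) // -addn1 leq_add2l; case: strict.
Qed.

Let ux_a : ux T s a = v.
Proof. by rewrite /ux (gtn_eqF a_gt0) vtx_node. Qed.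

(** A walk that leaves [v] at time [t] or later and is back at [(v, t)] uses only arcs at time [t].
    Conversely, the root of [succ0] allows every first arc, but without waiting only one at time [t]
    can lead to [x]. *)
Lemma nwalks_return j : t <= t' + K -> nwalks succ0 j.+1 0 x =
  \sum_(b <- succ a | t <= tme T b) nwalks succ j b x.
Proof.
move=> win; rewrite nwalksS [RHS]big_mkcond !sum_tsucc ux_a /=.
rewrite big_mkcond [RHS]big_mkcond big_seq [RHS]big_seq.
apply: eq_bigr => e; rewrite mem_filter => /andP[_ eE].
have te := tgt_gt0 wfE eE; rewrite -lt0n in te; rewrite (tme_tgt wfE) //.
have -> : allowed T strict 0 0 e.
  by rewrite /allowed /lo /hi /=; case: (arcP wfE eE) => _ _ _ /andP[].
case: (ltngtP (tim e) t) => [lt|gt|et].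
- rewrite if_same; apply/eqP; rewrite -leqn0 leqNgt; apply/negP => /(nwalks0_tme te).
  by rewrite (tme_tgt wfE) // => et; rewrite et ltnn in lt.
- have -> : nwalks succ j (tgt T e) x = 0.
    apply/eqP; rewrite -leqn0 leqNgt; apply/negP => /(nwalks_tme te).
    by rewrite (tme_tgt wfE) // leqNgt gt.
  rewrite if_same; apply/eqP; rewrite -leqn0 leqNgt; apply/negP => /(nwalks0_tme te).
  by rewrite (tme_tgt wfE) // => et; rewrite et ltnn in gt.
- by rewrite allowed_a // win nwalks_same_time ?(tme_tgt wfE).
Qed.

(** The value of [hval] at [b] when the whole weight sits at [x]. *)
Definition tight_walks b := if D b <= D x then nwalks succ (D x - D b) b x else 0.

Hypothesis Dx : 0 < D x.

(** A cycle shorter than the gap between [a] and [x] would shorten the way to [x]. So the cycles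
    filling the gap are shortest cycles, or there are none. [D] and [D0] both carry a shift by one,
    which gives the successor in [(D x).+1 == D a + D0 x]. *)
Lemma tight_return :
  \sum_(b <- succ a | D b == (D a).+1) waits T v t a b * tight_walks b =
  if [&& t <= t' + K, 0 < D0 x & (D x).+1 == D a + D0 x] then S0 x else 0.
Proof.
(* The value 1 belongs to the root alone: a walk to [x] has at least one arc. *)
have D0x : D0 x != 1.
  apply/eqP => e1; have [p [sp _ lp]] := dist_walk DS0 (eq_leq (esym e1)).
  by move: sp lp; rewrite e1; case: p => // _ /= x0; have := x_gt0; rewrite -x0.
have waitsE b : waits T v t a b = (t <= tme T b).
  by rewrite /waits a_gt0 vtx_node // tme_node // eqxx t't.
have [win|nwin] := leqP t (t' + K); last first.
  rewrite big_seq_cond big1 // => b /andP[ba _]; rewrite waitsE.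
  have [_ /andP[_ hb]] := edge_tme wfE a_gt0 ba; rewrite tme_node // in hb.
  by rewrite leqNgt (leq_ltn_trans hb nwin).
have step j : 0 < nwalks succ0 j.+1 0 x -> D x <= D a + j.+1.
  rewrite (nwalks_return _ win) lt0n sum_nat_seq_neq0 => /hasP[b ba /andP[_]].
  rewrite -lt0n => /nwalks_gt0[p [sp pb lp]].
  have /andP[Db1 Db2] := dist_edge DS Da ba.
  by have /andP[_] := dist_path DS Db1 pb; rewrite lp sp => h; lia.
have [Dle|Dlt] := leqP (D x) (D a).
  rewrite big1 => [|b /eqP Db]; last by rewrite /tight_walks Db leqNgt ltnS Dle muln0.
  case: ifP => // /and3P[_ D0x0 /eqP h].
  by exfalso; move: D0x D0x0 h Dle; lia.
have [j jE] : exists j, D x - D a = j.+1 by exists (D x - D a).-1; rewrite prednK // subn_gt0.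
have -> : \sum_(b <- succ a | D b == (D a).+1) waits T v t a b * tight_walks b =
    nwalks succ0 j.+1 0 x.
  rewrite (nwalks_return _ win) big_mkcond [RHS]big_mkcond big_seq [RHS]big_seq.
  apply: eq_bigr => b ba; rewrite waitsE; have /andP[Db1 Db2] := dist_edge DS Da ba.
  case: eqP => [Db|/eqP nDb].
    rewrite /tight_walks Db Dlt (_ : D x - _ = j); last by lia.
    by case: ifP; rewrite ?mul1n ?mul0n.
  case: ifP => // _; apply/esym/eqP; rewrite -leqn0 leqNgt; apply/negP.
  case/nwalks_gt0=> p [sp pb lp]; have /andP[_] := dist_path DS Db1 pb.
  by rewrite lp sp; move: nDb Db1 Db2 jE; lia.
have -> : ((D x).+1 == D a + D0 x) = (D0 x == j.+2) by apply/eqP/eqP; lia.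
have [le0|gt0] := posnP (nwalks succ0 j.+1 0 x).
  rewrite le0 /=; case: ifP => // /andP[D0x0 /eqP D0E].
  by rewrite (count_shortest DS0 D0x0) D0E le0.
case/nwalks_gt0: (gt0) => p [sp pp lp]; have := dist_le DS0 pp; rewrite lp sp.
case/andP=> D0x0 D0le; rewrite D0x0 /=.
have D0E : D0 x = j.+2.
  apply/eqP; rewrite eqn_leq D0le /= leqNgt; apply/negP => lt.
  case D0j: (D0 x) D0x0 D0x lt => [|[|k]] // _ _ lt.
  have := dist_attained DS0 (y := x); rewrite (count_shortest DS0) D0j // => /(_ isT)/step.
  by move: lt jE; lia.
by rewrite D0E eqxx (count_shortest DS0 D0x0) D0E.
Qed.
End DoubleVisits.

Section Assembly.
Variables (n T : nat) (E : seq arc).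
Hypothesis wfE : wf_tgraph n T E.
Variables (strict : bool) (ck : cost_kind) (s : nat).
Notation K := (window T ck).
Notation succ := (tsucc T E strict K s).
Variables (D S : nat -> nat) (B : nat).
Hypothesis DS : shortest_data succ D S.
Hypothesis leDB : forall x, D x <= B.
Variables (v t : nat).
Hypotheses (vn : v < n) (ht : 0 < t <= T).
Notation x := (node T v t).
Variables D0 S0 : nat -> nat.
Hypothesis DS0 : shortest_data (tsucc T E strict 0 v) D0 S0.

Let succN y z : z \in succ y -> 0 < z <= n * T.
Proof. exact: tsucc_bound. Qed.

Let T_gt0 : 0 < T.
Proof. by case/andP: ht => t0 /(leq_trans t0). Qed.

Local Open Scope ring_scope.

Lemma hval_tight b : (0 < D x)%N ->
  hval succ D (fun y => (y == x)%:R) B b = (tight_walks T E strict K s D v t b)%:R.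
Proof.
move=> Dx; rewrite /hval /wsum /fuel /tight_walks.
have zero j : (D b + j)%N != D x ->
    \sum_(q <- walks succ j b | D (last b q) == (D b + j)%N) (last b q == x)%:R * 1 = 0 :> rat.
  move=> nj; rewrite big1 // => q /eqP Dq; case: eqP => [lx|_]; last by rewrite mul0r.
  by move: nj; rewrite -Dq lx eqxx.
case: leqP => [le|lt]; last first.
  by rewrite big_nat_cond big1 // => j _; apply: zero; lia.
rewrite (bigD1_seq (D x - D b)%N) ?iota_uniq //=; last first.
  by rewrite mem_index_iota; have := leDB x; lia.
rewrite [X in _ + X]big1 ?addr0 => [|j nj]; last by apply: zero; move: nj le; lia.
rewrite nwalksE natr_sum big_mkcond [RHS]big_mkcond; apply: eq_bigr => q _ /=.
rewrite subnKC //; case: (last b q =P x) => [->|_]; first by rewrite eqxx mul1r.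
by rewrite mul0r if_same.
Qed.

(** Pairs of a shortest walk to [(v, t')] and a shortest cycle at time [t], over those [t'] for
    which their concatenation is an admissible shortest walk to [(v, t)]. *)
Definition double_visits : nat := \sum_(1 <= t' < t)
  (if [&& 0 < D (node T v t'), t <= t' + K, 0 < D0 x & (D x).+1 == D (node T v t') + D0 x]
   then S (node T v t') * S0 x else 0)%N.

(** An instance of [wsum_npairs] for the weight concentrated at [x]; only pairs starting at [v]
    before time [t] survive. *)
Lemma sum_npairs_double : (0 < D x)%N ->
  \sum_(p <- walks succ (D x).-1 0 | last 0%N p == x) (npairs (waits T v t) 0 p)%:R =
  double_visits%:R :> rat.
Proof.
move=> Dx; set tau' := fun y => (y == x)%:R : rat.
transitivity (wsum succ D tau' B 0 (fun p => (npairs (waits T v t) 0 p)%:R)).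
  rewrite /wsum (dist0 DS) (bigD1_seq (D x).-1) ?iota_uniq //=; last first.
    by rewrite mem_index_iota; have := leDB x; lia.
  rewrite [X in _ + X]big1 ?addr0 => [|j nj]; last first.
    rewrite big1 // => p /eqP Dp; rewrite /tau'; case: eqP => [lx|_]; last by rewrite mul0r.
    by move: nj; rewrite -lx Dp add1n eqxx.
  rewrite add1n prednK // big_mkcond [RHS]big_mkcond; apply: eq_bigr => p _.
  rewrite /tau'; case: (last 0%N p =P x) => [->|_]; first by rewrite eqxx mul1r.
  by rewrite mul0r if_same.
rewrite (wsum_npairs succN _ DS leDB) big_mkcond.
rewrite (sum_vertex vn T_gt0) /=; last first.
- move=> a a0 va; case: ifP => // _; rewrite big1 ?mulr0 // => b _.
  by rewrite /waits (negbTE va) andbF mul0r.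
- rewrite (dist0 DS) /= big1 ?mulr0 // => b _; rewrite /waits /=; by rewrite mul0r.
rewrite (big_cat_nat (n := t)) //=; [|by case/andP: ht|by case/andP: ht => _ /leqW].
rewrite [X in _ + X]big_nat_cond [X in _ + X]big1 ?addr0; last first.
  move=> t' /andP[/andP[tt' t'T] _]; case: ifP => // _; rewrite big1 ?mulr0 // => b _.
  rewrite /waits vtx_node ?tme_node; try lia.
  by rewrite (ltnNge t') tt' /= !andbF mul0r.
rewrite natr_sum; apply: eq_big_nat => t' /andP[t'0 t't].
case: ifP => //= Da.
transitivity ((S (node T v t'))%:R * (\sum_(b <- succ (node T v t') | D b == (D (node T v t')).+1)
     waits T v t (node T v t') b * tight_walks T E strict K s D v t b)%N%:R : rat).
  congr (_ * _); rewrite natr_sum; apply: eq_bigr => b _.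
  by rewrite hval_tight // natrM.
by rewrite (tight_return wfE DS vn ht DS0) //; case: ifP; rewrite ?natrM ?mulr0.
Qed.

Lemma active_total (U : nat -> rat) :
    (forall y, (0 < D y)%N ->
       U y = \sum_(b <- succ y | D b == (D y).+1) (tau n T E strict ck s D b + U b)) ->
  wsum succ D (tau n T E strict ck s D) B 0
    (fun p => (vtx T (last 0%N p) != v)%:R * (visp T Active v t p)%:R) =
  (if (0 < D x)%N then ((S x)%:R - double_visits%:R) * U x else 0)
  + \sum_(1 <= t' < T.+1 | (0 < D (node T v t'))%N) (S (node T v t'))%:R *
      \sum_(b <- succ (node T v t') | D b == (D (node T v t')).+1)
         (t' < t <= tme T b)%N%:R * (tau n T E strict ck s D b + U b).
Proof.
move=> UE; rewrite (active_value wfE DS leDB vn ht UE); congr (_ + _).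
  by case: ifP => // Dx; rewrite sum_npairs_double.
rewrite big_mkcond (sum_vertex vn T_gt0) /=; last first.
- move=> a a0 va; case: ifP => // _; rewrite big1 ?mulr0 // => b _.
  by rewrite /waits (negbTE va) andbF mul0r.
- by rewrite (dist0 DS) /= big1 ?mulr0 // => b _; rewrite /waits mul0r.
rewrite [RHS]big_mkcond; apply: eq_big_nat => t' h.
case: ifP => // _; congr (_ * _); apply: eq_bigr => b _.
rewrite /waits vtx_node ?tme_node; try lia.
by have /andP[-> _] := node_bound vn h; rewrite eqxx.
Qed.
End Assembly.

(** * Reasoning about structured programs *)

Fixpoint nv_writes c : seq nat :=
  match c with
  | NSet v _ => [:: v]
  | Seq c1 c2 | If _ c1 c2 => nv_writes c1 ++ nv_writes c2
  | For v _ c1 => v :: nv_writes c1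
  | _ => [::]
  end.

Fixpoint na_writes c : seq nat :=
  match c with
  | NPut a _ _ => [:: a]
  | Seq c1 c2 | If _ c1 c2 => na_writes c1 ++ na_writes c2
  | For _ _ c1 => na_writes c1
  | _ => [::]
  end.

Fixpoint rv_writes c : seq nat :=
  match c with
  | RSet v _ => [:: v]
  | Seq c1 c2 | If _ c1 c2 => rv_writes c1 ++ rv_writes c2
  | For _ _ c1 => rv_writes c1
  | _ => [::]
  end.

Fixpoint ra_writes c : seq nat :=
  match c with
  | RPut a _ _ => [:: a]
  | Seq c1 c2 | If _ c1 c2 => ra_writes c1 ++ ra_writes c2
  | For _ _ c1 => ra_writes c1
  | _ => [::]
  end.

Record frame c st st' : Prop := Frame {
  frame_nv : forall v, v \notin nv_writes c -> nv st' v = nv st v;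
  frame_na : forall a, a \notin na_writes c -> na st' a = na st a;
  frame_rv : forall v, v \notin rv_writes c -> rv st' v = rv st v;
  frame_ra : forall a, a \notin ra_writes c -> ra st' a = ra st a
}.

Lemma frame_trans c st1 st2 st3 : frame c st1 st2 -> frame c st2 st3 -> frame c st1 st3.
Proof.
move=> f g; split=> i hi.
- by rewrite (frame_nv g) // (frame_nv f).
- by rewrite (frame_na g) // (frame_na f).
- by rewrite (frame_rv g) // (frame_rv f).
- by rewrite (frame_ra g) // (frame_ra f).
Qed.

Lemma frame_weaken c c' st st' :
    {subset nv_writes c <= nv_writes c'} -> {subset na_writes c <= na_writes c'} ->
    {subset rv_writes c <= rv_writes c'} -> {subset ra_writes c <= ra_writes c'} ->
  frame c st st' -> frame c' st st'.
Proof.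
move=> h1 h2 h3 h4 f; split=> i hi.
- by rewrite (frame_nv f) //; apply: contra hi => /h1.
- by rewrite (frame_na f) //; apply: contra hi => /h2.
- by rewrite (frame_rv f) //; apply: contra hi => /h3.
- by rewrite (frame_ra f) //; apply: contra hi => /h4.
Qed.

Lemma frame_run c st : frame c st (run c st).
Proof.
elim: c st => [|v e|a i e|v r|a i r|c1 IH1 c2 IH2|e c1 IH1 c2 IH2|v e c1 IH1] st /=.
- by [].
- by split=> //= u; rewrite inE /fupd => /negbTE->.
- by split=> //= u; rewrite inE /fupd => /negbTE->.
- by split=> //= u; rewrite inE /fupd => /negbTE->.
- by split=> //= u; rewrite inE /fupd => /negbTE->.
- have f1 : frame (Seq c1 c2) st (run c1 st).
    by apply: frame_weaken (IH1 st) => i hi; rewrite mem_cat hi.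
  apply: frame_trans f1 _.
  by apply: frame_weaken (IH2 _) => i hi; rewrite mem_cat hi orbT.
- case: ifP => _.
    by apply: frame_weaken (IH1 _) => i hi; rewrite mem_cat hi.
  by apply: frame_weaken (IH2 _) => i hi; rewrite mem_cat hi orbT.
- elim: (neval st e) => [|k IHk] //=; apply: frame_trans IHk _.
  apply: (@frame_trans _ _ (set_nv (loop v (run c1) k st) v k)).
    by split=> //= u; rewrite inE negb_or /fupd => /andP[/negbTE->].
  by apply: frame_weaken (IH1 _) => // i hi; rewrite inE hi orbT.
Qed.

(** The invariant carries the ticks spent so far, and the step receives the frame of the loop, so
    that an invariant need mention only what changes. *)
Lemma for_rule v e c st N (Inv : nat -> nat -> state -> Prop) :
    neval st e = N -> Inv 0 0 st ->
    (forall i t s, i < N -> frame (For v e c) st s -> Inv i t s ->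
       Inv i.+1 (t + (ticks c (set_nv s v i)).+1) (run c (set_nv s v i))) ->
  Inv N (ticks (For v e c) st) (run (For v e c) st).
Proof.
move=> <- I0 IS /=; have: neval st e <= neval st e by [].
elim: {1 3 4 5}(neval st e) => [|k IH] lek /=; first by rewrite big_geq.
rewrite big_nat_recr //=; apply: IS => //; last exact/IH/ltnW.
(* The state after [k] passes results from the loop with constant bound [k], which has the same
   writes. *)
have := frame_run (For v (NC k) c) st; exact: frame_weaken.
Qed.

Fixpoint loop_free c : bool :=
  match c with
  | Seq c1 c2 | If _ c1 c2 => loop_free c1 && loop_free c2
  | For _ _ _ => false
  | _ => true
  end.

Lemma ticks_loop_free c st : loop_free c -> ticks c st = 0.
Proof.
elim: c st => //= [c1 IH1 c2 IH2|e c1 IH1 c2 IH2] st /andP[h1 h2].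
  by rewrite IH1 ?IH2.
by rewrite IH1 ?IH2 ?if_same.
Qed.

Lemma fupdE A (f : nat -> A) i x j : fupd f i x j = if j == i then x else f j.
Proof. by []. Qed.

Notation "c1 ;; c2" := (Seq c1 c2) (at level 85, right associativity, format "c1 ;;  '/' c2").

Definition NEq a b := NMul (NLe a b) (NLe b a).
Definition NLt a b := NLe (NAdd a (NC 1)) b.
Definition NNot a := NSub (NC 1) a.
Definition When e c := If e c Skip.

Lemma neval_NEq st a b : neval st (NEq a b) = (neval st a == neval st b).
Proof. by rewrite /= mulnb -eqn_leq. Qed.

Lemma neval_NLt st a b : neval st (NLt a b) = (neval st a < neval st b).
Proof. by rewrite /= addn1. Qed.

Lemma run_When e c st : run (When e c) st = if 0 < neval st e then run c st else st.
Proof. by []. Qed.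

Lemma ticks_When e c st : ticks (When e c) st = if 0 < neval st e then ticks c st else 0.
Proof. by []. Qed.

Lemma run_Seq c1 c2 st : run (Seq c1 c2) st = run c2 (run c1 st).
Proof. by []. Qed.

Lemma ticks_Seq c1 c2 st : ticks (Seq c1 c2) st = ticks c1 st + ticks c2 (run c1 st).
Proof. by []. Qed.

Lemma run_NSet v e st : run (NSet v e) st = set_nv st v (neval st e).
Proof. by []. Qed.

Lemma ticks_NSet v e st : ticks (NSet v e) st = 0.
Proof. by []. Qed.

(** * Variables, arrays and the stored graph *)

Module Names.
Notation vn := 0 (only parsing). Notation vT := 1 (only parsing). Notation vm := 2 (only parsing). Notation vk := 3 (only parsing).
Notation vN := 4 (only parsing). Notation vs := 5 (only parsing). Notation vK := 6 (only parsing). Notation vw := 7 (only parsing).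
Notation vi := 8 (only parsing). Notation vj := 9 (only parsing). Notation ve := 10 (only parsing). Notation vx := 11 (only parsing).
Notation vu := 12 (only parsing). Notation vcnt := 13 (only parsing). Notation vy := 14 (only parsing). Notation vt := 15 (only parsing).
Notation vv := 16 (only parsing). Notation vo := 17 (only parsing). Notation vsg := 18 (only parsing). Notation vp := 19 (only parsing).
Notation vq := 20 (only parsing). Notation vz := 21 (only parsing). Notation va := 22 (only parsing).
Notation vfrom := 23 (only parsing). Notation vto := 24 (only parsing). Notation vend := 25 (only parsing).
Notation aIn := 0 (only parsing). Notation aDeg := 1 (only parsing). Notation aTim := 2 (only parsing). Notation aTgt := 3 (only parsing).
Notation aVtx := 4 (only parsing). Notation aTme := 5 (only parsing). Notation aUx := 6 (only parsing). Notation aLo := 7 (only parsing).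
Notation aHi := 8 (only parsing). Notation aD := 9 (only parsing). Notation aS := 10 (only parsing). Notation aQ := 11 (only parsing).
Notation aG := 12 (only parsing). Notation aC := 13 (only parsing).
Notation rU := 0 (only parsing). Notation rTau := 1 (only parsing). Notation rB := 2 (only parsing). Notation rX := 3 (only parsing).
Notation rR := 4 (only parsing).
Notation racc := 0 (only parsing). Notation rtmp := 1 (only parsing).
End Names.

Import Names.

(** Row [u] of the adjacency arrays starts at [u * size E], which leaves room for any degree; the
    gaps are never touched and cost no time. *)
Record static n T (E : seq arc) st : Prop := Static {
  static_n : nv st vn = n;
  static_T : nv st vT = T;
  static_m : nv st vm = size E;
  static_N : nv st vN = n * T;
  static_deg : forall u, u < n -> na st aDeg u = size (out E u);
  static_arc : forall u j, u < n -> j < size (out E u) ->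
    na st aTim (u * size E + j) = tim (nth arc0 (out E u) j) /\
    na st aTgt (u * size E + j) = tgt T (nth arc0 (out E u) j);
  static_node : forall x, 0 < x <= n * T ->
    na st aVtx x = vtx T x /\ na st aTme x = tme T x
}.

Definition avoids (ws xs : seq nat) := all (fun i => i \notin ws) xs.

Lemma avoids_frame_nv c st s xs v : frame c st s -> avoids (nv_writes c) xs -> v \in xs ->
  nv s v = nv st v.
Proof. by move=> f /allP h /h; apply: (frame_nv f). Qed.

Lemma avoids_frame_na c st s xs a : frame c st s -> avoids (na_writes c) xs -> a \in xs ->
  na s a = na st a.
Proof. by move=> f /allP h /h; apply: (frame_na f). Qed.

Lemma static_frame n T E c st s : frame c st s ->
    avoids (nv_writes c) [:: vn; vT; vm; vN] ->
    avoids (na_writes c) [:: aDeg; aTim; aTgt; aVtx; aTme] ->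
  static n T E st -> static n T E s.
Proof.
move=> f hv ha h; have fv v := avoids_frame_nv (v := v) f hv.
have fa a := avoids_frame_na (a := a) f ha.
by case: h => h1 h2 h3 h4 h5 h6 h7; split; rewrite ?fv ?fa.
Qed.

Record graph n T (E : seq arc) d K s st : Prop := Graph {
  graph_static : static n T E st;
  graph_src : s < n;
  graph_ux : forall x, x <= n * T -> na st aUx x = ux T s x;
  graph_lo : forall x, x <= n * T -> na st aLo x = lo T d x;
  graph_hi : forall x, x <= n * T -> na st aHi x = hi T K x
}.

Lemma graph_frame n T E d K r c st s : frame c st s ->
    avoids (nv_writes c) [:: vn; vT; vm; vN] ->
    avoids (na_writes c) [:: aDeg; aTim; aTgt; aVtx; aTme; aUx; aLo; aHi] ->
  graph n T E d K r st -> graph n T E d K r s.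
Proof.
move=> f hv ha [h1 h2 h3 h4 h5]; have fa a := avoids_frame_na (a := a) f ha.
split; rewrite ?fa //; apply: static_frame f hv _ h1.
by move: ha; rewrite /avoids /= => /and5P[-> -> -> -> /andP[->]].
Qed.

Definition succ_body c :=
  NSet ve (NAdd (NMul (NV vu) (NV vm)) (NV vj)) ;;
  NSet va (NA aTim (NV ve)) ;;
  NSet vy (NA aTgt (NV ve)) ;;
  When (NMul (NLe (NA aLo (NV vx)) (NV va)) (NLe (NV va) (NA aHi (NV vx)))) c.

Definition ForSucc c :=
  NSet vu (NA aUx (NV vx)) ;; For vj (NA aDeg (NV vu)) (succ_body c).

Section Successors.
Variables (n T : nat) (E : seq arc).
Hypothesis wfE : wf_tgraph n T E.
Variables (d K r : nat).
Notation succ := (tsucc T E d K r).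

Lemma ux_bound x : r < n -> x <= n * T -> ux T r x < n.
Proof.
rewrite /ux => rn xN; case: posnP => // x0.
by apply: vtx_bound; rewrite x0.
Qed.

(** A loop-free body makes one scan cost at most the out-degree. The invariant is indexed by the
    successors handled so far; among the natural variables it may depend on [vcnt] only, because the
    scan itself sets others. *)
Lemma ForSucc_rule c st x (Inv : seq nat -> state -> Prop) :
    graph n T E d K r st -> nv st vx = x -> x <= n * T -> loop_free c ->
    avoids (nv_writes c) [:: vn; vT; vm; vN; vx; vu; vj] ->
    avoids (na_writes c) [:: aDeg; aTim; aTgt; aVtx; aTme; aUx; aLo; aHi] ->
    (forall ys s s', na s' = na s -> rv s' = rv s -> ra s' = ra s ->
       nv s' vcnt = nv s vcnt -> Inv ys s -> Inv ys s') ->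
    Inv [::] st ->
    (forall ys e s, frame (ForSucc c) st s -> nv s vy = tgt T e -> nv s va = tim e ->
       e \in E -> tgt T e \in succ x -> tgt T e \notin ys -> Inv ys s ->
       Inv (rcons ys (tgt T e)) (run c s)) ->
  Inv (succ x) (run (ForSucc c) st) /\
  ticks (ForSucc c) st <= size (out E (ux T r x)).
Proof.
move=> gst stx xN lf cv ca stable I0 IS.
have [sst rn gux glo ghi] := gst; pose u := ux T r x.
have un : u < n by apply: ux_bound.
pose body := succ_body c.
pose st1 := set_nv st vu (na st aUx (nv st vx)).
have st1u : nv st1 vu = u by rewrite /= stx gux.
have degE : neval st1 (NA aDeg (NV vu)) = size (out E u).
  by rewrite [neval _ _]/= -[fupd _ _ _ _]/(nv st1 vu) st1u (static_deg sst).
have lfb s : ticks body s = 0 by apply: ticks_loop_free; rewrite /= lf.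
pose F j := [seq tgt T e | e <- take j (out E u) & allowed T d K x e].
have sub_frame s : frame (For vj (NA aDeg (NV vu)) body) st1 s -> frame (ForSucc c) st s.
  move=> f; apply: (@frame_trans _ _ st1).
    by split=> //= i; rewrite inE negb_or /fupd => /andP[/negbTE->].
  apply: frame_weaken f => // i; rewrite [nv_writes _]/= => hi.
  by rewrite inE hi orbT.
pose J j t s := Inv (F j) s /\ t = j.
have key : J (size (out E u))
    (ticks (For vj (NA aDeg (NV vu)) body) st1) (run (For vj (NA aDeg (NV vu)) body) st1).
  apply: for_rule => //; first by split=> //; rewrite /F take0 /=; apply: stable I0.
  move=> j t s ltj f [Is ->]; rewrite lfb addn1; split=> //.
  have fs := sub_frame _ f.
  have su : nv s vu = u.
    rewrite (frame_nv f) //; apply/negP; rewrite /= !inE.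
    move/allP: cv => /(_ vu isT); rewrite mem_cat; by move/negbTE->.
  have sm : nv s vm = size E.
    rewrite (frame_nv fs) ?(static_m sst) //; apply/negP; rewrite /= !inE.
    move/allP: cv => /(_ vm isT); rewrite mem_cat; by move/negbTE->.
  have sx : nv s vx = x.
    rewrite (frame_nv fs) //; apply/negP; rewrite /= !inE.
    move/allP: cv => /(_ vx isT); rewrite mem_cat; by move/negbTE->.
  have fa a : a \in [:: aDeg; aTim; aTgt; aVtx; aTme; aUx; aLo; aHi] -> na s a = na st a.
    move=> ha; rewrite (frame_na fs) //; apply/negP; rewrite /= cats0.
    by move/allP: ca => /(_ a ha)/negbTE->.
  set e := nth arc0 (out E u) j.
  have eout : e \in out E u by apply: mem_nth.
  have eE : e \in E by move: eout; rewrite mem_filter => /andP[].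
  have [timE tgtE] := static_arc sst un ltj.
  set s1 := set_nv (set_nv (set_nv (set_nv s vj j) ve (u * size E + j)) va (tim e)) vy (tgt T e).
  have -> : run body (set_nv s vj j) = if allowed T d K x e then run c s1 else s1.
    rewrite /body /= !fupdE /= su sm sx !fa // timE tgtE glo // ghi //.
    rewrite mulnb lt0b.
    by rewrite /s1 /set_nv /= .
  have I1 : Inv (F j) s1 by apply: stable Is.
  have FS : F j.+1 = if allowed T d K x e then rcons (F j) (tgt T e) else F j.
    rewrite /F (take_nth arc0 ltj) filter_rcons -/e; case: ifP => // _.
    by rewrite map_rcons.
  rewrite FS; case: ifP => // al; apply: IS => //.
  - apply: frame_trans fs _; split=> // i; rewrite /= !inE !negb_or.
    by case/and5P=> _ hj he ha' /andP[hy _]; rewrite !fupdE !ifN.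
  - apply: tgt_tsucc => //; by move: eout; rewrite mem_filter => /andP[/eqP].
  - have := tsucc_uniq wfE d K r x; rewrite /tsucc -/u -(cat_take_drop j.+1 (out E u)).
    rewrite filter_cat map_cat cat_uniq => /andP[+ _].
    by rewrite -/(F j.+1) FS al rcons_uniq => /andP[].
case: key => Iend tk; split.
  by move: Iend; rewrite /F take_size.
by rewrite -[ticks _ _]/(0 + ticks (For vj (NA aDeg (NV vu)) body) st1) tk.
Qed.
End Successors.

(** * Building the adjacency arrays *)

Record input n T (E : seq arc) k st : Prop := Input {
  input_n : nv st vn = n;
  input_T : nv st vT = T;
  input_m : nv st vm = size E;
  input_k : nv st vk = k;
  input_arc : forall i, i < size E -> let e := nth arc0 E i in
    [/\ na st aIn (4 + 3 * i) = src e, na st aIn (5 + 3 * i) = dst e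
      & na st aIn (6 + 3 * i) = tim e]
}.

Definition fill_body :=
  NSet vu (NA aIn (NAdd (NC 4) (NMul (NC 3) (NV ve)))) ;;
  NSet vj (NAdd (NMul (NV vu) (NV vm)) (NA aDeg (NV vu))) ;;
  NSet vt (NA aIn (NAdd (NC 6) (NMul (NC 3) (NV ve)))) ;;
  NPut aTim (NV vj) (NV vt) ;;
  NPut aTgt (NV vj)
    (NAdd (NMul (NA aIn (NAdd (NC 5) (NMul (NC 3) (NV ve)))) (NV vT)) (NV vt)) ;;
  NPut aDeg (NV vu) (NAdd (NA aDeg (NV vu)) (NC 1)).

(** Loading the input leaves arbitrary values in the other cells, so the degree counters must be
    cleared. *)
Definition init_deg := For vu (NV vn) (NPut aDeg (NV vu) (NC 0)).
Definition fill := For ve (NV vm) fill_body.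
Definition init_adj := init_deg ;; fill.

Definition node_body :=
  NSet vx (NAdd (NAdd (NMul (NV vv) (NV vT)) (NV vt)) (NC 1)) ;;
  NPut aVtx (NV vx) (NV vv) ;; NPut aTme (NV vx) (NAdd (NV vt) (NC 1)) ;;
  RPut rB (NV vx) (RN (NC 0)).

Definition node_row := For vt (NV vT) node_body.
Definition init_nodes := For vv (NV vn) node_row.

Definition init := NSet vN (NMul (NV vn) (NV vT)) ;; init_adj ;; init_nodes.

Section Init.
Variables (n T : nat) (E : seq arc) (k : nat).
Hypothesis wfE : wf_tgraph n T E.

Lemma init_adj_ok st : input n T E k st ->
  let st' := run init_adj st in
  [/\ forall u, u < n -> na st' aDeg u = size (out E u),
      forall u j, u < n -> j < size (out E u) ->
        na st' aTim (u * size E + j) = tim (nth arc0 (out E u) j) /\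
        na st' aTgt (u * size E + j) = tgt T (nth arc0 (out E u) j)
    & ticks init_adj st <= n + size E].
Proof.
move=> inp; pose c1 := init_deg; pose c2 := fill.
pose J1 i t s := (forall u, u < i -> na s aDeg u = 0) /\ t = i.
have [deg0 t1] : J1 n (ticks c1 st) (run c1 st).
  apply: for_rule; [exact: input_n inp | by split |].
  move=> i t s _ _ [h ->]; split; last by rewrite /= addn1.
  move=> u; rewrite /= /fupd /= ltnS leq_eqVlt; case: eqP => //= _; exact: h.
have f1 : frame c1 st (run c1 st) by apply: frame_run.
set st1 := run c1 st in deg0 f1 *.
have arc1 i : i < size E -> let e := nth arc0 E i in
    [/\ na st1 aIn (4 + 3 * i) = src e, na st1 aIn (5 + 3 * i) = dst e
      & na st1 aIn (6 + 3 * i) = tim e].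
  by rewrite (frame_na f1) //; apply: (input_arc inp).
pose J2 i t s := [/\ forall u, u < n -> na s aDeg u = size (out (take i E) u),
   forall u j, u < n -> j < size (out (take i E) u) ->
        na s aTim (u * size E + j) = tim (nth arc0 (out (take i E) u) j) /\
        na s aTgt (u * size E + j) = tgt T (nth arc0 (out (take i E) u) j) & t = i].
have : J2 (size E) (ticks c2 st1) (run c2 st1).
  apply: for_rule; first by rewrite /= (frame_nv f1) // (input_m inp).
    by split=> [u|u j|] //; rewrite take0 //; apply: deg0.
  move=> i t s lti f [dg ar ->].
  have sm : nv s vm = size E by rewrite (frame_nv f) // (frame_nv f1) // (input_m inp).
  have sT : nv s vT = T by rewrite (frame_nv f) // (frame_nv f1) // (input_T inp).
  have := arc1 i lti; rewrite -!(frame_na f) //; set e := nth arc0 E i => -[e1 e2 e3].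
  have [un _ _ _] := arcP wfE (mem_nth arc0 lti : e \in E).
  pose u := src e; pose dg0 := size (out (take i E) u).
  have outS u' : out (take i.+1 E) u' =
      if u' == u then rcons (out (take i E) u') e else out (take i E) u'.
    by rewrite /out (take_nth arc0 lti) filter_rcons -/e eq_sym.
  have szE u' : size (out (take i E) u') <= i.
    by rewrite size_filter (leq_trans (count_size _ _)) // size_take lti.
  (* Rows do not overlap: at most [i < size E] arcs have been filed, so every offset is below the
     row length. *)
  have inj u' j : j < size E -> (u' * size E + j == u * size E + dg0) = (u' == u) && (j == dg0).
    move=> hj; have hd : dg0 < size E := leq_ltn_trans (szE u) lti.
    apply/eqP/andP => [h|[/eqP-> /eqP->//]].
    have E0 : 0 < size E by apply: leq_ltn_trans lti.
    have : (u' * size E + j) %/ size E = (u * size E + dg0) %/ size E by rewrite h.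
    rewrite !divnMDl // !divn_small // !addn0 => uu.
    by move: h; rewrite uu => /addnI->.
  have -> : run fill_body (set_nv s ve i) =
     let s1 := set_nv (set_nv (set_nv (set_nv s ve i) vu u) vj (u * size E + dg0)) vt (tim e) in
     set_na (set_na (set_na s1 aTim (u * size E + dg0) (tim e))
        aTgt (u * size E + dg0) (tgt T e)) aDeg u dg0.+1.
    by rewrite /fill_body /= /fupd /= sm sT e1 e2 e3 dg // addn1.
  split=> [u' hu'|u' j hu'|]; last by rewrite addn1.
    rewrite /= /fupd /= outS; case: eqP => [->|_]; first by rewrite size_rcons.
    exact: dg.
  rewrite /= /fupd /= outS => hj.
  have hjE : j < size E.
    apply: leq_trans hj _; case: ifP => _; rewrite ?size_rcons; first exact: leq_ltn_trans (szE _) lti.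
    exact: leq_trans (szE _) (ltnW lti).
  rewrite inj //; case: (u' =P u) hj => [->|_] hj /=; last exact: ar.
  rewrite nth_rcons; rewrite size_rcons in hj; case: (j =P dg0) => [->|/eqP nj].
    by rewrite ltnn ?eqxx.
  have lj : j < dg0 by rewrite ltn_neqAle nj -ltnS.
  by rewrite lj; apply: ar.
rewrite /J2 take_size => -[h1 h2 h3]; split=> //.
by rewrite -[ticks _ _]/(ticks c1 st + ticks c2 st1) t1 h3.
Qed.

Lemma init_nodes_ok st : nv st vn = n -> nv st vT = T ->
  let st' := run init_nodes st in
  (forall x, 0 < x <= n * T ->
     [/\ na st' aVtx x = vtx T x, na st' aTme x = tme T x & ra st' rB x = 0%R]) /\
  ticks init_nodes st <= n * T.+1.
Proof.
move=> sn sT.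
pose P b s := forall x, 0 < x <= b ->
  [/\ na s aVtx x = vtx T x, na s aTme x = tme T x & ra s rB x = 0%R].
pose J i t s := P (i * T) s /\ t = i * T.+1.
pose c := init_nodes.
suff [h ->] : J n (ticks c st) (run c st) by [].
apply: for_rule; first exact: sn.
  by split=> // x; case: x.
move=> i t s _ f [Ps ->].
pose J' j t s := P (i * T + j) s /\ t = j.
pose c' := node_row; set s' := set_nv s vv i.
suff [h1 h2] : J' T (ticks c' s') (run c' s') by split; rewrite ?h2 mulSn ?(addnC T) // addnC.
have sT' : neval s' (NV vT) = T by rewrite /= /fupd /= (frame_nv f).
apply: for_rule; [exact: sT' | by split; rewrite ?addn0 |].
move=> j t' s1 jT f' [Ps1 ->]; split; last by rewrite addn1.
have s1T : nv s1 vT = T by rewrite (frame_nv f').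
have s1v : nv s1 vv = i by rewrite (frame_nv f').
move=> x hx; rewrite /= /fupd /= s1T s1v.
have -> : (i * T + j + 1 = node T i j.+1) by rewrite /node addn1 addnS.
case: eqP => [->|/eqP nx]; first by rewrite vtx_node // tme_node // addn1.
by apply: Ps1; move: hx nx; rewrite /node; lia.
Qed.

Lemma init_ok st : input n T E k st ->
  let st' := run init st in
  [/\ static n T E st', nv st' vk = k, forall x, 0 < x <= n * T -> ra st' rB x = 0%R
    & ticks init st <= n + size E + n * T.+1].
Proof.
move=> inp; set st1 := run (NSet vN (NMul (NV vn) (NV vT))) st.
have inp1 : input n T E k st1 by case: inp.
have [h1 h2 h3] := init_adj_ok inp1; set st2 := run init_adj st1 in h1 h2.
have f2 : frame init_adj st1 st2 by apply: frame_run.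
have e2n : nv st2 vn = n by rewrite (frame_nv f2) // (input_n inp1).
have e2T : nv st2 vT = T by rewrite (frame_nv f2) // (input_T inp1).
have [h4 h5] := init_nodes_ok e2n e2T; set st3 := run init_nodes st2 in h4.
have f3 : frame init_nodes st2 st3 by apply: frame_run.
rewrite -[run init st]/st3; split.
- split; last by move=> x /h4[-> ->].
  + by rewrite (frame_nv f3) // (frame_nv f2) // (input_n inp1).
  + by rewrite (frame_nv f3) // (frame_nv f2) // (input_T inp1).
  + by rewrite (frame_nv f3) // (frame_nv f2) // (input_m inp1).
  + by rewrite (frame_nv f3) // (frame_nv f2) // /= (input_n inp) (input_T inp).
  + by rewrite (frame_na f3).
  + by rewrite !(frame_na f3).
- by rewrite (frame_nv f3) // (frame_nv f2) // (input_k inp1).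
- by move=> x /h4[].
- rewrite -[ticks _ _]/(0 + (ticks init_adj st1 + ticks init_nodes st2)).
  by rewrite add0n leq_add.
Qed.
End Init.

(** * Breadth-first search as a program *)

Definition bfs_clear_body d :=
  NPut aD (NV vx) (NC 0) ;; NPut aS (NV vx) (NC 0) ;;
  NPut aUx (NV vx) (NA aVtx (NV vx)) ;;
  NPut aLo (NV vx) (NAdd (NA aTme (NV vx)) (NC d)) ;;
  NPut aHi (NV vx) (NAdd (NA aTme (NV vx)) (NV vK)).

Definition bfs_clear d := For vx (NAdd (NV vN) (NC 1)) (bfs_clear_body d).

(** Overwrites entry 0 after the clearing loop: the root has vertex [s] and may be left at any time
    from 0 to [T]. *)
Definition bfs_start :=
  NPut aUx (NC 0) (NV vs) ;; NPut aLo (NC 0) (NC 0) ;; NPut aHi (NC 0) (NV vT) ;;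
  NPut aD (NC 0) (NC 1) ;; NPut aS (NC 0) (NC 1) ;; NPut aQ (NC 0) (NC 0) ;;
  NSet vcnt (NC 1).

(** The second test comes after the possible update of the distance, so it covers new nodes as well
    as nodes found before on the same level. *)
Definition bfs_relax :=
  When (NLe (NA aD (NV vy)) (NC 0))
    (NPut aD (NV vy) (NAdd (NA aD (NV vx)) (NC 1)) ;;
     NPut aQ (NV vcnt) (NV vy) ;; NSet vcnt (NAdd (NV vcnt) (NC 1))) ;;
  When (NEq (NA aD (NV vy)) (NAdd (NA aD (NV vx)) (NC 1)))
    (NPut aS (NV vy) (NAdd (NA aS (NV vy)) (NA aS (NV vx)))).

Definition bfs_body :=
  When (NLt (NV vi) (NV vcnt)) (NSet vx (NA aQ (NV vi)) ;; ForSucc bfs_relax).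

Definition bfs_loop := For vi (NAdd (NV vN) (NC 1)) bfs_body.

Definition bfs d := bfs_clear d ;; bfs_start ;; bfs_loop.

(** The abstract distance data range over all numbers, whereas array entries beyond [N] are
    arbitrary. *)
Definition clip N (f : nat -> nat) y := if y <= N then f y else 0.

Definition queue st q :=
  nv st vcnt = size q /\ forall i, i < size q -> na st aQ i = nth 0 q i.

Lemma clipE N f y : y <= N -> clip N f y = f y.
Proof. by rewrite /clip => ->. Qed.

Section BfsProgram.
Variables (n T : nat) (E : seq arc).
Hypothesis wfE : wf_tgraph n T E.
Variables (d K s : nat).
Notation N := (n * T).
Notation succ := (tsucc T E d K s).
Notation deg x := (size (out E (ux T s x))).

Lemma bfs_init_ok st : static n T E st -> nv st vs = s -> s < n -> nv st vK = K ->
  let st' := run (bfs_clear d ;; bfs_start) st in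
  [/\ graph n T E d K s st', queue st' [:: 0],
      forall y, clip N (na st' aD) y = (y == 0) & forall y, clip N (na st' aS) y = (y == 0)]
  /\ ticks (bfs_clear d ;; bfs_start) st = N.+1.
Proof.
move=> sst ss sn sK; pose c := bfs_clear d.
pose J i t r := t = i /\ forall x, x < i -> [/\ na r aD x = 0, na r aS x = 0,
   na r aUx x = na st aVtx x, na r aLo x = na st aTme x + d & na r aHi x = na st aTme x + K].
have [tE h] : J N.+1 (ticks c st) (run c st).
  apply: for_rule; [by rewrite /= (static_N sst) addn1 | by [] |].
  move=> i t r _ f [-> h]; split; first by rewrite addn1.
  have rK : nv r vK = K by rewrite (frame_nv f).
  have rV : na r aVtx = na st aVtx by rewrite (frame_na f).
  have rT : na r aTme = na st aTme by rewrite (frame_na f).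
  move=> x; rewrite /= /fupd /= rK rV rT ltnS leq_eqVlt; case: eqP => [->//|_ /=].
  exact: h.
have f1 : frame c st (run c st) by apply: frame_run.
have s1 := static_frame f1 isT isT sst; set st1 := run c st in h f1 s1.
have e1T : nv st1 vT = T := static_T s1.
have e1s : nv st1 vs = s by rewrite (frame_nv f1).
split; last by rewrite -[ticks _ _]/(ticks c st + 0) addn0.
set st' := run _ st; have -> : st' = run bfs_start st1 by [].
split.
- split=> //.
  + by apply: (static_frame (frame_run bfs_start st1)) s1.
  + move=> x xN; rewrite /= /fupd /= e1s /ux; case: (x =P 0) => // /eqP x0.
    have [_ _ -> _ _] := h x xN; case: (static_node sst (x := x)) => //.
    by rewrite lt0n x0.
  + move=> x xN; rewrite /= /fupd /= /lo; case: (x =P 0) => // /eqP x0.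
    have [_ _ _ -> _] := h x xN; case: (static_node sst (x := x)) => [|_ -> //].
    by rewrite lt0n x0.
  + move=> x xN; rewrite /= /fupd /= e1T /hi; case: (x =P 0) => // /eqP x0.
    have [_ _ _ _ ->] := h x xN; case: (static_node sst (x := x)) => [|_ -> //].
    by rewrite lt0n x0.
- by split=> // -[].
- move=> y; rewrite /clip; case: leqP => yN; last by case: y yN.
  by rewrite /= /fupd /=; case: eqP => // _; case: (h y yN).
- move=> y; rewrite /clip; case: leqP => yN; last by case: y yN.
  by rewrite /= /fupd /=; case: eqP => // _; case: (h y yN).
Qed.

Lemma bfs_relax_ok st x D S q : graph n T E d K s st -> nv st vx = x -> x <= N ->
    queue st q -> (forall y, y <= N -> na st aD y = D y) ->
    (forall y, y <= N -> na st aS y = S y) -> 0 < D x ->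
  let st' := run (ForSucc bfs_relax) st in
  [/\ queue st' (q ++ [seq y <- succ x | D y == 0]),
      forall y, y <= N -> na st' aD y = if (D y == 0) && (y \in succ x) then (D x).+1 else D y
    & forall y, y <= N -> na st' aS y =
        if (y \in succ x) && (na st' aD y == (D x).+1) then S y + S x else S y]
  /\ ticks (ForSucc bfs_relax) st <= deg x.
Proof.
move=> gst sx xN qst DE SE Dx.
pose Inv ys r := [/\ queue r (q ++ [seq y <- ys | D y == 0]),
      forall y, y <= N -> na r aD y = if (D y == 0) && (y \in ys) then (D x).+1 else D y
    & forall y, y <= N -> na r aS y =
        if (y \in ys) && (na r aD y == (D x).+1) then S y + S x else S y].
have := @ForSucc_rule n T E wfE d K s bfs_relax st x Inv gst sx xN isT isT isT.
apply.
- by move=> ys r r' e1 _ _ e2; rewrite /Inv /queue e1 e2.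
- split; first by rewrite cats0.
    by move=> y yN; rewrite andbF DE.
  by move=> y yN; rewrite SE.
move=> ys e r f ry _ eE ex eys [[qc qn] rD rS]; set y0 := tgt T e in ry ex eys *.
have y0N : y0 <= N by have /andP[] := tsucc_bound wfE ex.
have rx : nv r vx = x by rewrite (frame_nv f).
have xD : na r aD x = D x by rewrite rD // (gtn_eqF Dx).
have xS : na r aS x = S x by rewrite rS // xD (ltn_eqF (ltnSn _)) andbF.
have y0D : na r aD y0 = D y0 by rewrite rD // (negbTE eys) andbF.
have y0S : na r aS y0 = S y0 by rewrite rS // (negbTE eys).
rewrite /Inv filter_rcons.
rewrite /bfs_relax [run _ _]/= /NEq /= ry rx y0D leqn0 lt0b.
case: eqP => [Dy0|/eqP Dy0].
  (* A newly found node is not [x], so the second test still reads the old distance of [x]. *)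
  have nx : (x == y0) = false by apply/eqP => e1; move: Dx; rewrite e1 Dy0.
  rewrite /= /fupd /= ry rx eqxx nx xD addn1 leqnn xS y0S /=.
  split.
  - split; first by rewrite qc -cats1 catA [RHS]size_cat addn1.
    rewrite -cats1 catA => i; rewrite size_cat [size [:: _]]/= addn1 ltnS nth_cat /= /fupd /= qc.
    case: ltngtP => // [lt _|-> _]; last by rewrite ?eqxx subnn.
    by rewrite ?(ltn_eqF lt) qn.
  - move=> y yN; rewrite /= /fupd /= mem_rcons inE; case: (y =P y0) => [->|_] /=; last exact: rD.
    by rewrite Dy0.
  - move=> y yN; rewrite /= /fupd /= mem_rcons inE; case: (y =P y0) => [->|_] /=; last exact: rS.
    by rewrite ?eqxx ?Dy0.
rewrite ry rx y0D xD addn1 mulnb lt0b -eqn_leq; case: ifP => [/eqP Dy1|nDy1].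
  split.
  - by [].
  - move=> y yN; rewrite /= /fupd /= mem_rcons inE; case: (y =P y0) => [->|_] /=; last exact: rD.
    by rewrite (negbTE Dy0).
  - move=> y yN; rewrite /= /fupd /= mem_rcons inE; case: (y =P y0) => [->|_] /=; last exact: rS.
    by rewrite xS y0S y0D Dy1 eqxx.
split=> // y yN; rewrite mem_rcons inE; case: (y =P y0) => [->|_] /=.
- by rewrite (negbTE Dy0).
- exact: rD.
- by rewrite y0D nDy1.
- exact: rS.
Qed.

Lemma bfs_ok st : static n T E st -> nv st vs = s -> s < n -> nv st vK = K ->
  let st' := run (bfs d) st in
  exists q, [/\ graph n T E d K s st', queue st' q,
    bfs_inv succ N N.+1 (clip N (na st' aD)) (clip N (na st' aS)) q
    & ticks (bfs d) st <= 2 * N.+1 + \sum_(x <- q) deg x].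
Proof.
move=> sst ss sn sK.
have [[g1 q1 D1 S1] t1] := bfs_init_ok sst ss sn sK.
set st1 := run _ st in g1 q1 D1 S1; rewrite /bfs.
have runE : run (bfs_clear d ;; bfs_start ;; bfs_loop) st = run bfs_loop st1 by [].
have ticksE : ticks (bfs_clear d ;; bfs_start ;; bfs_loop) st = N.+1 + ticks bfs_loop st1.
  by rewrite -t1 -[in RHS]addnA.
rewrite runE ticksE; clearbody st1; clear runE ticksE.
pose J i t r := [/\ graph n T E d K s r & exists q, [/\ queue r q,
    bfs_inv succ N i (clip N (na r aD)) (clip N (na r aS)) q
    & t <= i + \sum_(x <- take i q) deg x]].
have [g2 [q [q2 inv tk]]] : J N.+1 (ticks bfs_loop st1) (run bfs_loop st1).
  apply: for_rule.
  - by rewrite /= (static_N (graph_static g1)) addn1.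
  - split=> //; exists [:: 0]; split=> //.
    exact: bfs_inv0 D1 S1.
  move=> i t r _ f [gr [q [[qc qn] inv le]]].
  set r1 := set_nv r vi i.
  have gr1 : graph n T E d K s r1 by case: gr => -[].
  have condE : neval r1 (NLt (NV vi) (NV vcnt)) = (i < size q).
    by rewrite neval_NLt /= /fupd /= qc.
  have [lt|ge] := ltnP i (size q); last first.
    have -> : run bfs_body r1 = r1 by rewrite run_When condE lt0b ltnNge ge.
    have -> : ticks bfs_body r1 = 0 by rewrite ticks_When condE lt0b ltnNge ge.
    split=> //; exists q; split=> //; first exact: bfs_inv_idle.
    by rewrite take_oversize // in le; rewrite addn1 addSn ltnS take_oversize ?leqW.
  set x := nth 0 q i; set r2 := set_nv r1 vx x.
  have xq : x \in q by apply: mem_nth.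
  have xN : x <= N by apply: (bfs_bound inv).
  have gr2 : graph n T E d K s r2 by case: gr1 => -[].
  have xE : neval r1 (NA aQ (NV vi)) = x by rewrite /= /fupd /= qn.
  have rE : run bfs_body r1 = run (ForSucc bfs_relax) r2.
    by rewrite run_When condE lt0b lt run_Seq run_NSet xE.
  have tE : ticks bfs_body r1 = ticks (ForSucc bfs_relax) r2.
    by rewrite ticks_When condE lt0b lt ticks_Seq run_NSet xE ticks_NSet.
  have Dx : 0 < clip N (na r aD) x by rewrite -(bfs_mem inv).
  have := @bfs_relax_ok r2 x (clip N (na r aD)) (clip N (na r aS)) q gr2.
  case=> //; try by move=> y yN; rewrite /clip yN.
  move=> [q3 D3 S3] t3; rewrite rE tE.
  have gr3 := graph_frame (frame_run (ForSucc bfs_relax) r2) isT isT gr2.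
  move: (run _ r2) (ticks _ r2) gr3 q3 D3 S3 t3 => r3 t4 gr3 q3 D3 S3 t3.
  split=> //.
  exists (q ++ [seq y <- succ x | clip N (na r aD) y == 0]); split=> //.
    apply: (bfs_inv_step _ _ lt inv) => [y z|y|y|y].
    - exact: (tsucc_bound wfE).
    - exact: (tsucc_uniq wfE).
    - have [yN|yN] := leqP y N; first by rewrite [clip _ (na r3 aD) _]clipE // D3.
      rewrite /clip leqNgt yN /=; case: ifP => // /(tsucc_bound wfE)/andP[_].
      by rewrite leqNgt yN.
    - have [yN|yN] := leqP y N; first by rewrite [clip _ (na r3 aS) _]clipE // [clip _ (na r3 aD) _]clipE // S3.
      rewrite /clip leqNgt yN /=; case: ifP => // /andP[/(tsucc_bound wfE)/andP[_]].
      by rewrite leqNgt yN.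
  rewrite takel_cat // (take_nth 0 lt) -cats1 big_cat big_seq1 /= -/x.
  by rewrite addSn addnS ltnS addnA leq_add.
exists q; split=> //.
by move: tk; rewrite take_oversize ?(bfs_size inv) // => tk; lia.
Qed.
End BfsProgram.

(** * Optimal ends and their weights *)

Definition tau_idx :=
  NSet vx (NAdd (NAdd (NMul (NV vv) (NV vT)) (NV vt)) (NC 1)) ;;
  NSet vy (NAdd (NMul (NV vw) (NAdd (NV vt) (NC 1))) (NA aD (NV vx))).

(** [vo = 0] means that no reached temporal node of [v] has been seen yet, in agreement with
    [optc]. *)
Definition tau_min := For vt (NV vT) (tau_idx ;;
  When (NMul (NLe (NC 1) (NA aD (NV vx)))
             (NNot (NMul (NLe (NC 1) (NV vo)) (NLe (NV vo) (NV vy)))))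
    (NSet vo (NV vy))).

Definition tau_sum := For vt (NV vT) (tau_idx ;;
  When (NMul (NLe (NC 1) (NA aD (NV vx))) (NEq (NV vy) (NV vo)))
    (NSet vsg (NAdd (NV vsg) (NA aS (NV vx))))).

Definition tau_set := For vt (NV vT) (tau_idx ;;
  If (NMul (NMul (NLe (NC 1) (NA aD (NV vx))) (NEq (NV vy) (NV vo)))
           (NNot (NEq (NV vv) (NV vs))))
    (RPut rTau (NV vx) (RDiv (RN (NC 1)) (RN (NV vsg))))
    (RPut rTau (NV vx) (RN (NC 0)))).

Definition tau_row := NSet vo (NC 0) ;; tau_min ;; NSet vsg (NC 0) ;; tau_sum ;; tau_set.

Definition tau_prog := For vv (NV vn) tau_row.

Section TauProgram.
Variables (n T : nat) (E : seq arc).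
Hypothesis wfE : wf_tgraph n T E.
Variables (strict : bool) (ck : cost_kind) (s : nat) (D S : nat -> nat).
Notation N := (n * T).
Notation w := (weight n ck).
Hypothesis DS : shortest_data (tsucc T E strict (window T ck) s) D S.
Hypothesis leDB : forall x, D x <= N.+1.

Lemma sub1b (b : bool) : 1 - b = ~~ b. Proof. by case: b. Qed.

Definition tau_state v st := [/\ nv st vT = T, nv st vw = w, nv st vs = s,
  nv st vv = v & forall x, x <= N -> na st aD x = D x /\ na st aS x = S x].

Lemma tau_state_frame c v st r : frame c st r ->
    avoids (nv_writes c) [:: vT; vw; vs; vv] -> avoids (na_writes c) [:: aD; aS] ->
  tau_state v st -> tau_state v r.
Proof.
move=> f hv ha [h1 h2 h3 h4 h5]; have fv i := avoids_frame_nv (v := i) f hv.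
have fa a := avoids_frame_na (a := a) f ha.
by split; rewrite ?fv ?fa.
Qed.

Section Row.
Variable v : nat.
Hypothesis vn : v < n.

Lemma run_tau_idx st i c : i < T -> tau_state v st ->
  let x := node T v i.+1 in
  run (tau_idx ;; c) (set_nv st vt i) =
    run c (set_nv (set_nv (set_nv st vt i) vx x) vy (w * i.+1 + D x)).
Proof.
move=> iT [sT sw _ sv sD]; rewrite run_Seq; congr run.
have xN : node T v i.+1 <= N by have /andP[] := node_bound vn (iT : 0 < i.+1 <= T).
rewrite /tau_idx /= /fupd /= sT sv sw.
have -> : v * T + i + 1 = node T v i.+1 by rewrite addn1 /node addnS.
by have [-> _] := sD _ xN; rewrite addn1.
Qed.

(** The loop finds the least [w * t' + D] over the reached temporal nodes of [v]; [optc_le] bounds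
    [optc] by each of them and [optc_attained] provides one that attains it. *)
Lemma tau_min_ok st : tau_state v st -> nv st vo = 0 ->
  nv (run tau_min st) vo = optc n E strict ck s v /\ ticks tau_min st = T.
Proof.
move=> sst so; pose J i t r := [/\ t = i,
  0 < nv r vo -> exists2 t', 0 < t' <= i &
    0 < D (node T v t') /\ nv r vo = w * t' + D (node T v t')
  & forall t', 0 < t' <= i -> 0 < D (node T v t') ->
      0 < nv r vo <= w * t' + D (node T v t')].
have [tE h1 h2] : J T (ticks tau_min st) (run tau_min st).
  apply: for_rule; [by case: sst | by rewrite /J so; split=> // -[] |].
  move=> i t r iT f [-> h1 h2]; have sr := tau_state_frame f isT isT sst.
  have xN : node T v i.+1 <= N by have /andP[] := node_bound vn (iT : 0 < i.+1 <= T).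
  split; first by rewrite ticks_loop_free ?addn1.
    rewrite run_tau_idx // run_When [neval _ _]/= /fupd /=.
    case: sr => _ _ _ _ /(_ _ xN)[-> _]; rewrite mulnb sub1b mulnb lt0b.
    case: ifP => [/andP[Dx _] _|_].
      by exists i.+1; rewrite /= ?leqnn.
    by move=> /h1[t' ht' ?]; exists t' => //; lia.
  move=> t' ht' Dt'; rewrite run_tau_idx // run_When [neval _ _]/= /fupd /=.
  case: sr => _ _ _ _ /(_ _ xN)[-> _]; rewrite mulnb sub1b mulnb lt0b.
  have [te|lt] : t' = i.+1 \/ 0 < t' <= i by lia.
    rewrite te in Dt' *; rewrite Dt' /=.
    case: ifP => [_|/negbFE/andP[o1 o2]]; last by rewrite /= o1 o2.
    by rewrite /= /fupd /= ltn_addl //= leqnn.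
  have /andP[o0 ole] := h2 t' lt Dt'; rewrite o0 -ltnNge /=.
  case: ifP => [/andP[Dx ly]|_]; last by rewrite /= o0.
  by rewrite /= /fupd /= ltn_addl //= (leq_trans (ltnW ly)).
split=> //; set o := nv _ vo in h1 h2 *.
have [o0|o0] := posnP (optc n E strict ck s v).
  rewrite o0; apply/eqP; rewrite -leqn0 leqNgt; apply/negP => /h1[t' ht' [Dt' _]].
  have /andP[t'0 _] := node_bound vn ht'.
  by have := optc_le wfE DS t'0 Dt'; rewrite vtx_node // o0.
have [y [y0 Dy vy' oE]] := optc_attained wfE DS o0.
have yE : node T v (tme T y) = y by rewrite -vy' node_vtx.
have T0 : 0 < T by have := dist_gt0_le (@tsucc_bound n T E wfE _ _ _) DS Dy; case: (T) => //; rewrite muln0; case: (y) y0.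
have := h2 (tme T y) (tme_bound _ T0); rewrite yE -oE => /(_ Dy)/andP[o1 o2].
have [t' ht' [Dt' oE']] := h1 o1; have /andP[t'0 _] := node_bound vn ht'.
have := optc_le wfE DS t'0 Dt'; rewrite vtx_node // tme_node // -oE' => /andP[_ o3].
by apply/eqP; rewrite eqn_leq o2.
Qed.

Lemma term_node t : 0 < t <= T -> term n T E strict ck s D v (node T v t) =
  (0 < D (node T v t)) && (w * t + D (node T v t) == optc n E strict ck s v).
Proof.
by move=> ht; rewrite /term vtx_node // tme_node // eqxx; have /andP[-> _] := node_bound vn ht.
Qed.

Lemma tau_sum_ok st : tau_state v st -> nv st vo = optc n E strict ck s v ->
    nv st vsg = 0 ->
  nv (run tau_sum st) vsg = sigma strict ck n E s v /\ ticks tau_sum st = T.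
Proof.
move=> sst so sg0; pose J i t r := t = i /\ nv r vsg =
  \sum_(1 <= t' < i.+1) if term n T E strict ck s D v (node T v t') then S (node T v t') else 0.
have [tE h] : J T (ticks tau_sum st) (run tau_sum st).
  apply: for_rule; [by case: sst | by rewrite /J sg0 big_geq |].
  move=> i t r iT f [-> h]; have sr := tau_state_frame f isT isT sst.
  have ro : nv r vo = optc n E strict ck s v by rewrite (frame_nv f).
  have xN : node T v i.+1 <= N by have /andP[] := node_bound vn (iT : 0 < i.+1 <= T).
  split; first by rewrite ticks_loop_free ?addn1.
  rewrite run_tau_idx // run_When [neval _ _]/= /fupd /= ro.
  case: sr => _ _ _ _ /(_ _ xN)[rD rS]; rewrite rD !mulnb -eqn_leq.
  rewrite big_nat_recr //= -h lt0b term_node //.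
  by case: ifP => _; rewrite /= /fupd /= ?rS ?addn0.
split=> //; rewrite h (sigmaE wfE DS leDB) [RHS]big_mkcond.
case: (posnP T) => [T0|T0]; first by rewrite T0 big_geq // muln0 big_nat1 /term.
rewrite (sum_vertex (V := nat) vn T0) //= => a a0 va.
by rewrite /term (negbTE va) !andbF.
Qed.

Lemma tau_set_ok st : tau_state v st -> nv st vo = optc n E strict ck s v ->
    nv st vsg = sigma strict ck n E s v ->
  [/\ forall t, 0 < t <= T ->
        ra (run tau_set st) rTau (node T v t) = tau n T E strict ck s D (node T v t),
      forall y, y <= v * T -> ra (run tau_set st) rTau y = ra st rTau y
    & ticks tau_set st = T].
Proof.
move=> sst so sg; pose J i t r := [/\ t = i,
  forall t', 0 < t' <= i -> ra r rTau (node T v t') = tau n T E strict ck s D (node T v t')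
  & forall y, y <= v * T -> ra r rTau y = ra st rTau y].
have [tE h1 h2] : J T (ticks tau_set st) (run tau_set st); last by split.
apply: for_rule; [by case: sst | by split=> // -[] |].
move=> i t r iT f [-> h1 h2]; have sr := tau_state_frame f isT isT sst.
have ro : nv r vo = optc n E strict ck s v by rewrite (frame_nv f).
have rsg : nv r vsg = sigma strict ck n E s v by rewrite (frame_nv f).
have hi : 0 < i.+1 <= T by [].
have xN : node T v i.+1 <= N by have /andP[] := node_bound vn hi.
have x0 : 0 < node T v i.+1 by have /andP[] := node_bound vn hi.
have rE : run (tau_idx ;; If (NMul (NMul (NLe (NC 1) (NA aD (NV vx))) (NEq (NV vy) (NV vo)))
           (NNot (NEq (NV vv) (NV vs)))) (RPut rTau (NV vx) (RDiv (RN (NC 1)) (RN (NV vsg))))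
     (RPut rTau (NV vx) (RN (NC 0)))) (set_nv r vt i) =
   set_ra (set_nv (set_nv (set_nv r vt i) vx (node T v i.+1)) vy
      (w * i.+1 + D (node T v i.+1))) rTau (node T v i.+1) (tau n T E strict ck s D (node T v i.+1)).
  rewrite run_tau_idx //.
  case: sr => _ _ rs rv /(_ _ xN)[rD _].
  rewrite /= /fupd /= ro rsg rs rv rD !mulnb -!eqn_leq sub1b mulnb lt0b.
  rewrite /tau vtx_node // tme_node // x0 /= -andbA [X in _ && X]andbC.
  by case: ifP.
split; first by rewrite ticks_loop_free ?addn1.
  move=> t' ht'; rewrite rE /= /fupd /=.
  case: (node T v t' =P node T v i.+1) => [->//|ne]; apply: h1.
  have [te|//] : t' = i.+1 \/ 0 < t' <= i by lia.
  by rewrite te in ne.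
move=> y yv; rewrite rE /= /fupd /= ltn_eqF ?h2 //.
by rewrite (leq_ltn_trans yv) // /node -addn1 leq_add2l.
Qed.
End Row.

Lemma tau_prog_ok st : nv st vn = n -> nv st vT = T -> nv st vw = w -> nv st vs = s ->
    (forall x, x <= N -> na st aD x = D x /\ na st aS x = S x) ->
  (forall y, 0 < y <= N -> ra (run tau_prog st) rTau y = tau n T E strict ck s D y) /\
  ticks tau_prog st <= n * (1 + 3 * T).
Proof.
move=> sn sT sw ss sD; pose J i t r := t <= i * (1 + 3 * T) /\
  forall y, 0 < y <= i * T -> ra r rTau y = tau n T E strict ck s D y.
have [tE h] : J n (ticks tau_prog st) (run tau_prog st); last by split.
apply: for_rule; [exact: sn | by split=> // -[] |].
move=> v t r vn f [tle h].
have sr : tau_state v (set_nv (set_nv r vv v) vo 0).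
  by split; rewrite /= /fupd /= ?(frame_nv f) // => x xN; rewrite !(frame_na f) //; apply: sD.
rewrite /tau_row run_Seq run_NSet ticks_Seq ticks_NSet run_NSet.
rewrite -[neval _ (NC 0)]/0; set r1 := set_nv _ vo 0 in sr *.
have r1o : nv r1 vo = 0 by [].
have ra1 : ra r1 = ra r by [].
move: r1 sr r1o ra1 => r1 sr r1o ra1; rewrite run_Seq ticks_Seq.
have [r2o t2] := tau_min_ok vn sr r1o.
have sr2 := tau_state_frame (frame_run tau_min r1) isT isT sr.
have ra2 : ra (run tau_min r1) rTau = ra r1 rTau by rewrite (frame_ra (frame_run _ _)).
move: (run tau_min r1) r2o sr2 ra2 => r2 r2o sr2 ra2.
rewrite run_Seq ticks_Seq run_NSet ticks_NSet -[neval _ (NC 0)]/0.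
have sr3 : tau_state v (set_nv r2 vsg 0) by case: sr2.
have r3o : nv (set_nv r2 vsg 0) vo = optc n E strict ck s v by [].
have r3g : nv (set_nv r2 vsg 0) vsg = 0 by [].
have ra3 : ra (set_nv r2 vsg 0) = ra r2 by [].
move: (set_nv r2 vsg 0) sr3 r3o r3g ra3 => r3 sr3 r3o r3g ra3.
rewrite run_Seq ticks_Seq; have [r4g t4] := tau_sum_ok vn sr3 r3o r3g.
have sr4 := tau_state_frame (frame_run tau_sum r3) isT isT sr3.
have r4o : nv (run tau_sum r3) vo = optc n E strict ck s v by rewrite (frame_nv (frame_run _ _)).
have ra4 : ra (run tau_sum r3) rTau = ra r3 rTau by rewrite (frame_ra (frame_run _ _)).
move: (run tau_sum r3) r4g sr4 ra4 r4o => r4 r4g sr4 ra4 r4o.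
have [h5 h6 t5] := tau_set_ok vn sr4 r4o r4g.
split; first by rewrite t2 t4 t5; lia.
move=> y hy; have [le|gt] := leqP y (v * T).
  by rewrite h6 // ra4 ra3 ra2 ra1 h //; lia.
have y0 : 0 < y by case/andP: hy.
have T0 : 0 < T by case: (T) hy => // ; rewrite muln0; lia.
have vy : vtx T y = v.
  apply/eqP; rewrite eqn_leq /vtx -ltnS ltn_divLR // leq_divRL //; lia.
by rewrite -(node_vtx T y0) vy h5 // tme_bound.
Qed.
End TauProgram.

(** * Backward accumulation *)

Definition back_add :=
  When (NEq (NA aD (NV vy)) (NAdd (NA aD (NV vx)) (NC 1)))
    (RSet racc (RAdd (RV racc) (RAdd (RA rTau (NV vy)) (RA rU (NV vy))))).

Definition back_body :=
  When (NLt (NV vi) (NV vcnt)) (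
    NSet vx (NA aQ (NSub (NV vcnt) (NAdd (NV vi) (NC 1)))) ;;
    RSet racc (RN (NC 0)) ;;
    ForSucc back_add ;;
    RPut rU (NV vx) (RV racc)).

Definition back := For vi (NAdd (NV vN) (NC 1)) back_body.

Definition acc_passive := For vi (NV vN) (
  NSet vx (NAdd (NV vi) (NC 1)) ;;
  When (NMul (NLe (NC 1) (NA aD (NV vx))) (NNot (NEq (NA aVtx (NV vx)) (NV vs))))
    (RPut rB (NV vx)
      (RAdd (RA rB (NV vx)) (RMul (RN (NA aS (NV vx))) (RA rU (NV vx)))))).

Lemma run_RSet v e st : run (RSet v e) st = set_rv st v (reval st e).
Proof. by []. Qed.

Lemma ticks_RSet v e st : ticks (RSet v e) st = 0.
Proof. by []. Qed.

Lemma run_RPut a i e st : run (RPut a i e) st = set_ra st a (neval st i) (reval st e).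
Proof. by []. Qed.

Lemma ticks_RPut a i e st : ticks (RPut a i e) st = 0.
Proof. by []. Qed.

Section BackProgram.
Variables (n T : nat) (E : seq arc).
Hypothesis wfE : wf_tgraph n T E.
Variables (d K s : nat) (D S : nat -> nat) (q : seq nat).
Notation N := (n * T).
Notation succ := (tsucc T E d K s).
Notation deg x := (size (out E (ux T s x))).
Hypothesis inv : bfs_inv succ N N.+1 D S q.

Lemma tight_sum_ok c st x (tau U : nat -> rat) :
    graph n T E d K s st -> nv st vx = x -> x <= N ->
    (forall y, y <= N -> na st aD y = D y) ->
    rv st racc = 0%R -> ra st rTau = tau -> ra st rU = U -> c = ForSucc back_add ->
  rv (run c st) racc = (\sum_(b <- succ x | D b == (D x).+1) (tau b + U b))%R /\
  ticks c st <= deg x.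
Proof.
move=> gst sx xN DE r0 tauE UE ->.
pose Inv ys r := rv r racc = (\sum_(b <- ys | D b == (D x).+1) (tau b + U b))%R.
apply: (@ForSucc_rule n T E wfE d K s back_add st x Inv) => //.
- by move=> ys r r' _ e _ _; rewrite /Inv e.
- by rewrite /Inv big_nil.
move=> ys e r f ry _ eE ex _; rewrite /Inv => IH.
have yN : tgt T e <= N by have /andP[] := tsucc_bound wfE ex.
have rx : nv r vx = x by rewrite (frame_nv f).
have rD : na r aD = na st aD by rewrite (frame_na f).
have rtau : ra r rTau = tau by rewrite (frame_ra f).
have rU' : ra r rU = U by rewrite (frame_ra f).
rewrite -cats1 big_cat big_cons big_nil -IH run_When neval_NEq.
rewrite [neval _ _]/= [neval _ (NAdd _ _)]/= rx ry rD !DE // addn1 lt0b.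
by case: ifP => _; rewrite /= /fupd /= ?ry ?rtau ?rU' !addr0.
Qed.

(** The queue is sorted by distance and read from its end. The entry written for [x] cannot disturb
    the nodes treated before: their tight successors are strictly farther than [x]. *)
Lemma back_ok st : graph n T E d K s st -> queue st q ->
    (forall y, y <= N -> na st aD y = D y) ->
  (forall x, (0 < D x)%N -> ra (run back st) rU x =
     \sum_(b <- succ x | D b == (D x).+1) (ra st rTau b + ra (run back st) rU b))%R /\
  ticks back st <= N.+1 + \sum_(x <- q) deg x.
Proof.
move=> gst [qc qn] DE; set tau := ra st rTau.
pose P U k := U (nth 0 q k) = (\sum_(b <- succ (nth 0 q k) | D b == (D (nth 0 q k)).+1)
   (tau b + U b))%R.
pose J i t r := t <= i + \sum_(x <- drop (size q - i) q) deg x /\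
  forall k, size q - i <= k < size q -> P (ra r rU) k.
have [tE h] : J N.+1 (ticks back st) (run back st).
  apply: for_rule; first by rewrite /= (static_N (graph_static gst)) addn1.
    by split=> // k; rewrite subn0; lia.
  move=> i t r _ f [tle h].
  have gr : graph n T E d K s (set_nv r vi i).
    have gr : graph n T E d K s r by apply: (graph_frame f) gst.
    by case: gr => -[].
  have condE : neval (set_nv r vi i) (NLt (NV vi) (NV vcnt)) = (i < size q).
    by rewrite neval_NLt /= /fupd /= (frame_nv f) // qc.
  have [lt|ge] := ltnP i (size q); last first.
    have -> : ticks back_body (set_nv r vi i) = 0 by rewrite ticks_When condE lt0b ltnNge ge.
    have -> : run back_body (set_nv r vi i) = set_nv r vi i.
      by rewrite run_When condE lt0b ltnNge ge.
    have e1 : size q - i = 0 by lia.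
    have e2 : size q - i.+1 = 0 by lia.
    rewrite e1 in tle h; split; last by move=> k; rewrite e2; apply: h.
    by rewrite e2 addn1 addSn ltnS.
  set k0 := size q - i.+1; have k0q : k0 < size q by rewrite /k0; lia.
  have k0S : size q - i = k0.+1 by rewrite /k0; lia.
  set x := nth 0 q k0; have xq : x \in q by apply: mem_nth.
  have xN : x <= N by apply: (bfs_bound inv).
  have xE : neval (set_nv r vi i) (NA aQ (NSub (NV vcnt) (NAdd (NV vi) (NC 1)))) = x.
    by rewrite /= /fupd /= (frame_nv f) // (frame_na f) // qc addn1 qn.
  set r1 := set_rv (set_nv (set_nv r vi i) vx x) racc 0.
  have g1 : graph n T E d K s r1 by case: gr => -[].
  have D1 y : y <= N -> na r1 aD y = D y by move=> yN; rewrite /= (frame_na f) // DE.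
  have tau1 : ra r1 rTau = tau by rewrite /= (frame_ra f).
  have runE : run back_body (set_nv r vi i) =
      run (RPut rU (NV vx) (RV racc)) (run (ForSucc back_add) r1).
    by rewrite run_When condE lt0b lt run_Seq run_NSet xE.
  have tickE : ticks back_body (set_nv r vi i) = ticks (ForSucc back_add) r1.
    rewrite ticks_When condE lt0b lt ticks_Seq run_NSet xE ticks_NSet.
    by rewrite ticks_Seq ticks_RSet run_RSet ticks_Seq ticks_RPut addn0.
  have [acc2 t2] := tight_sum_ok g1 (erefl : nv r1 vx = x) xN D1 erefl tau1 erefl erefl.
  have x2 : nv (run (ForSucc back_add) r1) vx = x by rewrite (frame_nv (frame_run _ _)).
  have U2 : ra (run (ForSucc back_add) r1) rU = ra r rU by rewrite (frame_ra (frame_run _ _)).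
  rewrite runE tickE; move: (run (ForSucc _) r1) (ticks _ r1) acc2 t2 x2 U2 => r2 t2 acc2 t2le x2 U2.
  split.
    rewrite (drop_nth 0) // -/k0 -/x big_cons -k0S.
    by move: tle t2le; lia.
  move=> k hk; rewrite run_RPut /P /= /fupd /= x2 acc2 U2.
  have lek : k0 <= k by case/andP: hk.
  have ltk : k < size q by case/andP: hk.
  have Dk : D x <= D (nth 0 q k).
    have [-> //|lt'] : k = k0 \/ k0 < k by lia.
    by have /pairwiseP := bfs_sorted inv => /(_ 0 k0 k); rewrite !inE; apply.
  have bx b : D b == (D (nth 0 q k)).+1 -> (b == x) = false.
    by move=> /eqP Db; apply/eqP => bx; move: Dk; rewrite -bx Db ltnn.
  transitivity (\sum_(b <- succ (nth 0 q k) | D b == (D (nth 0 q k)).+1) (tau b + ra r rU b))%R.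
    have [->|lt'] : k = k0 \/ k0 < k by lia.
      by rewrite -/x eqxx.
    rewrite (_ : (nth 0 q k == x) = false); last first.
      by rewrite /x nth_uniq ?(bfs_uniq inv) //; apply/eqP; lia.
    by apply: h; rewrite k0S lt'.
  by apply: eq_bigr => b /bx->.
split; last first.
  apply: leq_trans tE _; rewrite leq_add2l (_ : size q - N.+1 = 0) ?drop0 //.
  by apply/eqP; rewrite subn_eq0; apply: (bfs_size inv).
move=> x Dx; have xq : x \in q by rewrite (bfs_mem inv).
have := h (index x q); rewrite /P nth_index //; apply.
rewrite index_mem xq andbT (_ : size q - N.+1 = 0) //.
by apply/eqP; rewrite subn_eq0; apply: (bfs_size inv).
Qed.

Lemma acc_passive_ok st : static n T E st -> nv st vs = s ->
    (forall y, y <= N -> na st aD y = D y) -> (forall y, y <= N -> na st aS y = S y) ->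
  (forall y, (0 < y <= N)%N -> ra (run acc_passive st) rB y = ra st rB y +
     if (0 < D y)%N && (vtx T y != s) then (S y)%:R * ra st rU y else 0)%R /\
  ticks acc_passive st = N.
Proof.
move=> sst ss DE SE.
pose J i t r := t = i /\ forall y, (0 < y <= N)%N -> (ra r rB y = ra st rB y +
     if [&& y <= i, 0 < D y & vtx T y != s]%N then (S y)%:R * ra st rU y else 0)%R.
have [tE h] : J N (ticks acc_passive st) (run acc_passive st).
  apply: for_rule; first exact: (static_N sst).
    by split=> // y /andP[y0 _]; rewrite leqNgt y0 addr0.
  move=> i t r iN f [-> h]; split; first by rewrite ticks_loop_free ?addn1.
  have rD : na r aD = na st aD by rewrite (frame_na f).
  have rS : na r aS = na st aS by rewrite (frame_na f).
  have rV : na r aVtx = na st aVtx by rewrite (frame_na f).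
  have rs : nv r vs = s by rewrite (frame_nv f).
  have rU' : ra r rU = ra st rU by rewrite (frame_ra f).
  have [vE _] := static_node sst (iN : 0 < i.+1 <= N).
  move=> y hy; rewrite run_Seq run_NSet run_When.
  rewrite [neval _ (NMul _ _)]/= [neval _ (NAdd _ _)]/= /fupd /= addn1 rD rV rs vE DE //.
  rewrite mulnb -eqn_leq sub1b mulnb lt0b.
  have [ye|ny] := eqVneq y i.+1.
    rewrite ye; case: ifP => c; rewrite /= /fupd /= ?leqnn ?c ?eqxx /= h ?ltnn //.
      by rewrite addr0 rS rU' SE.
  rewrite (leq_eqVlt y) (negbTE ny) ltnS /=.
  by case: ifP => c; rewrite /= /fupd /= ?(negbTE ny) h.
split=> // y hy; rewrite h //; case/andP: (hy) => _ ->; by [].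
Qed.
End BackProgram.

(** * Accumulation for active walks *)

Definition node_idx i := NAdd (NAdd (NMul (NV vv) (NV vT)) (NV i)) (NC 1).

(** Only the entries [1, ..., T] enter the prefix sums; entry [T + 1], which updates can also reach,
    is left with arbitrary contents. *)
Definition clear_row := For vt (NAdd (NV vT) (NC 1)) (RPut rX (NV vt) (RN (NC 0))).

(** [vt] and [vq] count times from 0, so the loop runs over [1, ..., t - 1] for [t = vt + 1]. *)
Definition count_doubles := For vq (NV vt) (
  NSet vz (node_idx vq) ;;
  When (NMul (NMul (NLe (NC 1) (NA aD (NV vz))) (NLe (NV vt) (NAdd (NV vq) (NV vK))))
        (NMul (NLe (NC 1) (NA aG (NV vx)))
              (NEq (NAdd (NA aD (NV vx)) (NC 1)) (NAdd (NA aD (NV vz)) (NA aG (NV vx))))))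
    (NSet vp (NAdd (NV vp) (NMul (NA aS (NV vz)) (NA aC (NV vx)))))).

(* Waiting at [v] from time [t] until an arc of time [t''] contributes to the times in
   (t, t'']: the entries t + 1 and t'' + 1 of a difference array. *)
Definition wait_add :=
  When (NEq (NA aD (NV vy)) (NAdd (NA aD (NV vx)) (NC 1))) (
    RSet rtmp (RMul (RN (NA aS (NV vx))) (RAdd (RA rTau (NV vy)) (RA rU (NV vy)))) ;;
    RPut rX (NAdd (NV vt) (NC 2)) (RAdd (RA rX (NAdd (NV vt) (NC 2))) (RV rtmp)) ;;
    RPut rX (NAdd (NV va) (NC 1)) (RSub (RA rX (NAdd (NV va) (NC 1))) (RV rtmp))).

Definition add_point :=
  NSet vx (node_idx vt) ;;
  When (NLe (NC 1) (NA aD (NV vx))) (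
    NSet vp (NC 0) ;; count_doubles ;;
    RPut rB (NV vx) (RAdd (RA rB (NV vx))
      (RMul (RSub (RN (NA aS (NV vx))) (RN (NV vp))) (RA rU (NV vx)))) ;;
    ForSucc wait_add).

Definition add_points := For vt (NV vT) add_point.

Definition add_waits := RSet racc (RN (NC 0)) ;; For vt (NV vT) (
  RSet racc (RAdd (RV racc) (RA rX (NAdd (NV vt) (NC 1)))) ;;
  RPut rB (node_idx vt) (RAdd (RA rB (node_idx vt)) (RV racc))).

Definition active_row := clear_row ;; add_points ;; add_waits.

Definition acc_active :=
  For vv (NV vn) (When (NNot (NEq (NV vv) (NV vs))) active_row).

Section ActiveRow.
Variables (n T : nat) (E : seq arc).
Hypothesis wfE : wf_tgraph n T E.
Variables (strict : bool) (ck : cost_kind) (s : nat).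
Variables (D S D0 S0 : nat -> nat) (tau U : nat -> rat).
Notation N := (n * T).
Notation K := (window T ck).
Notation succ := (tsucc T E strict K s).
Variable v : nat.
Hypothesis v_lt : v < n.

Record row_state st : Prop := RowState {
  row_graph : graph n T E strict K s st;
  row_K : nv st vK = K;
  row_v : nv st vv = v;
  row_D : forall y, y <= N -> na st aD y = D y;
  row_S : forall y, y <= N -> na st aS y = S y;
  row_tau : ra st rTau = tau;
  row_U : ra st rU = U;
  row_G : forall t, 0 < t <= T -> na st aG (node T v t) = D0 (node T v t);
  row_C : forall t, 0 < t <= T -> na st aC (node T v t) = S0 (node T v t)
}.

Lemma row_frame c st r : frame c st r ->
    avoids (nv_writes c) [:: vn; vT; vm; vN; vK; vv] ->
    avoids (na_writes c)
      [:: aDeg; aTim; aTgt; aVtx; aTme; aUx; aLo; aHi; aD; aS; aG; aC] ->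
    avoids (ra_writes c) [:: rTau; rU] ->
  row_state st -> row_state r.
Proof.
move=> f hv ha hr [h1 h2 h3 h4 h5 h6 h7 h8 h9].
have fv i := avoids_frame_nv (v := i) f hv; have fa a := avoids_frame_na (a := a) f ha.
have fr a : a \in [:: rTau; rU] -> ra r a = ra st a by move/allP: hr => h /h; apply: (frame_ra f).
split; rewrite ?fv ?fa ?fr //; apply: graph_frame f _ _ h1.
  by move: hv; rewrite /avoids /= => /and5P[-> -> -> -> _].
by move: ha; rewrite /avoids /= => /and5P[-> -> -> -> /and5P[-> -> -> ->]].
Qed.

Lemma node_idxE st i : row_state st -> neval st (node_idx i) = node T v (nv st i).+1.
Proof.
move=> h; have sT := static_T (graph_static (row_graph h)).
by rewrite /= sT (row_v h) addn1 /node addnS.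
Qed.

Lemma clear_row_ok st : nv st vT = T ->
  (forall t, t <= T -> ra (run clear_row st) rX t = 0%R) /\ ticks clear_row st = T.+1.
Proof.
move=> sT; pose J i t r := t = i /\ forall x, x < i -> ra r rX x = 0%R.
have [tE h] : J T.+1 (ticks clear_row st) (run clear_row st); last by split.
apply: for_rule; [by rewrite /= sT addn1 | by [] |].
move=> i t r _ _ [-> h]; split; first by rewrite addn1.
move=> x; rewrite /= /fupd /= ltnS leq_eqVlt; case: eqP => //= _; exact: h.
Qed.

Let node_le t : 0 < t <= T -> 0 < node T v t <= N.
Proof. exact: node_bound. Qed.

Lemma count_doubles_ok st i : row_state st -> i < T -> nv st vt = i ->
    nv st vx = node T v i.+1 -> nv st vp = 0 ->
  nv (run count_doubles st) vp = double_visits T ck D S v i.+1 D0 S0 /\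
  ticks count_doubles st = i.
Proof.
move=> h iT st_t st_x st_p.
have hi : 0 < i.+1 <= T by [].
pose J j t r := t = j /\ nv r vp = \sum_(1 <= t' < j.+1)
  (if [&& 0 < D (node T v t'), i.+1 <= t' + K, 0 < D0 (node T v i.+1) &
       (D (node T v i.+1)).+1 == D (node T v t') + D0 (node T v i.+1)]
   then S (node T v t') * S0 (node T v i.+1) else 0).
have [tE hp] : J i (ticks count_doubles st) (run count_doubles st); last by split.
apply: for_rule; [by [] | by rewrite /J st_p big_geq |].
move=> j t r ji f [-> hr]; split; first by rewrite ticks_loop_free ?addn1.
have h1 : row_state r by apply: (row_frame f).
have hj : 0 < j.+1 <= T by rewrite /= (ltn_trans ji).
have /andP[_ xN] := node_le hi; have /andP[_ zN] := node_le hj.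
have h2 : row_state (set_nv r vq j) by case: h1 => -[[]].
have zE : neval (set_nv r vq j) (node_idx vq) = node T v j.+1 by rewrite node_idxE.
rewrite run_Seq run_NSet zE run_When /= /fupd /=.
have rt : nv r vt = i by rewrite (frame_nv f).
have rx : nv r vx = node T v i.+1 by rewrite (frame_nv f).
rewrite rt rx (row_K h1) !(row_D h1) // (row_G h1) // !mulnb lt0b -eqn_leq addn1.
rewrite big_nat_recr //= -hr -!andbA addSn ltnS.
case: ifP => _; rewrite /= /fupd /= ?rx ?addn0 //.
by rewrite (row_S h1) // (row_C h1).
Qed.

Local Open Scope ring_scope.

(** What the waits starting at [(v, t)] add to entry [y] of the difference array, per shortest walk
    to [(v, t)]. *)
Definition wait_diff t y : rat := \sum_(b <- succ (node T v t) | D b == (D (node T v t)).+1)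
  ((t.+1 == y)%:R - ((tme T b).+1 == y)%:R) * (tau b + U b).

Lemma wait_add_ok st i : row_state st -> (i < T)%N -> nv st vt = i ->
    nv st vx = node T v i.+1 ->
  (forall y, ra (run (ForSucc wait_add) st) rX y =
     ra st rX y + (S (node T v i.+1))%:R * wait_diff i.+1 y) /\
  (ticks (ForSucc wait_add) st <= size (out E v))%N.
Proof.
move=> h iT st_t st_x; have hi : (0 < i.+1 <= T)%N by [].
have /andP[x0 xN] := node_le hi; set x := node T v i.+1 in x0 xN st_x *.
pose Inv ys r := forall y, ra r rX y = ra st rX y + (S x)%:R *
  \sum_(b <- ys | D b == (D x).+1) ((i.+2 == y)%:R - ((tme T b).+1 == y)%:R) * (tau b + U b).
have uxE : ux T s x = v by rewrite /ux (gtn_eqF x0) /x vtx_node.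
rewrite -[X in out E X]uxE.
apply: (@ForSucc_rule n T E wfE strict K s wait_add st x Inv) => //; first exact: row_graph.
- by move=> ys r r' _ _ e _; rewrite /Inv e.
- by move=> y; rewrite big_nil mulr0 addr0.
move=> ys e r f ry ra' eE ex _ IH y.
have yN : (tgt T e <= N)%N by have /andP[] := tsucc_bound wfE ex.
have rx : nv r vx = x by rewrite (frame_nv f).
have rt : nv r vt = i by rewrite (frame_nv f).
have rD : na r aD = na st aD by rewrite (frame_na f).
have rS : na r aS = na st aS by rewrite (frame_na f).
have rtau : ra r rTau = tau by rewrite (frame_ra f) // (row_tau h).
have rU' : ra r rU = U by rewrite (frame_ra f) // (row_U h).
rewrite -cats1 big_cat big_cons big_nil run_When neval_NEq.
rewrite [neval _ _]/= [neval _ (NAdd _ _)]/= rx ry rD !(row_D h) // addn1 lt0b.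
case: ifP => _; last by rewrite /= addr0 IH.
rewrite /= addr0 [in RHS]mulrDr [in RHS]addrA -IH /fupd /= ry rx rt ra' rS rtau rU' (row_S h) // (tme_tgt wfE eE).
rewrite addn2 addn1; move: (tau (tgt T e) + U (tgt T e)) ((S x)%:R : rat) => a b.
(* Both updates hit the same entry if the arc leaves without waiting; they then cancel. *)
move: i.+2 (tim e).+1 => p1 p2; rewrite (eq_sym p1 y) (eq_sym p2 y).
case: (y =P p2) => [<-|_]; case: (y =P p1) => [<-|_] /=.
- by rewrite subrr mul0r mulr0 addr0 addrK.
- by rewrite sub0r mulN1r mulrN.
- by rewrite subr0 mul1r.
- by rewrite subrr mul0r mulr0 addr0.
Qed.

(** The walks arriving at [(v, t)], less those already counted as waiting through [t]. The
    difference is taken in [rat], so it is not truncated. *)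
Definition own_visits t : rat := if (0 < D (node T v t))%N then
  ((S (node T v t))%:R - (double_visits T ck D S v t D0 S0)%:R) * U (node T v t) else 0.

Lemma add_points_ok st : row_state st -> (forall t, (t <= T)%N -> ra st rX t = 0) ->
  [/\ forall t, (0 < t <= T)%N -> ra (run add_points st) rB (node T v t) =
         ra st rB (node T v t) + own_visits t,
      forall y, (y <= v * T)%N || (v * T + T < y)%N -> ra (run add_points st) rB y = ra st rB y,
      forall y, (y <= T)%N -> ra (run add_points st) rX y =
        \sum_(1 <= t' < T.+1 | (0 < D (node T v t'))%N) (S (node T v t'))%:R * wait_diff t' y
    & (ticks add_points st <= T * (1 + T + size (out E v)))%N].
Proof.
move=> h X0.
pose J i t r := [/\ (t <= i * (1 + T + size (out E v)))%N,
  forall t, (0 < t <= T)%N -> ra r rB (node T v t) =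
    ra st rB (node T v t) + (if (t <= i)%N then own_visits t else 0),
  forall y, (y <= v * T)%N || (v * T + T < y)%N -> ra r rB y = ra st rB y
  & forall y, (y <= T)%N -> ra r rX y =
      \sum_(1 <= t' < i.+1 | (0 < D (node T v t'))%N) (S (node T v t'))%:R * wait_diff t' y].
have [tE h1 h2 h3] : J T (ticks add_points st) (run add_points st); last first.
  by split=> // t ht; rewrite h1 //; case/andP: ht => _ ->.
apply: for_rule; first exact: (static_T (graph_static (row_graph h))).
  split=> // [t /andP[t0 _]|y yT]; first by rewrite leqNgt t0 addr0.
  by rewrite big_geq // X0.
move=> i t r iT f [tle hB hB' hX].
have hi : (0 < i.+1 <= T)%N by [].
have /andP[x0 xN] := node_le hi.
have hr : row_state r by apply: (row_frame f).
have hr1 : row_state (set_nv r vt i) by case: hr => -[[]].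
have xE : neval (set_nv r vt i) (node_idx vt) = node T v i.+1 by rewrite node_idxE.
rewrite /add_point run_Seq run_NSet ticks_Seq ticks_NSet run_NSet xE add0n.
set x := node T v i.+1 in x0 xN xE *; set r1 := set_nv _ vx x.
have hr2 : row_state r1 by case: hr1 => -[[]].
rewrite run_When ticks_When.
have -> : (0 < neval r1 (NLe (NC 1) (NA aD (NV vx))))%N = (0 < D x)%N.
  by rewrite /= /fupd /= (row_D hr) // lt0b.
have nodeP t' : (0 < t' <= T)%N -> (node T v t' == x) = (t' == i.+1).
  by move=> ht'; rewrite /x /node eqn_add2l.
have outP y : (y <= v * T)%N || (v * T + T < y)%N -> (y == x) = false.
  by move=> hy; apply/eqP => yx; move: hy hi; rewrite yx /x /node; lia.
case: ifP => Dx; last first.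
  split; first by lia.
  - move=> t' ht'; rewrite /= hB // [(t' <= i.+1)%N]leq_eqVlt ltnS.
    case: eqP => [->|_] //=; rewrite ltnn /own_visits -/x Dx; by [].
  - by move=> y hy; rewrite /= hB'.
  - by move=> y hy; rewrite /= hX // [RHS]big_mkcond big_nat_recr //= -/x Dx addr0 -big_mkcond.
rewrite run_Seq run_NSet ticks_Seq ticks_NSet run_NSet -[neval _ (NC 0)]/0%N add0n.
set r2 := set_nv r1 vp 0.
have hr3 : row_state r2 by case: hr2 => -[[]].
have r2B : ra r2 = ra r by [].
have r2t : nv r2 vt = i by [].
have r2x : nv r2 vx = x by [].
have r2p : nv r2 vp = 0%N by [].
move: r2 hr3 r2B r2t r2x r2p => r2 hr3 r2B r2t r2x r2p.
rewrite run_Seq ticks_Seq; have [p3 t3] := count_doubles_ok hr3 iT r2t r2x r2p.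
have f3 := frame_run count_doubles r2.
have hr4 := row_frame f3 isT isT isT hr3.
have r3B : ra (run count_doubles r2) rB = ra r rB by rewrite (frame_ra f3) // r2B.
have r3X : ra (run count_doubles r2) rX = ra r rX by rewrite (frame_ra f3) // r2B.
have r3t : nv (run count_doubles r2) vt = i by rewrite (frame_nv f3).
have r3x : nv (run count_doubles r2) vx = x by rewrite (frame_nv f3).
rewrite t3; move: (run count_doubles r2) p3 hr4 r3B r3X r3t r3x {f3}.
move=> r3 p3 hr4 r3B r3X r3t r3x.
rewrite run_Seq run_RPut ticks_Seq ticks_RPut run_RPut add0n.
set r4 := set_ra r3 rB _ _.
have hr5 : row_state r4 by case: hr4 => -[[]].
have [X5 t5] := wait_add_ok hr5 iT (r3t : nv r4 vt = i) (r3x : nv r4 vx = x).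
have B5 : ra (run (ForSucc wait_add) r4) rB = ra r4 rB by rewrite (frame_ra (frame_run _ _)).
have B4 y : ra r4 rB y = ra r rB y + if y == x then own_visits i.+1 else 0.
  rewrite /r4 /= /fupd /= r3x r3B p3 (row_S hr4) // (row_U hr4).
  by case: eqP => [->|_]; rewrite ?addr0 // /own_visits -/x Dx.
have X4 : ra r4 rX = ra r rX by [].
move: (run (ForSucc wait_add) r4) (ticks (ForSucc wait_add) r4) X5 t5 B5 => r5 t5 X5 t5le B5.
split.
- by move: tle t5le iT; nia.
- move=> t' ht'; rewrite B5 B4 hB // nodeP // [(t' <= i.+1)%N]leq_eqVlt ltnS.
  by case: eqP => [->|_] /=; rewrite ?ltnn ?addr0.
- by move=> y hy; rewrite B5 B4 outP // hB' // addr0.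
- by move=> y yT; rewrite X5 X4 hX // [RHS]big_mkcond big_nat_recr //= -/x Dx -big_mkcond.
Qed.

Definition wait_visits t : rat :=
  \sum_(1 <= t' < T.+1 | (0 < D (node T v t'))%N) (S (node T v t'))%:R *
    \sum_(b <- succ (node T v t') | D b == (D (node T v t')).+1)
       (t' < t <= tme T b)%N%:R * (tau b + U b).

Lemma sum_indicator k t : (0 < k)%N ->
  \sum_(1 <= y < t.+1) (k == y)%:R = (k <= t)%N%:R :> rat.
Proof.
move=> k0; case: leqP => [le|lt].
  rewrite (bigD1_seq k) ?iota_uniq ?mem_index_iota ?k0 ?ltnS //= eqxx.
  by rewrite big1 ?addr0 // => y ny; rewrite eq_sym (negbTE ny).
rewrite big_nat_cond big1 // => y /andP[/andP[_ yt] _].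
by rewrite gtn_eqF // (leq_trans yt).
Qed.

(** The prefix sum of the two entries of an interval is its indicator; this uses that an arc out of
    [(v, t')] is never earlier than [t']. *)
Lemma sum_wait_diff t : (0 < t <= T)%N ->
  \sum_(1 <= y < t.+1)
     \sum_(1 <= t' < T.+1 | (0 < D (node T v t'))%N) (S (node T v t'))%:R * wait_diff t' y
  = wait_visits t.
Proof.
move=> ht; rewrite exchange_big /= big_nat_cond [RHS]big_nat_cond.
apply: eq_bigr => t' /andP[ht' _]; rewrite -mulr_sumr; congr (_ * _).
rewrite /wait_diff exchange_big /= big_seq_cond [RHS]big_seq_cond.
apply: eq_bigr => b /andP[hb _]; rewrite -mulr_suml sumrB !sum_indicator //; congr (_ * _).
have /andP[x0 _] := node_le ht'.
have [_ /andP[le _]] := edge_tme wfE x0 hb; rewrite tme_node // in le.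
have {}le : (t' <= tme T b)%N by apply: leq_trans le; apply: leq_addr.
case: (ltnP t' t) => [lt|ge]; case: (leqP t (tme T b)) => [l2|g2] /=; rewrite ?subr0 ?subrr //.
by move: (leq_trans ge le); rewrite leqNgt g2.
Qed.

Lemma add_waits_ok st : row_state st ->
  [/\ forall t, (0 < t <= T)%N -> ra (run add_waits st) rB (node T v t) =
         ra st rB (node T v t) + \sum_(1 <= y < t.+1) ra st rX y,
      forall y, (y <= v * T)%N || (v * T + T < y)%N -> ra (run add_waits st) rB y = ra st rB y
    & (ticks add_waits st <= T)%N].
Proof.
move=> h0; rewrite /add_waits run_Seq run_RSet ticks_Seq ticks_RSet run_RSet add0n.
set st1 := set_rv _ _ _.
have h : row_state st1 by case: h0 => -[[]].
have -> : ra st = ra st1 by [].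
have acc1 : rv st1 racc = 0 by [].
move: st1 h acc1 => {h0} {}st h acc1.
pose J i t r := [/\ t = i, rv r racc = \sum_(1 <= y < i.+1) ra st rX y,
  forall t, (0 < t <= T)%N -> ra r rB (node T v t) = ra st rB (node T v t) +
    (if (t <= i)%N then \sum_(1 <= y < t.+1) ra st rX y else 0)
  & forall y, (y <= v * T)%N || (v * T + T < y)%N -> ra r rB y = ra st rB y].
set c := For _ _ _.
have [tE _ h1 h2] : J T (ticks c st) (run c st); last first.
  by split=> [t ht||] //; [rewrite h1 //; case/andP: ht => _ -> | rewrite tE].
apply: for_rule; first exact: (static_T (graph_static (row_graph h))).
  by split=> // [|t /andP[t0 _]]; [rewrite big_geq | rewrite leqNgt t0 addr0].
move=> i t r iT f [-> hacc hB hB'].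
have hr : row_state r by apply: (row_frame f).
have hr1 : row_state (set_nv r vt i) by case: hr => -[[]].
have rX' : ra r rX = ra st rX by rewrite (frame_ra f).
rewrite ticks_loop_free // addn1 run_Seq run_RSet run_RPut.
set r1 := set_rv _ _ _.
have r1acc : rv r1 racc = \sum_(1 <= y < i.+2) ra st rX y.
  by rewrite /r1 /= /fupd /= hacc rX' addn1 [RHS]big_nat_recr.
have hr2 : row_state r1 by case: hr1 => -[[]].
have xE : neval r1 (node_idx vt) = node T v i.+1 by rewrite node_idxE.
have r1B : ra r1 = ra r by [].
move: r1 r1acc hr2 xE r1B => r1 r1acc hr2 xE r1B.
rewrite [reval _ _]/= -[neval r1 _]/(neval r1 (node_idx vt)) xE r1acc r1B; split=> //.
- move=> t' ht'; rewrite /= /fupd /= r1B.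
  have -> : (node T v t' == node T v i.+1) = (t' == i.+1) by rewrite /node eqn_add2l.
  rewrite [(t' <= i.+1)%N]leq_eqVlt ltnS.
  case: eqP => [->|_] /=; last by rewrite hB.
  by rewrite (xE : (nv r1 vv * nv r1 vT + nv r1 vt + 1)%N = _) hB // ltnn addr0.
- move=> y hy; rewrite /= /fupd /= r1B; case: eqP => [yx|_]; last exact: hB'.
  by exfalso; move: hy iT; rewrite yx /node; lia.
Qed.

Lemma active_row_ok st : row_state st ->
  [/\ forall t, (0 < t <= T)%N -> ra (run active_row st) rB (node T v t) =
         ra st rB (node T v t) + (own_visits t + wait_visits t),
      forall y, (y <= v * T)%N || (v * T + T < y)%N -> ra (run active_row st) rB y = ra st rB y
    & (ticks active_row st <= T.+1 + T * (1 + T + size (out E v)) + T)%N].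
Proof.
move=> h; have [X1 t1] := clear_row_ok (static_T (graph_static (row_graph h))).
have h1 := row_frame (frame_run clear_row st) isT isT isT h.
have B1 : ra (run clear_row st) rB = ra st rB by rewrite (frame_ra (frame_run _ _)).
rewrite /active_row run_Seq ticks_Seq t1; move: (run clear_row st) h1 B1 X1 => r1 h1 B1 X1.
have [B2 B2' X2 t2] := add_points_ok h1 X1.
have h2 := row_frame (frame_run add_points r1) isT isT isT h1.
rewrite run_Seq ticks_Seq.
move: (run add_points r1) (ticks add_points r1) h2 B2 B2' X2 t2 => r2 t2 h2 B2 B2' X2 t2le.
have [B3 B3' t3] := add_waits_ok h2.
split; last by rewrite -addnA leq_add2l leq_add.
  move=> t ht; rewrite B3 // B2 // B1 -addrA; congr (_ + (_ + _)).
  rewrite -sum_wait_diff //; apply: eq_big_nat => y /andP[_ yt]; apply: X2.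
  by rewrite (leq_trans (_ : y <= t)%N) //; case/andP: ht.
by move=> y hy; rewrite B3' // B2' // B1.
Qed.
End ActiveRow.

(** * Bounds on the number of scanned arcs *)

Lemma sum_deg n (E : seq arc) : \sum_(0 <= u < n) size (out E u) <= size E.
Proof.
elim: E => [|e E' IH]; first by rewrite big1.
rewrite (eq_bigr (fun u => (src e == u) + size (out E' u))); last first.
  by move=> u _; rewrite /out /=; case: eqP.
rewrite big_split /= -add1n leq_add //.
have [lt|ge] := ltnP (src e) n; last first.
  rewrite big_nat_cond big1 // => u /andP[/andP[_ un] _].
  by rewrite gtn_eqF // (leq_trans un).
rewrite (bigD1_seq (src e)) ?iota_uniq ?mem_index_iota //= eqxx.
by rewrite big1 ?addn0 // => u /negbTE; rewrite eq_sym => ->.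
Qed.

Lemma sum_vtx n T (f : nat -> nat) :
  \sum_(1 <= x < (n * T).+1) f (vtx T x) = T * \sum_(0 <= v < n) f v.
Proof.
elim: n => [|n IH]; first by rewrite !big_geq ?muln0.
rewrite (big_cat_nat (n := (n * T).+1)) //=; last by rewrite mulSn; lia.
rewrite IH [in RHS]big_nat_recr //= mulnDr; congr (_ + _).
rewrite (eq_big_nat _ _ (F2 := fun=> f n)) => [|x hx].
  by rewrite sum_nat_const_nat mulSn subSS addnK.
have T0 : 0 < T by case: (posnP T) hx => // ->; rewrite !muln0; lia.
by congr f; apply/eqP; rewrite eqn_leq /vtx -ltnS ltn_divLR // leq_divRL //; lia.
Qed.

(** The root scans the arcs of [s] once, and each vertex owns [T] temporal nodes. *)
Lemma sum_deg_queue n T (E : seq arc) s q : s < n -> uniq q -> (forall x, x \in q -> x <= n * T) ->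
  \sum_(x <- q) size (out E (ux T s x)) <= size E + T * size E.
Proof.
move=> sn uq hq.
apply: (@leq_trans (\sum_(0 <= x < (n * T).+1) size (out E (ux T s x)))).
  rewrite [X in _ <= X](bigID (fun x => x \in q)) /= -[X in X <= _]addn0 leq_add //.
  rewrite -[X in _ <= X]big_filter; apply/eq_leq/perm_big/uniq_perm => //.
    by rewrite filter_uniq ?iota_uniq.
  by move=> x; rewrite mem_filter mem_index_iota /=; case xq: (x \in q) => //=; rewrite ltnS hq.
rewrite big_ltn // leq_add //; first by rewrite size_filter count_size.
rewrite (eq_big_nat _ _ (F2 := fun x => size (out E (vtx T x)))); last first.
  by move=> x /andP[x0 _]; rewrite /ux gtn_eqF.
by rewrite (sum_vtx _ _ (fun v => size (out E v))) leq_mul2l sum_deg orbT.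
Qed.

Section ActiveProgram.
Variables (n T : nat) (E : seq arc).
Hypothesis wfE : wf_tgraph n T E.
Variables (strict : bool) (ck : cost_kind) (s : nat).
Variables (D S : nat -> nat) (D0 S0 : nat -> nat -> nat) (tau U : nat -> rat).
Notation N := (n * T).
Notation K := (window T ck).

Lemma acc_active_ok st : graph n T E strict K s st -> nv st vK = K -> nv st vs = s ->
    (forall y, y <= N -> na st aD y = D y) -> (forall y, y <= N -> na st aS y = S y) ->
    ra st rTau = tau -> ra st rU = U ->
    (forall v t, v < n -> 0 < t <= T ->
       na st aG (node T v t) = D0 v (node T v t) /\ na st aC (node T v t) = S0 v (node T v t)) ->
  (forall v t, v < n -> 0 < t <= T -> (ra (run acc_active st) rB (node T v t) =
     ra st rB (node T v t) + if v == s then 0 else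
       own_visits T ck D S (D0 v) (S0 v) U v t + wait_visits T E strict ck s D S tau U v t)%R) /\
  ticks acc_active st <= n * (1 + T.+1 + T * (1 + T) + T) + T * size E.
Proof.
move=> gst sK ss sD sS stau sU sG.
pose J i k r := [/\ k <= i * (1 + T.+1 + T * (1 + T) + T) + T * \sum_(0 <= u < i) size (out E u)
  & forall v t, v < n -> 0 < t <= T -> (ra r rB (node T v t) = ra st rB (node T v t) +
     if (v < i)%N && (v != s) then
       own_visits T ck D S (D0 v) (S0 v) U v t + wait_visits T E strict ck s D S tau U v t
     else 0)%R].
have [tE h] : J n (ticks acc_active st) (run acc_active st); last first.
  split=> [v t hv ht|]; first by rewrite h // hv; case: eqP.
  by apply: leq_trans tE _; rewrite leq_add2l leq_mul2l sum_deg orbT.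
apply: for_rule; first exact: (static_n (graph_static gst)).
  by split=> // v t _ _; rewrite addr0.
move=> i k r iN f [kle h].
have hr : row_state n T E strict ck s D S (D0 i) (S0 i) tau U i (set_nv r vv i).
  have gr : graph n T E strict K s (set_nv r vv i).
    by have := graph_frame f isT isT gst => -[[]].
  split=> //.
  - by rewrite /= /fupd /= (frame_nv f).
  - by move=> y yN; rewrite /= (frame_na f) // sD.
  - by move=> y yN; rewrite /= (frame_na f) // sS.
  - by rewrite /= (frame_ra f).
  - by rewrite /= (frame_ra f).
  - by move=> t ht; rewrite /= (frame_na f) //; case: (sG i t iN ht).
  - by move=> t ht; rewrite /= (frame_na f) //; case: (sG i t iN ht).
have condE : (0 < neval (set_nv r vv i) (NNot (NEq (NV vv) (NV vs)))) = (i != s).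
  by rewrite /= /fupd /= (frame_nv f) // ss mulnb -eqn_leq; case: eqP.
set r1 := set_nv r vv i in hr condE *.
have rB' : ra r1 = ra r by [].
set c := When _ _; have runE : run c r1 = if i != s then run active_row r1 else r1.
  by rewrite /c run_When condE.
have ticksE : ticks c r1 = if i != s then ticks active_row r1 else 0.
  by rewrite /c ticks_When condE.
rewrite runE ticksE {runE ticksE condE}; clearbody r1.
case: (i =P s) => [is_s|/eqP ns]; rewrite [~~ _]/=; lazy iota.
  split.
    rewrite big_nat_recr //= mulSn [T * (\sum_(0 <= u < i) _ + _)]mulnDr addn1; move: kle.
    set z := T * \sum_(0 <= i0 < i) _; set y := T * size _; set a := T * (1 + T).
    set b := i * _; lia.
  move=> v t hv ht; rewrite rB' h // ltnS [v <= i]leq_eqVlt; congr (_ + _)%R.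
  by case: (v =P i) => [ev|_] //=; rewrite ev ltnn is_s eqxx.
have [B1 B2 t1] := active_row_ok wfE iN hr.
move: (run active_row r1) (ticks active_row r1) B1 B2 t1 => r2 t2 B1 B2 t1.
split.
  rewrite big_nat_recr //= mulSn [T * (\sum_(0 <= u < i) _ + _)]mulnDr; move: kle t1; rewrite mulnDr.
  set z := T * \sum_(0 <= i0 < i) _; set y := T * size _; set a := T * (1 + T).
  set b := i * _; lia.
move=> v t hv ht; have [->|vi_] := eqVneq v i.
  by rewrite B1 // rB' h // ltnn addr0 ltnSn ns.
rewrite B2 ?rB' ?h //; last by apply/orP; move: vi_; rewrite /node; nia.
by rewrite ltnS (leq_eqVlt v) (negbTE vi_).
Qed.
End ActiveProgram.

(** * The loops over all sources *)

Definition core d := bfs d ;; tau_prog ;; back.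

(** Cycles end where they start, so of each search only the [T] entries of its own source are
    kept. *)
Definition save_row := For vt (NV vT) (
  NSet vx (NAdd (NAdd (NMul (NV vs) (NV vT)) (NV vt)) (NC 1)) ;;
  NPut aG (NV vx) (NA aD (NV vx)) ;; NPut aC (NV vx) (NA aS (NV vx))).

Definition load_window cls := NSet vK (if cls is CRestless then NV vk else NV vT).
Definition load_weight cls := NSet vw (if cls is CForemost then NV vn else NC 0).

Definition passive_loop d := For vs (NV vn) (core d ;; acc_passive).
Definition cycles_loop d := For vs (NV vn) (bfs d ;; save_row).
Definition active_loop d := For vs (NV vn) (core d ;; acc_active).

Definition main d cls md :=
  init ;; load_weight cls ;;
  (if md is Passive then load_window cls ;; passive_loop d
   else NSet vK (NC 0) ;; cycles_loop d ;; load_window cls ;; active_loop d).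

Section Main.
Variables (n T : nat) (E : seq arc).
Hypothesis wfE : wf_tgraph n T E.
Variables (strict : bool).
Notation N := (n * T).

Lemma bfs_data d K s st : static n T E st -> nv st vs = s -> s < n -> nv st vK = K ->
  let r := run (bfs d) st in let D := clip N (na r aD) in let S := clip N (na r aS) in
  exists q, [/\ graph n T E d K s r, queue r q, bfs_inv (tsucc T E d K s) N N.+1 D S q,
    shortest_data (tsucc T E d K s) D S
    & ticks (bfs d) st <= 2 * N.+1 + (size E + T * size E)].
Proof.
move=> sst ss sn sK r D S; have [q [g qu inv tk]] := bfs_ok wfE d sst ss sn sK.
exists q; split=> //.
  exact: (bfs_shortest (@tsucc_uniq n T E wfE d K s) inv).
apply: leq_trans tk _; rewrite leq_add2l; apply: (@sum_deg_queue n) => //.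
  exact: (bfs_uniq inv).
by move=> x; apply: (bfs_bound inv).
Qed.

(** The prefixes of a shortest walk have different distances, hence different ends among the [N.+1]
    nodes. *)
Lemma shortest_bound succ D S : (forall x y, y \in succ x -> 0 < y <= N) ->
  shortest_data succ D S -> forall x, D x <= N.+1.
Proof.
move=> succN DS x; case: (posnP (D x)) => [->//|Dx].
have [p [szp pp lp]] := dist_walk DS Dx.
have Dp : D (last 0 p) = (size p).+1 by rewrite lp szp prednK.
pose l := [seq last 0 (take k p) | k <- iota 0 (D x)].
have <- : size l = D x by rewrite size_map size_iota.
rewrite -(size_iota 0 N.+1); apply: uniq_leq_size.
  apply: (@map_uniq _ _ D); rewrite -map_comp map_inj_in_uniq ?iota_uniq //.
  move=> i j; rewrite !mem_iota /= !add0n => hi hj.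
  rewrite !(dist_prefix DS) //; first by case.
    by rewrite szp -ltnS prednK.
  by rewrite szp -ltnS prednK.
move=> y /mapP[k]; rewrite mem_iota add0n => /andP[_ hk] ->.
rewrite mem_iota add0n ltnS /=; apply: (last_path_le succN) => //.
by move: pp; rewrite -{1}(cat_take_drop k p) cat_path => /andP[].
Qed.

Variable ck : cost_kind.
Notation K := (window T ck).
Notation w := (weight n ck).

Lemma core_ok s st : static n T E st -> nv st vs = s -> s < n -> nv st vK = K ->
    nv st vw = w ->
  let r := run (core strict) st in
  exists D S : nat -> nat, [/\ graph n T E strict K s r,
    (forall y, y <= N -> na r aD y = D y) /\ (forall y, y <= N -> na r aS y = S y),
    shortest_data (tsucc T E strict K s) D S,
    (forall y, (0 < D y)%N -> ra r rU y =
      \sum_(b <- tsucc T E strict K s y | D b == (D y).+1)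
         (tau n T E strict ck s D b + ra r rU b))%R /\
    (forall y, (0 < y <= N)%N -> ra r rTau y = tau n T E strict ck s D y)
  & ticks (core strict) st <= 3 * N.+1 + 2 * (size E + T * size E) + n * (1 + 3 * T)].
Proof.
move=> sst ss sn sK sw; rewrite /core run_Seq ticks_Seq.
have [q [g1 q1 inv DS t1]] := bfs_data strict sst ss sn sK.
have f1 := frame_run (bfs strict) st.
have w1 : nv (run (bfs strict) st) vw = w by rewrite (frame_nv f1).
have s1 : nv (run (bfs strict) st) vs = s by rewrite (frame_nv f1).
move: (run (bfs _) st) (ticks (bfs _) st) g1 q1 inv DS t1 w1 s1 {f1}.
move=> r1 t1 g1 q1 inv DS t1le w1 s1; rewrite run_Seq ticks_Seq.
set D := clip N (na r1 aD) in inv DS; set S := clip N (na r1 aS) in inv DS.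
have DE y : y <= N -> na r1 aD y = D y by move=> yN; rewrite /D clipE.
have SE y : y <= N -> na r1 aS y = S y by move=> yN; rewrite /S clipE.
have leD := shortest_bound (@tsucc_bound n T E wfE strict K s) DS.
have st1 := graph_static g1.
have [tauE t2] := tau_prog_ok wfE DS leD (static_n st1) (static_T st1) w1 s1
  (fun x xN => conj (DE x xN) (SE x xN)).
have f2 := frame_run tau_prog r1.
have g2 := graph_frame f2 isT isT g1.
have q2 : queue (run tau_prog r1) q by rewrite /queue (frame_nv f2) // (frame_na f2).
have D2 y : y <= N -> na (run tau_prog r1) aD y = D y by rewrite (frame_na f2) //; apply: DE.
have S2 y : y <= N -> na (run tau_prog r1) aS y = S y by rewrite (frame_na f2) //; apply: SE.
clearbody D S.
move: (run tau_prog r1) (ticks tau_prog r1) tauE t2 g2 q2 D2 S2 {f2}.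
move=> r2 t2 tauE t2le g2 q2 D2 S2.
have [UE t3] := back_ok wfE inv g2 q2 D2.
have f3 := frame_run back r2.
have g3 := graph_frame f3 isT isT g2.
have tau3 : ra (run back r2) rTau = ra r2 rTau by rewrite (frame_ra f3).
have D3 : na (run back r2) aD = na r2 aD by rewrite (frame_na f3).
have S3 : na (run back r2) aS = na r2 aS by rewrite (frame_na f3).
exists D, S; split=> //.
- by split=> y yN; rewrite ?D3 ?S3; [apply: D2 | apply: S2].
- split=> y; last by rewrite tau3; apply: tauE.
  move=> Dy; rewrite UE // big_seq_cond [RHS]big_seq_cond; apply: eq_bigr => b /andP[by_ _].
  by rewrite tauE //; apply: (tsucc_bound wfE by_).
have deg_le : \sum_(x <- q) size (out E (ux T s x)) <= size E + T * size E.
  by apply: (@sum_deg_queue n) => //; [exact: (bfs_uniq inv) | by move=> x; apply: (bfs_bound inv)].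
by move: t1le t2le t3 deg_le; set a := \sum_(x <- q) _; move: (T * size E) (n * _); lia.
Qed.

Lemma passive_loop_ok st : static n T E st -> nv st vK = K -> nv st vw = w ->
    (forall y, 0 < y <= N -> ra st rB y = 0%R) ->
  let c := passive_loop strict in
  (forall v t, v < n -> 0 < t <= T ->
     ra (run c st) rB (node T v t) = betweenness strict ck n T E Passive v t) /\
  ticks c st <= n * (4 * N.+1 + 2 * (size E + T * size E) + n * (1 + 3 * T)).
Proof.
move=> sst sK sw B0 c.
pose C := 4 * N.+1 + 2 * (size E + T * size E) + n * (1 + 3 * T).
pose J i k r := k <= i * C /\ forall v t, v < n -> 0 < t <= T ->
  ra r rB (node T v t) = (\sum_(0 <= s < i)
    \sum_(z < n | [&& s != v, (z : nat) != v & s != z])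
      delta strict ck n T E Passive s z v t)%R.
have [tE h] : J n (ticks c st) (run c st); last first.
  by split=> // v t hv ht; rewrite h // big_mkord.
apply: for_rule; first exact: (static_n sst).
  by split=> // v t hv ht; rewrite big_geq // B0 // node_bound.
move=> s k r sn f [kle h]; set r0 := set_nv r vs s.
have sr : static n T E r0 by have := static_frame f isT isT sst => -[].
have rK : nv r0 vK = K by rewrite /= /fupd /= (frame_nv f).
have rw : nv r0 vw = w by rewrite /= /fupd /= (frame_nv f).
have rs : nv r0 vs = s by [].
have rB0 : ra r0 = ra r by [].
move: r0 sr rK rw rs rB0 => r0 sr rK rw rs rB0; rewrite run_Seq ticks_Seq.
have [D [S [g1 [D1 S1] DS [UE _] t1]]] := core_ok sr rs sn rK rw.
have f1 := frame_run (core strict) r0.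
have B1 : ra (run (core strict) r0) rB = ra r rB by rewrite (frame_ra f1) // rB0.
have s1 : nv (run (core strict) r0) vs = s by rewrite (frame_nv f1).
move: (run (core _) r0) (ticks (core _) r0) g1 D1 S1 UE t1 B1 s1 {f1}.
move=> r1 t1 g1 D1 S1 UE t1le B1 s1.
have [h2 t2] := acc_passive_ok (graph_static g1) s1 D1 S1.
move: (run acc_passive r1) (ticks acc_passive r1) h2 t2 => r2 t2 h2 ->.
have leD := shortest_bound (@tsucc_bound n T E wfE strict K s) DS.
split.
  rewrite mulSn; move: kle t1le; rewrite /C; move: (T * size E) (n * (1 + _)) (s * _) => a b e.
  by lia.
move=> v t hv ht; rewrite h2 ?node_bound // B1 h // big_nat_recr //=; congr (_ + _)%R.
rewrite (sum_delta wfE DS leD) // vtx_node //.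
case: eqP => [_|/eqP vs_]; first by rewrite andbF.
by rewrite (passive_value wfE DS leD hv ht UE) andbT.
Qed.

Lemma save_row_ok s st : static n T E st -> nv st vs = s -> s < n ->
  let r := run save_row st in
  [/\ forall t, 0 < t <= T -> na r aG (node T s t) = na st aD (node T s t) /\
                             na r aC (node T s t) = na st aS (node T s t),
      forall y, y <= s * T -> na r aG y = na st aG y /\ na r aC y = na st aC y
    & ticks save_row st = T].
Proof.
move=> sst ss sn r; pose J i k r := [/\ k = i,
  forall t, 0 < t <= i -> na r aG (node T s t) = na st aD (node T s t) /\
                          na r aC (node T s t) = na st aS (node T s t)
  & forall y, y <= s * T -> na r aG y = na st aG y /\ na r aC y = na st aC y].
have [tE h1 h2] : J T (ticks save_row st) (run save_row st); last by split.
apply: for_rule; first exact: (static_T sst).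
  by split=> // t; case: t.
move=> i k {}r iT f [-> h1 h2]; split; first by rewrite addn1.
  move=> t ht; rewrite /= /fupd /= !(frame_nv f) // ss (static_T sst).
  have -> : s * T + i + 1 = node T s i.+1 by rewrite addn1 /node addnS.
  have fD : na r aD = na st aD by rewrite (frame_na f).
  have fS : na r aS = na st aS by rewrite (frame_na f).
  rewrite fD fS; case: (node T s t =P node T s i.+1) => [->//|ne]; apply: h1.
  have [te|//] : t = i.+1 \/ 0 < t <= i by lia.
  by rewrite te in ne.
move=> y ys; rewrite /= /fupd /= !(frame_nv f) // ss (static_T sst).
by rewrite (_ : (y == _) = false); [exact: h2 | apply/eqP; lia].
Qed.

Lemma cycles_loop_ok st : static n T E st -> nv st vK = 0 ->
  let c := cycles_loop strict in
  (exists D0 S0 : nat -> nat -> nat, forall v, v < n ->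
     shortest_data (tsucc T E strict 0 v) (D0 v) (S0 v) /\
     forall t, 0 < t <= T -> na (run c st) aG (node T v t) = D0 v (node T v t) /\
                             na (run c st) aC (node T v t) = S0 v (node T v t)) /\
  ticks c st <= n * (1 + (2 * N.+1 + (size E + T * size E) + T)).
Proof.
move=> sst sK c; pose C := 1 + (2 * N.+1 + (size E + T * size E) + T).
pose J i k r := k <= i * C /\ exists D0 S0 : nat -> nat -> nat, forall v, v < i ->
     shortest_data (tsucc T E strict 0 v) (D0 v) (S0 v) /\
     forall t, 0 < t <= T -> na r aG (node T v t) = D0 v (node T v t) /\
                             na r aC (node T v t) = S0 v (node T v t).
have [tE h] : J n (ticks c st) (run c st); last by split.
apply: for_rule; first exact: (static_n sst).
  by split=> //; exists (fun _ _ => 0), (fun _ _ => 0).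
move=> s k r sn f [kle [D0 [S0 h]]]; set r0 := set_nv r vs s.
have sr : static n T E r0 by have := static_frame f isT isT sst => -[].
have rK : nv r0 vK = 0 by rewrite /= /fupd /= (frame_nv f).
have rs : nv r0 vs = s by [].
have rA : na r0 = na r by [].
move: r0 sr rK rs rA => r0 sr rK rs rA; rewrite run_Seq ticks_Seq.
have [q [g1 _ _ DS t1]] := bfs_data strict sr rs sn rK.
have f1 := frame_run (bfs strict) r0.
have s1 : nv (run (bfs strict) r0) vs = s by rewrite (frame_nv f1).
have G1 : na (run (bfs strict) r0) aG = na r aG by rewrite (frame_na f1) // rA.
have C1 : na (run (bfs strict) r0) aC = na r aC by rewrite (frame_na f1) // rA.
move: (run (bfs _) r0) (ticks (bfs _) r0) g1 DS t1 s1 G1 C1 {f1}.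
move=> r1 t1 g1 DS t1le s1 G1 C1.
have [h1 h2 t2] := save_row_ok (graph_static g1) s1 sn.
move: (run save_row r1) (ticks save_row r1) h1 h2 t2 => r2 t2 h1 h2 ->.
split; first by rewrite mulSn; move: kle t1le; rewrite /C; move: (T * size E) (s * _) => a b; lia.
exists (fun v => if v == s then clip N (na r1 aD) else D0 v).
exists (fun v => if v == s then clip N (na r1 aS) else S0 v).
move=> v; rewrite ltnS leq_eqVlt; case: (v =P s) => [->|_] /= vs_.
  split=> // t ht; have /andP[_ xN] := node_bound sn ht.
  by rewrite !clipE //; apply: h1.
have [DSv hv] := h v vs_; split=> // t ht.
have le : node T v t <= s * T by move: vs_ ht; rewrite /node; nia.
by have [-> ->] := h2 _ le; rewrite G1 C1; apply: hv.
Qed.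

Lemma active_loop_ok st (D0 S0 : nat -> nat -> nat) :
    static n T E st -> nv st vK = K -> nv st vw = w ->
    (forall y, 0 < y <= N -> ra st rB y = 0%R) ->
    (forall v, v < n -> shortest_data (tsucc T E strict 0 v) (D0 v) (S0 v) /\
       forall t, 0 < t <= T -> na st aG (node T v t) = D0 v (node T v t) /\
                               na st aC (node T v t) = S0 v (node T v t)) ->
  let c := active_loop strict in
  (forall v t, v < n -> 0 < t <= T ->
     ra (run c st) rB (node T v t) = betweenness strict ck n T E Active v t) /\
  ticks c st <= n * (1 + (3 * N.+1 + 2 * (size E + T * size E) + n * (1 + 3 * T)) +
                 (n * (1 + T.+1 + T * (1 + T) + T) + T * size E)).
Proof.
move=> sst sK sw B0 sG c.
pose C := 1 + (3 * N.+1 + 2 * (size E + T * size E) + n * (1 + 3 * T)) +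
                 (n * (1 + T.+1 + T * (1 + T) + T) + T * size E).
pose J i k r := k <= i * C /\ forall v t, v < n -> 0 < t <= T ->
  ra r rB (node T v t) = (\sum_(0 <= s < i)
    \sum_(z < n | [&& s != v, (z : nat) != v & s != z])
      delta strict ck n T E Active s z v t)%R.
have [tE h] : J n (ticks c st) (run c st); last first.
  by split=> // v t hv ht; rewrite h // big_mkord.
apply: for_rule; first exact: (static_n sst).
  by split=> // v t hv ht; rewrite big_geq // B0 // node_bound.
move=> s k r sn f [kle h]; set r0 := set_nv r vs s.
have sr : static n T E r0 by have := static_frame f isT isT sst => -[].
have rK : nv r0 vK = K by rewrite /= /fupd /= (frame_nv f).
have rw : nv r0 vw = w by rewrite /= /fupd /= (frame_nv f).
have rs : nv r0 vs = s by [].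
have rB0 : ra r0 = ra r by [].
have rG0 : na r0 aG = na st aG by rewrite /= (frame_na f).
have rC0 : na r0 aC = na st aC by rewrite /= (frame_na f).
move: r0 sr rK rw rs rB0 rG0 rC0 => r0 sr rK rw rs rB0 rG0 rC0; rewrite run_Seq ticks_Seq.
have [D [S [g1 [D1 S1] DS [UE tauE] t1]]] := core_ok sr rs sn rK rw.
have f1 := frame_run (core strict) r0.
have B1 : ra (run (core strict) r0) rB = ra r rB by rewrite (frame_ra f1) // rB0.
have s1 : nv (run (core strict) r0) vs = s by rewrite (frame_nv f1).
have K1 : nv (run (core strict) r0) vK = K by rewrite (frame_nv f1).
have G1 : na (run (core strict) r0) aG = na st aG by rewrite (frame_na f1).
have C1 : na (run (core strict) r0) aC = na st aC by rewrite (frame_na f1).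
move: (run (core _) r0) (ticks (core _) r0) g1 D1 S1 UE tauE t1 B1 s1 K1 G1 C1 {f1}.
move=> r1 t1 g1 D1 S1 UE tauE t1le B1 s1 K1 G1 C1.
have GC v t : v < n -> 0 < t <= T -> na r1 aG (node T v t) = D0 v (node T v t) /\
    na r1 aC (node T v t) = S0 v (node T v t).
  by move=> hv ht; rewrite G1 C1; apply: (sG v hv).2.
have [h2 t2] := acc_active_ok wfE g1 K1 s1 D1 S1 erefl erefl GC.
move: (run acc_active r1) (ticks acc_active r1) h2 t2 => r2 t2 h2 t2le.
have leD := shortest_bound (@tsucc_bound n T E wfE strict K s) DS.
split.
  rewrite mulSn; move: kle t1le t2le; rewrite /C.
  by move: (T * size E) (n * (1 + 3 * T)) (n * (_ + T)) (s * _) => a b e g; lia.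
move=> v t hv ht; rewrite h2 // B1 h // big_nat_recr //=; congr (_ + _)%R.
rewrite (sum_delta wfE DS leD) //; case: eqP => // _.
(* The weights in the array agree with [tau] on the numbers [1, ..., N] only; this suffices, as
   every successor lies in that range. *)
rewrite (active_total wfE DS leD hv ht (sG v hv).1 UE); congr (_ + _)%R.
apply: eq_bigr => t' _; congr (_ * _)%R; rewrite big_seq_cond [RHS]big_seq_cond.
apply: eq_bigr => b /andP[hb _]; rewrite tauE //.
exact: (tsucc_bound wfE hb).
Qed.
End Main.

Section MainProgram.
Variables (n T : nat) (E : seq arc) (k : nat).
Hypothesis wfE : wf_tgraph n T E.
Variables (strict : bool) (cls : cost_class).
Notation ck := (mk_cost cls k).

Lemma load_window_eval st : nv st vk = k -> nv st vT = T ->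
  neval st (if cls is CRestless then NV vk else NV vT) = window T ck.
Proof. by case: cls. Qed.

Lemma load_weight_eval st : nv st vn = n ->
  neval st (if cls is CForemost then NV vn else NC 0) = weight n ck.
Proof. by case: cls. Qed.

Lemma main_ok md st : input n T E k st ->
  let c := main strict cls md in
  [/\ static n T E (run c st),
     forall v t, v < n -> 0 < t <= T ->
       ra (run c st) rB (node T v t) = betweenness strict ck n T E md v t
   & ticks c st <= n + size E + n * T.+1 +
       (if md is Passive then
          n * (4 * (n * T).+1 + 2 * (size E + T * size E) + n * (1 + 3 * T))
        else n * (1 + (2 * (n * T).+1 + (size E + T * size E) + T)) +
             n * (1 + (3 * (n * T).+1 + 2 * (size E + T * size E) + n * (1 + 3 * T)) +
                 (n * (1 + T.+1 + T * (1 + T) + T) + T * size E)))].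
Proof.
move=> inp c; rewrite /c /main run_Seq ticks_Seq {c}.
have [s1 k1 B1 t1] := init_ok wfE inp.
move: (run init st) (ticks init st) s1 k1 B1 t1 => r1 t1 s1 k1 B1 t1le.
rewrite run_Seq ticks_Seq run_NSet ticks_NSet add0n (load_weight_eval (static_n s1)).
set r2 := set_nv r1 vw _.
have s2 : static n T E r2 by case: s1.
have k2 : nv r2 vk = k by [].
have w2 : nv r2 vw = weight n ck by [].
have B2 : ra r2 = ra r1 by [].
move: r2 s2 k2 w2 B2 => r2 s2 k2 w2 B2.
case: md.
  rewrite run_Seq ticks_Seq run_NSet ticks_NSet add0n (load_window_eval k2 (static_T s2)).
  set r3 := set_nv r2 vK _.
  have s3 : static n T E r3 by case: s2.
  have K3 : nv r3 vK = window T ck by [].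
  have w3 : nv r3 vw = weight n ck by [].
  have B3 : ra r3 = ra r1 by [].
  move: r3 s3 K3 w3 B3 => r3 s3 K3 w3 B3.
  have [|h t2] := @passive_loop_ok n T E wfE strict ck r3 s3 K3 w3; first by rewrite B3.
  split=> //; last exact: leq_add.
  exact: (static_frame (frame_run (passive_loop strict) r3) isT isT s3).
rewrite run_Seq ticks_Seq run_NSet ticks_NSet add0n -[neval _ (NC 0)]/0.
set r3 := set_nv r2 vK 0.
have s3 : static n T E r3 by case: s2.
have K3 : nv r3 vK = 0 by [].
have w3 : nv r3 vw = weight n ck by [].
have k3 : nv r3 vk = k by [].
have B3 : ra r3 = ra r1 by [].
move: r3 s3 K3 w3 k3 B3 => r3 s3 K3 w3 k3 B3; rewrite run_Seq ticks_Seq.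
have [[D0 [S0 GC]] t2] := @cycles_loop_ok n T E wfE strict r3 s3 K3.
have f4 := frame_run (cycles_loop strict) r3.
have s4 := static_frame f4 isT isT s3.
have w4 : nv (run (cycles_loop strict) r3) vw = weight n ck by rewrite (frame_nv f4).
have k4 : nv (run (cycles_loop strict) r3) vk = k by rewrite (frame_nv f4).
have B4 : ra (run (cycles_loop strict) r3) rB = ra r1 rB by rewrite (frame_ra f4) // B3.
move: (run (cycles_loop _) r3) (ticks (cycles_loop _) r3) GC t2 s4 w4 k4 B4 {f4}.
move=> r4 t2 GC t2le s4 w4 k4 B4.
rewrite run_Seq ticks_Seq run_NSet ticks_NSet add0n (load_window_eval k4 (static_T s4)).
set r5 := set_nv r4 vK _.
have s5 : static n T E r5 by case: s4.
have K5 : nv r5 vK = window T ck by [].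
have w5 : nv r5 vw = weight n ck by [].
have B5 : ra r5 rB = ra r1 rB by [].
have G5 : na r5 = na r4 by [].
move: r5 s5 K5 w5 B5 G5 => r5 s5 K5 w5 B5 G5.
have [||h t3] := @active_loop_ok n T E wfE strict ck r5 D0 S0 s5 K5 w5.
- by rewrite B5.
- by rewrite G5.
split=> //; last by apply: leq_add => //; apply: leq_add.
exact: (static_frame (frame_run (active_loop strict) r5) isT isT s5).
Qed.
End MainProgram.

(** * Loading the input and writing the output *)

(** While the input is loaded, all cells hold natural numbers, so the execution is followed on a
    [nat]-valued memory. *)
Definition denotes (m : memory) (f : nat -> nat) := forall a, m a = ((f a)%:R)%R.

Lemma denotes_upd m f d x y : denotes m f -> x = (y%:R)%R -> denotes (upd m d x) (fupd f d y).
Proof. by move=> mf -> a; rewrite /upd /fupd; case: eqP. Qed.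

(* The cell written by a non-jumping instruction, and its new value. *)
Definition nwrite (i : instr) (f : nat -> nat) : nat * nat :=
  match i with
  | IConst d q => (d, addr q)
  | IAdd d a b => (d, f a + f b)
  | ISub d a b => (d, f a - f b)
  | IMul d a b => (d, f a * f b)
  | IDiv d a b => (d, f a %/ f b)
  | ILoad d a => (d, f (f a))
  | IStore a s => (f a, f s)
  | _ => (0, 0)
  end.

(** Conditions under which the rational operation agrees with the one on [nat]: no negative
    difference, and exact division by a positive number. *)
Definition nat_step (i : instr) (f : nat -> nat) : Prop :=
  match i with
  | IConst d q => exists k : nat, q = (k%:R)%R
  | ISub d a b => f b <= f a
  | IDiv d a b => 0 < f b /\ (f b %| f a)
  | IJle _ _ _ | IHalt => False
  | _ => True
  end.

Lemma runs_write P pc m f i c d y pc' Q b :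
    code_at P pc (i :: c) -> denotes m f -> nat_step i f -> nwrite i f = (d, y) ->
    (forall m' g, denotes m' g -> g d = y -> (forall a, a <> d -> g a = f a) ->
       code_at P pc.+1 c -> runs P pc.+1 m' pc' Q b) ->
  runs P pc m pc' Q b.+1.
Proof.
move=> Pc mf hi iE h; apply: (runs_code Pc) => // [|Pc']; first by case: (i) hi.
have [-> mf'] : (step1 i pc m).1 = pc.+1 /\ denotes (step1 i pc m).2 (fupd f d y).
  case: i hi iE {Pc} => [d' q|d' a b'|d' a b'|d' a b'|d' a b'|d' a|a s|a b' l|] //= hi [<- <-];
    split=> //.
  - by case: hi => k ->; apply: denotes_upd; rewrite ?addr_nat.
  - by apply: denotes_upd => //; rewrite !mf natrD.
  - by apply: denotes_upd => //; rewrite !mf natrB.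
  - by apply: denotes_upd => //; rewrite !mf natrM.
  - case: hi => b0 dv; apply: denotes_upd => //; rewrite !mf.
    by rewrite -{1}(divnK dv) natrM mulfK // pnatr_eq0 -lt0n.
  - by rewrite [m a]mf addr_nat; apply: denotes_upd; rewrite ?mf.
  - by rewrite [m a]mf addr_nat; apply: denotes_upd; rewrite ?mf.
by apply: h mf' _ _ Pc' => [|a]; rewrite /fupd ?eqxx // => /eqP/negbTE->.
Qed.

Lemma runs_jump P pc m f a b l c pc' Q B :
    code_at P pc (IJle a b l :: c) -> denotes m f ->
    (code_at P pc.+1 c -> runs P (if f a <= f b then l else pc.+1) m pc' Q B) ->
  runs P pc m pc' Q B.+1.
Proof. by move=> Pc mf h; apply: (runs_code Pc) => //= /h; rewrite !mf ler_nat. Qed.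

(* Without arcs cells 4 and 5 are both 0; otherwise they hold the distinct endpoints
   of the first arc. *)
Definition nonempty_test := [:: IJle 4 5 2; IJle 4 4 5; IJle 5 4 4; IJle 4 4 5; IHalt].

(* With m > 0 arcs, the input lies below address 256 m; k, n, T and the first
   arc are saved from there on, to free the registers 0-6. *)
Definition save_input :=
  nseq 8 (IAdd 2 2 2) ++
  [:: IStore 2 3; IConst 3 1%:R; IAdd 2 2 3; IStore 2 0; IAdd 2 2 3; IStore 2 1;
      IAdd 2 2 3; IStore 2 4; IAdd 2 2 3; IStore 2 5; IAdd 2 2 3; IStore 2 6;
      IConst 3 5%:R; ISub 2 2 3; IConst 3 256%:R; IDiv 0 2 3;
      IConst 3 3%:R; IMul 0 0 3; IAdd 0 0 3;
      IConst 6 1%:R; IConst 5 32%:R; IConst 3 6%:R]%R.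

Definition copy_step := [:: IMul 1 0 5; IAdd 1 1 6; ILoad 4 0; IStore 1 4; ISub 0 0 6].

Definition copy_arcs pc := [:: IJle 0 3 (pc + 7)] ++ copy_step ++ [:: IJle 0 0 pc].

(* Cells 0, 32, 64 and 96 hold the variables vn, vT, vm and vk, and cell
   32 a + 1 holds entry a of the array aIn. *)
Definition restore_input :=
  [:: IConst 1 3%:R; IAdd 0 2 1; ILoad 129 0; IAdd 0 0 6; ILoad 161 0;
      IAdd 0 0 6; ILoad 193 0; ILoad 96 2; IAdd 1 2 6; ILoad 0 1;
      IAdd 1 1 6; ILoad 32 1; IConst 1 256%:R; IDiv 64 2 1]%R.

Definition prelude := nonempty_test ++ save_input ++
  copy_arcs (5 + size save_input) ++ restore_input.

Definition input_nat n T E k a := addr (encode n T E k a).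

Lemma encode_denotes n T E k : denotes (encode n T E k) (input_nat n T E k).
Proof. by move=> a; rewrite /input_nat /encode; do ![case: ifP => // _]; rewrite addr_nat. Qed.

Lemma encode_arc n T E k i : i < size E -> let e := nth arc0 E i in let f := input_nat n T E k in
  [/\ f (4 + 3 * i) = src e, f (5 + 3 * i) = dst e & f (6 + 3 * i) = tim e].
Proof.
move=> hi e; rewrite /input_nat; set f := encode n T E k.
have fE j : j < 3 -> f (4 + j + 3 * i) =
    ((if j == 0 then src e else if j == 1 then dst e else tim e)%:R)%R.
  move=> hj; rewrite /f /encode.
  have ne c : c < 4 -> (4 + j + 3 * i == c) = false by lia.
  rewrite !ne // (_ : 4 <= _ < _); last by lia.
  rewrite (_ : 4 + j + 3 * i - 4 = i * 3 + j); last by lia.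
  rewrite divnMDl // modnMDl divn_small // modn_small // addn0.
  by case: eqP => // _; case: eqP.
have := fE 0 isT; have := fE 1 isT; have := fE 2 isT.
by rewrite /= !addn0 => -> -> ->; rewrite !addr_nat.
Qed.

Section Prelude.
Variables (P : program) (n T : nat) (E : seq arc) (k : nat).
Hypothesis PE : code_at P 0 prelude.
Notation m := (size E).
Notation F := (256 * m).
Notation mem0 := (input_nat n T E k).

Definition saved (f : nat -> nat) := [/\ f F = k, f (F + 1) = n, f (F + 2) = T &
  [/\ f (F + 3) = mem0 4, f (F + 4) = mem0 5 & f (F + 5) = mem0 6]] /\
  [/\ f 2 = F, f 3 = 6, f 5 = 32 & f 6 = 1].

Lemma mem0E : [/\ mem0 0 = n, mem0 1 = T, mem0 2 = m & mem0 3 = k].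
Proof. by rewrite /input_nat /encode /= !addr_nat. Qed.

Lemma runs_double pc mem f j c pc' Q b :
    code_at P pc (nseq j (IAdd 2 2 2) ++ c) -> denotes mem f ->
    (forall mem' g, denotes mem' g -> g 2 = 2 ^ j * f 2 -> (forall a, a <> 2 -> g a = f a) ->
       code_at P (pc + j) c -> runs P (pc + j) mem' pc' Q b) ->
  runs P pc mem pc' Q (j + b).
Proof.
elim: j pc mem f => [|j IH] pc mem f Pc mf h.
  by rewrite addn0 in h; apply: h mf _ _ Pc; rewrite ?mul1n.
apply: (runs_write Pc mf) => // {mf}mem1 f1 mf1 f12 f1o Pc1.
apply: IH Pc1 mf1 _ => mem2 g mg g2 go Pc2; rewrite addSnnS in Pc2 *.
apply: h mg _ _ Pc2; first by rewrite g2 f12 expnS; lia.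
by move=> a na; rewrite go // f1o.
Qed.

Hypothesis m_gt0 : 0 < m.

(* Evaluates memory accesses from the equations left by [runs_write]. *)
Ltac look_by tac := repeat match goal with
  | e : ?g ?d = _ |- context [?g ?d] => rewrite e
  | o : forall a, a <> ?d -> ?g a = _ |- context [?g ?x] =>
      rewrite (o x); last first; [by [] || tac |]
  end.

Ltac step_by tac Pc mf dst val :=
  refine (runs_write (d := dst) (y := val) Pc mf _ _ _);
  [ cbn [nat_step]; try (by []); try (by eexists); look_by tac
  | cbn [nwrite]; rewrite ?addr_nat; look_by tac; try (by []); congr pair; try by tac
  | clear Pc mf; let m1 := fresh "mm" in let g := fresh "f" in let gd := fresh "e" in
    let go := fresh "o" in move=> m1 g mf gd go Pc ].

Ltac look := look_by ltac:(clear -m_gt0; lia).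
Ltac step Pc mf dst val := step_by ltac:(clear -m_gt0; lia) Pc mf dst val.

Lemma save_input_ok pc mem pc' Q b : denotes mem mem0 ->
    code_at P pc (save_input ++ copy_arcs (pc + size save_input) ++ restore_input) ->
    (forall mem' f, denotes mem' f -> saved f -> f 0 = 3 * m + 3 ->
       (forall a, 7 <= a <= 3 * m + 3 -> f a = mem0 a) ->
       runs P (pc + size save_input) mem' pc' Q b) ->
  runs P pc mem pc' Q (size save_input + b).
Proof.
have [] := mem0E; move fE: (mem0) => f0 f00 f01 f02 f03 mf Pc h.
move: Pc h; rewrite size_cat size_nseq [size (_ :: _)]/= /save_input -!catA -addnA => Pc h.
apply: (runs_double Pc mf) => {mf}mem1 f1 mf; rewrite f02 (_ : 2 ^ 8 = 256) ?(expnS, expn0) // => e1 o1 {}Pc.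
step Pc mf (256 * m) k.
step Pc mf 3 1.
step Pc mf 2 (F + 1).
step Pc mf (F + 1) n.
step Pc mf 2 (F + 2).
step Pc mf (F + 2) T.
step Pc mf 2 (F + 3).
step Pc mf (F + 3) (f0 4).
step Pc mf 2 (F + 4).
step Pc mf (F + 4) (f0 5).
step Pc mf 2 (F + 5).
step Pc mf (F + 5) (f0 6).
step Pc mf 3 5.
step Pc mf 2 (256 * m).
  by clear -m_gt0; lia.
step Pc mf 3 256.
step Pc mf 0 (size E).
  by rewrite dvdn_mulr.
step Pc mf 3 3.
step Pc mf 0 (3 * m).
step Pc mf 0 (3 * m + 3).
step Pc mf 6 1.
step Pc mf 5 32.
step Pc mf 3 6.
rewrite [X in runs P X](_ : _ = pc + 30); last by lia.
apply: h mf _ _ _.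
- by rewrite /saved fE; split; (split; last try split); look.
- by look.
move=> a ha.
by repeat match goal with
  | o : forall a, a <> ?d -> ?g a = _ |- context [?g a] => rewrite (o a); last by (clear -m_gt0 ha; lia)
  end.
Qed.

(** Cells are moved from the top down: the target [32 a + 1] lies above all cells still to be
    copied, and below the values saved from [256 m] on, as [32 (3 m + 3) + 1 < 256 m] for [m > 0].
    Registers 3, 5 and 6 hold 6, 32 and 1; the loop stops at cell 6, since lower cells are registers
    whose input was saved. *)
Lemma copy_arcs_ok pc i mem f c pc' Q b :
    code_at P pc (copy_arcs pc ++ c) -> denotes mem f -> saved f ->
    f 0 = i -> 6 <= i <= 3 * m + 3 ->
    (forall a, 6 < a <= i -> f a = mem0 a) ->
    (forall a, i < a <= 3 * m + 3 -> f (a * 32 + 1) = mem0 a) ->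
    (forall mem' g, denotes mem' g -> saved g -> code_at P (pc + 7) c ->
       (forall a, 6 < a <= 3 * m + 3 -> g (a * 32 + 1) = mem0 a) ->
       runs P (pc + 7) mem' pc' Q b) ->
  runs P pc mem pc' Q (7 * (i - 6) + 1 + b).
Proof.
move=> Pc; move: (Pc); rewrite code_at_cat => -[_ Pend].
move ri: (i - 6) => r; elim: r i mem f ri => [|r IH] i mem f ri mf sv f0 hi old new h.
  apply: (runs_jump Pc mf) => _; have [_ [_ f3 _ _]] := sv.
  have i6 : i = 6 by lia.
  rewrite f0 f3 i6 leqnn; apply: h mf sv Pend _ => a ha.
  by apply: new; rewrite i6.
rewrite (_ : 7 * r.+1 + 1 + b = (7 * r + 1 + b + 1).+4.+2); last by lia.
apply: (runs_jump Pc mf) => P1.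
have [[fk fn fT [fa fb fc]] [f2 f3 f5 f6]] := sv.
rewrite f0 f3 ifN; last by lia.
have fi : f i = mem0 i by apply: old; lia.
step_by ltac:(clear -m_gt0 hi; lia) P1 mf 1 (i * 32).
step_by ltac:(clear -m_gt0 hi; lia) P1 mf 1 (i * 32 + 1).
step_by ltac:(clear -m_gt0 hi; lia) P1 mf 4 (mem0 i).
step_by ltac:(clear -m_gt0 hi; lia) P1 mf (i * 32 + 1) (mem0 i).
step_by ltac:(clear -m_gt0 hi; lia) P1 mf 0 (i - 1).
  by clear -hi; lia.
rewrite addn1; apply: (runs_jump P1 mf) => _; rewrite leqnn.
apply: (IH (i - 1)) mf _ _ _ _ _ h; try by clear -ri hi; lia.
- by split; (split; last try split); look_by ltac:(clear -m_gt0 hi; lia).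
- by [].
- move=> a ha; rewrite -old; last by clear -ha hi; lia.
  by look_by ltac:(clear -ha hi; lia).
move=> a ha; have [->|ai] : a = i \/ i < a by clear -ha; lia.
  by look_by ltac:(clear -m_gt0 hi; lia).
rewrite -new; last by clear -ai ha; lia.
by look_by ltac:(clear -ai hi; lia).
Qed.

Lemma restore_input_ok pc mem f pc' Q b :
    code_at P pc restore_input -> denotes mem f -> saved f ->
    (forall a, 6 < a <= 3 * m + 3 -> f (a * 32 + 1) = mem0 a) ->
    (forall mem' g, denotes mem' g ->
       [/\ g 0 = n, g 32 = T, g 64 = m & g 96 = k] ->
       (forall a, 3 < a <= 3 * m + 3 -> g (a * 32 + 1) = mem0 a) ->
       runs P (pc + 14) mem' pc' Q b) ->
  runs P pc mem pc' Q (14 + b).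
Proof.
move=> Pc mf [[fk fn fT [fa fb fc]] [f2 f3 f5 f6]] old h.
step Pc mf 1 3.
step Pc mf 0 (F + 3).
step Pc mf 129 (mem0 4).
step Pc mf 0 (F + 4).
step Pc mf 161 (mem0 5).
step Pc mf 0 (F + 5).
step Pc mf 193 (mem0 6).
step Pc mf 96 k.
step Pc mf 1 (F + 1).
step Pc mf 0 n.
step Pc mf 1 (F + 2).
step Pc mf 32 T.
step Pc mf 1 256.
step Pc mf 64 (size E).
  by rewrite dvdn_mulr.
rewrite [X in runs P X](_ : _ = pc + 14); last by lia.
apply: h mf _ _; first by split; look.
move=> a ha; have [->|[->|[->|ha']]] : a = 4 \/ a = 5 \/ a = 6 \/ 6 < a <= 3 * m + 3 by lia.
- by rewrite (_ : 4 * 32 + 1 = 129) //; look.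
- by rewrite (_ : 5 * 32 + 1 = 161) //; look.
- by rewrite (_ : 6 * 32 + 1 = 193) //; look.
by rewrite -old //; look_by ltac:(clear -ha'; lia).
Qed.

Lemma prelude_ok : wf_tgraph n T E ->
  runs P 0 (encode n T E k) (size prelude)
    (fun m' => exists st, enc st m' /\ input n T E k st) (21 * m + 60).
Proof.
move=> wfE; have mf := @encode_denotes n T E k.
have [_ _ ne _] := arcP wfE (mem_nth arc0 m_gt0 : nth arc0 E 0 \in E).
have [m4 m5 _] := @encode_arc n T E k 0 m_gt0.
set Q := fun m' => _; set mem := encode n T E k.
have [P5 Pcopy] : code_at P 5 (save_input ++ copy_arcs (5 + size save_input) ++ restore_input)
    /\ code_at P (5 + size save_input) (copy_arcs (5 + size save_input) ++ restore_input).
  by move: PE; rewrite /prelude code_at_cat => -[_ h]; move: (h); rewrite code_at_cat => -[].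
have key : runs P 5 mem (size prelude) Q (21 * m + 50).
  (* 30 instructions save the cells, each of the [3 m - 3] copied cells takes 7, the final test 1,
     and 14 instructions restore. *)
  apply: (@runs_weaken _ _ _ _ Q _ (30 + (7 * (3 * m + 3 - 6) + 1 + (14 + 0)))) => //; last first.
    by clear; lia.
  apply: (save_input_ok mf P5) => mem1 f mf1 sv f0 old.
  apply: (copy_arcs_ok Pcopy mf1 sv f0) => // [|a|mem2 g mg svg Pend new].
  - by clear -m_gt0; lia.
  - by clear; lia.
  apply: (restore_input_ok Pend mg svg new) => mem3 g3 mg3 [gn gT gm gk] arcs.
  apply: runs_end => //.
  exists (State (fun v => g3 (cell 0 v)) (fun a i => g3 (cell a.+1 i))
           (fun v => mem3 (cell 28 v)) (fun a i => mem3 (cell (a + 21) i))); split.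
    by split.
  split=> // i hi; have [e1 e2 e3] := @encode_arc n T E k i hi.
  by rewrite /= /cell !arcs ?e1 ?e2 ?e3 //; clear -hi; lia.
have P0 := PE; have P1 := code_at_behead P0; have P2 := code_at_behead P1.
have P3 := code_at_behead P2.
apply: (@runs_weaken _ _ _ _ Q _ (21 * m + 50).+3) => //; last by clear; lia.
apply: (runs_jump P0 mf) => _; rewrite [input_nat _ _ _ _ 4]m4 [input_nat _ _ _ _ 5]m5.
case: leqP => le45; last first.
  apply: (@runs_weaken _ _ _ _ Q _ (21 * m + 50).+1) => //.
  by apply: (runs_jump P1 mf) => _; rewrite leqnn.
apply: (runs_jump P2 mf) => _; rewrite [input_nat _ _ _ _ 4]m4 [input_nat _ _ _ _ 5]m5.
rewrite ifN; last by rewrite -ltnNge ltn_neqAle ne.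
by apply: (runs_jump P3 mf) => _; rewrite leqnn.
Qed.
End Prelude.

Definition shift := NAdd (NMul (NC 3) (NV vm)) (NAdd (NV vN) (NC 4)).

(* The results are first moved beyond the output area, so that writing the output
   never overwrites a result that is still to be copied. *)
Definition move_results := For vi (NV vN)
  (RPut rR (NAdd shift (NAdd (NV vi) (NC 1))) (RA rB (NAdd (NV vi) (NC 1)))).

Definition finish := move_results ;;
  NSet vfrom (NAdd (NMul (NC 32) (NAdd shift (NC 1))) (NC 25)) ;;
  NSet vto (NAdd (NMul (NC 3) (NV vm)) (NC 4)) ;;
  NSet vend (NAdd (NV vto) (NV vN)).

Lemma finish_ok n T E st : static n T E st ->
  let r := run finish st in let o := 3 * size E + (n * T + 4) in
  [/\ nv r vfrom = 32 * (o + 1) + 25, nv r vto = 3 * size E + 4,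
      nv r vend = 3 * size E + 4 + n * T,
      forall x, x < n * T -> ra r rR (o + x.+1) = ra st rB x.+1
    & ticks finish st = n * T].
Proof.
move=> sst r o.
pose J i k r := k = i /\ forall x, x < i -> ra r rR (o + x.+1) = ra st rB x.+1.
have [tE h] : J (n * T) (ticks move_results st) (run move_results st).
  apply: for_rule; [exact: (static_N sst) | by [] | move=> i k r' iN f [-> h]].
  split; first by rewrite addn1.
  move=> x; rewrite ltnS /= /fupd /= !(frame_nv f) // (static_N sst) (static_m sst) -/o addn1.
  rewrite eqn_add2l eqSS leq_eqVlt; case: eqP => [->|_] /= xi; last exact: h.
  by rewrite (frame_ra f).
have f1 := frame_run move_results st.
rewrite /r /finish run_Seq ticks_Seq !tE.
have sm : nv (run move_results st) vm = size E by rewrite (frame_nv f1) ?(static_m sst).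
have sN : nv (run move_results st) vN = n * T by rewrite (frame_nv f1) ?(static_N sst).
move: (run move_results st) sm sN h => r1 sm sN h.
rewrite !run_Seq !ticks_Seq !run_NSet !ticks_NSet addn0 /= /fupd /= sm sN.
by split; rewrite ?addn0.
Qed.

Definition copy_out pc :=
  [:: IJle 3 2 (pc + 6); ILoad 6 1; IStore 2 6; IAdd 2 2 4; IAdd 1 1 5; IJle 1 1 pc].

(** The output area cuts across all banks, so writing it destroys variables and arrays; the three
    addresses are therefore brought into registers beforehand. A result sits in bank 25, the bank of
    [rR], in steps of 32 cells. *)
Definition epilogue pc :=
  [:: IConst 1 0%:R; IAdd 2 (cell 0 vto) 1; IAdd 3 (cell 0 vend) 1; IAdd 1 (cell 0 vfrom) 1;
      IConst 4 1%:R; IConst 5 32%:R]%R ++ copy_out (pc + 6).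

Ltac upd_eval := repeat (rewrite upd_same || (rewrite upd_other; last by lia)).

(** [t + N <= s] keeps the whole output area below the cells still to be read, and [6 < t] protects
    the registers. *)
Lemma copy_out_ok P pc N s t j (m : memory) (val : nat -> rat) :
    code_at P pc (copy_out pc) -> j <= N -> 6 < t -> t + N <= s ->
    [/\ m 1 = ((s + 32 * j)%:R)%R, m 2 = ((t + j)%:R)%R, m 3 = ((t + N)%:R)%R,
        m 4 = (1%:R)%R & m 5 = (32%:R)%R] ->
    (forall x, x < j -> m (t + x) = val x) ->
    (forall x, j <= x < N -> m (s + 32 * x) = val x) ->
  runs P pc m (pc + 6) (fun m' => forall x, x < N -> m' (t + x) = val x) (6 * (N - j) + 1).
Proof.
move=> Pc; move rE: (N - j) => r.
elim: r j m rE => [|r IH] j m rE jN t6 ts [m1 m2 m3 m4 m5] done todo.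
  apply: (runs_code Pc) => // _; rewrite /= m2 m3 ler_nat leq_add2l ifT; last by lia.
  by apply: runs_end => // x xN; apply: done; lia.
rewrite (_ : 6 * r.+1 + 1 = (6 * r + 1).+4.+2); last by lia.
apply: (runs_code Pc) => // P1; rewrite /= m2 m3 ler_nat leq_add2l ifN; last by lia.
do 5![apply: (runs_code P1) => // {}P1]; rewrite [step1 _ _ _]/= lexx.
have a2 : addr (upd m 6 (m (addr (m 1))) 2) = t + j by rewrite upd_other // m2 addr_nat.
have v6 : m (addr (m 1)) = val j by rewrite m1 addr_nat todo //; lia.
rewrite [X in runs P X](_ : _ = pc) //= v6 in a2 *; rewrite a2.
apply: (IH j.+1) => //; try lia.
- split; upd_eval; rewrite ?m1 ?m2 ?m3 ?m4 ?m5 -?natrD //; congr (_%:R)%R; lia.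
- move=> x; rewrite ltnS leq_eqVlt => /orP[/eqP->|xj]; first by upd_eval.
  by upd_eval; apply: done.
- by move=> x xj; upd_eval; apply: todo; lia.
Qed.

Lemma runs_exec P pc m pc' Q b B : runs P pc m pc' Q b -> nth IHalt P pc' = IHalt -> b < B ->
  exists m', exec P B pc m = Some m' /\ Q m'.
Proof.
move=> [k [m' [kb r q]]] halt bB; exists m'; split=> //.
have [f ->] : exists f, B = k + f.+1 by exists (B - k).-1; lia.
by rewrite r /= halt.
Qed.

Lemma epilogue_ok P pc n T (E : seq arc) st st0 (m : memory) :
    code_at P pc (epilogue pc) -> enc st m ->
    nv st vfrom = 32 * (3 * size E + (n * T + 4) + 1) + 25 -> nv st vto = 3 * size E + 4 ->
    nv st vend = 3 * size E + 4 + n * T -> 0 < size E ->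
    (forall x, x < n * T -> ra st rR (3 * size E + (n * T + 4) + x.+1) = ra st0 rB x.+1) ->
  runs P pc m (pc + 12)
    (fun m' => forall x, x < n * T -> m' (3 * size E + 4 + x) = ra st0 rB x.+1)
    (6 * (n * T) + 7).
Proof.
move=> Pc [mv _ _ mr] vf vt ve m0 res.
have := mv vfrom; have := mv vto; have := mv vend; rewrite vf vt ve /cell => cend cto cfrom.
rewrite (_ : _ + 7 = (6 * (n * T - 0) + 1).+4.+2); last by lia.
have Pout : code_at P (pc + 6) (copy_out (pc + 6)).
  by move: Pc; rewrite /epilogue code_at_cat => -[].
do 6![apply: (runs_code Pc) => // {}Pc]; rewrite /= [X in runs P X](_ : _ = pc + 6); last by lia.
rewrite (_ : pc + 12 = pc + 6 + 6); last by lia.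
set o := 3 * size E + (n * T + 4) in vf cfrom res *.
apply: (@copy_out_ok _ _ _ (32 * (o + 1) + 25) _ 0) => //; try by rewrite /o; lia.
  by split; rewrite /= /cell; upd_eval; rewrite ?cend ?cto ?cfrom ?addr0 -?natrD //; congr (_%:R)%R; lia.
move=> x xN; rewrite /= /cell; do 6![rewrite upd_other; last by rewrite /o; lia].
rewrite -res //; have := mr rR (o + x.+1) isT; rewrite /cell => <-.
by congr (m _); lia.
Qed.

Definition betweenness_cmd (d : bool) cls md := main d cls md ;; finish.

Definition betweenness_code (d : bool) cls md := code (betweenness_cmd d cls md) 0 (size prelude).

Definition betweenness_program (d : bool) cls md :=
  let c := betweenness_code d cls md in prelude ++ c ++ epilogue (size prelude + size c).

Lemma wf_betweenness_cmd (d : bool) cls md : wf_cmd (betweenness_cmd d cls md).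
Proof. by case: d; case: cls; case: md. Qed.

Lemma words_upto_nil c : words_upto [::] c = [::].
Proof. by rewrite /words_upto; elim: c 0 => //= c IH i; rewrite IH. Qed.

Lemma betweenness_nil d ck n T md v t : betweenness d ck n T [::] md v t = 0%R.
Proof.
rewrite /betweenness big1 // => s _; rewrite big1 // => z _.
by rewrite /delta /sigma; case: optcost => // c; rewrite words_upto_nil.
Qed.

(** Without arcs the program halts after three steps, and the zeros already in the output cells are
    the right answer; the constant 4 covers this case. Otherwise prelude, compiled command and
    epilogue are chained, and the program ends by running off its last instruction. *)
Lemma betweenness_program_ok d cls md (bound : nat -> nat -> nat -> nat) :
    (forall n m T, 4 <= bound n m T) ->
    (forall n T E k st, wf_tgraph n T E -> 0 < size E -> input n T E k st ->
       21 * size E + 60 + (size (betweenness_code d cls md) * (ticks (main d cls md) st + n * T).+1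
         + (6 * (n * T) + 7)) < bound n (size E) T) ->
  computes_within (betweenness_program d cls md) md d cls bound.
Proof.
move=> bound4 boundE n T E k wfE; set P := betweenness_program d cls md.
have P0 : code_at P 0 prelude by rewrite /P /betweenness_program; exact: (@code_at_mid [::] prelude).
case: (posnP (size E)) => [/size0nil E0|E0].
  exists (encode n T E k); split.
    have mf := @encode_denotes n T E k; have P1 := code_at_behead (code_at_behead P0).
    have h : runs P 0 (encode n T E k) 4 (fun m' => m' = encode n T E k) 2.
      apply: (runs_jump P0 mf) => _; rewrite E0 /= -E0.
      by apply: (runs_jump P1 mf) => _; rewrite E0 /= -E0; apply: runs_done.
    have [P4 _] := code_at_behead (code_at_behead P1).
    by have [m' [-> ->]] := runs_exec h P4 (ltnW (bound4 n (size E) T)).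
  move=> v t hv ht; rewrite E0 betweenness_nil /encode /out_addr [size _]/=.
  have ne c : c < 4 -> (4 + 3 * 0 + v * T + t.-1 == c) = false by lia.
  by rewrite !ne // [4 <= _ < _](_ : _ = false) //; lia.
have pre := @prelude_ok P n T E k P0 E0 wfE.
have Pc : code_at P (size prelude) (betweenness_code d cls md).
  by rewrite /P /betweenness_program; exact: code_at_mid.
have Pe : code_at P (size prelude + size (betweenness_code d cls md))
    (epilogue (size prelude + size (betweenness_code d cls md))).
  move: (@code_at_mid (prelude ++ betweenness_code d cls md) (epilogue (size prelude + size (betweenness_code d cls md))) [::]).
  by rewrite cats0 -catA size_cat.
set Q := fun m' : memory => forall v t, v < n -> 0 < t <= T ->
  m' (out_addr n T (size E) v t) = betweenness d (mk_cost cls k) n T E md v t.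
have [k1 [m1 [k1le r1 [st [em inp]]]]] := pre.
have [sst B _] := main_ok wfE d cls md inp.
have wfc := wf_betweenness_cmd d cls md.
have [k2 [m2 [k2le r2 [em2 _]]]] := code_ok wfc em Pc.
move: em2 k2le; rewrite [run _ _]run_Seq [ticks _ _]ticks_Seq.
have [ff ft fe res ->] := finish_ok sst.
move: (run (main d cls md) st) sst B ff ft fe res => st1 sst B ff ft fe res em2 k2le.
have [k3 [m3 [k3le r3 out]]] := epilogue_ok Pe em2 ff ft fe E0 res.
have h : runs P 0 (encode n T E k) (size P) Q (k1 + (k2 + k3)).
  exists (k1 + (k2 + k3)), m3; split=> // [f|v t hv ht].
    rewrite -addnA r1 -addnA r2 r3; congr exec.
    by rewrite /P /betweenness_program 2!size_cat [size (epilogue _)]/= addnA.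
  rewrite -B // /out_addr; have /andP[x0 xN] := node_bound hv ht.
  have := out (node T v t).-1; rewrite prednK // => <- //.
  by congr (m3 _); rewrite /node; lia.
apply: (runs_exec h); first by rewrite nth_default.
apply: leq_ltn_trans (boundE _ _ _ _ _ wfE E0 inp).
by apply: leq_add => //; apply: leq_add.
Qed.

(** * The running time *)

Lemma wf_tgraph_gt0 n T E : wf_tgraph n T E -> 0 < size E -> 0 < n /\ 0 < T.
Proof.
move=> wfE E0; have [sn _ _ ht] := arcP wfE (mem_nth arc0 E0 : nth arc0 E 0 \in E).
by split; [apply: leq_ltn_trans sn | move: ht => /andP[t0 tT]; apply: leq_trans tT].
Qed.

(** As [n], [m] and [T] are positive, each lower-order term is at most [n^2 T] or [n m T]; 40 is a
    generous constant that also serves the active case. *)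
Lemma passive_cost n m T : 0 < n -> 0 < m -> 0 < T ->
  n + m + n * T.+1 + n * (4 * (n * T).+1 + 2 * (m + T * m) + n * (1 + 3 * T)) + n * T
    <= 40 * (n ^ 2 * T + n * m * T).
Proof.
move=> n0 m0 T0; rewrite -mulnn.
have h1 : n * T <= n * n * T by rewrite leq_mul2r leq_pmulr ?orbT.
have h2 : n <= n * T by rewrite leq_pmulr.
have h3 : n * n <= n * n * T by rewrite leq_pmulr.
have h4 : n * m <= n * m * T by rewrite leq_pmulr.
have h5 : m <= n * m by rewrite leq_pmull.
by lia.
Qed.

Lemma active_cost n m T : 0 < n -> 0 < m -> 0 < T ->
  n + m + n * T.+1 +
    (n * (1 + (2 * (n * T).+1 + (m + T * m) + T)) +
     n * (1 + (3 * (n * T).+1 + 2 * (m + T * m) + n * (1 + 3 * T)) +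
          (n * (1 + T.+1 + T * (1 + T) + T) + T * m))) + n * T
    <= 40 * (n ^ 2 * T ^ 2 + n * m * T).
Proof.
move=> n0 m0 T0; rewrite -!mulnn.
have h1 : n * T <= n * n * T by rewrite leq_mul2r leq_pmulr ?orbT.
have h2 : n <= n * T by rewrite leq_pmulr.
have h3 : n * n <= n * n * T by rewrite leq_pmulr.
have h4 : n * m <= n * m * T by rewrite leq_pmulr.
have h5 : m <= n * m by rewrite leq_pmull.
have h6 : n * n * T <= n * n * (T * T) by rewrite leq_mul2l leq_pmulr ?orbT.
by lia.
Qed.

Lemma total_cost S n m T a X : a <= 40 * X -> n * T <= X -> m <= X ->
  21 * m + 60 + (S * a.+1 + (6 * (n * T) + 7)) < 100 * S.+1 * X + 100 * S.+1.
Proof.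
move=> aX nX mX; have : S * a.+1 <= S * (40 * X).+1 by rewrite leq_mul2l ltnS aX orbT.
by move: (S * a.+1) => b; lia.
Qed.

Theorem theorem1 (strict : bool) :
  (forall cls : cost_class,
     exists (P : program) (c : nat),
       computes_within P Passive strict cls
         (fun n m T => c * (n ^ 2 * T + n * m * T) + c))
  /\
  (forall cls : cost_class, cls <> CForemost ->
     exists (P : program) (c : nat),
       computes_within P Active strict cls
         (fun n m T => c * (n ^ 2 * T ^ 2 + n * m * T) + c)).
Proof.
(* The constant comes from the size of the compiled code, hence depends on the setting, mode and
   cost but not on the input; the bound [k] is read from memory. *)
have ok md cls (X : nat -> nat -> nat -> nat) :
    (forall n T E k st, wf_tgraph n T E -> 0 < size E -> input n T E k st ->
       [/\ ticks (main strict cls md) st + n * T <= 40 * X n (size E) T,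
           n * T <= X n (size E) T & size E <= X n (size E) T]) ->
    exists (P : program) (c : nat),
      computes_within P md strict cls (fun n m T => c * X n m T + c).
  move=> h; exists (betweenness_program strict cls md).
  exists (100 * (size (betweenness_code strict cls md)).+1).
  apply: betweenness_program_ok => [n m T|n T E k st wfE E0 inp].
    by move: (size _) (X _ _ _) => S x; lia.
  by have [h1 h2 h3] := h _ _ _ _ _ wfE E0 inp; apply: total_cost.
have le_nT n T : 0 < n -> n * T <= n ^ 2 * T.
  by move=> n0; rewrite -mulnn leq_mul2r leq_pmulr ?orbT.
have le_m n m T : 0 < n -> 0 < T -> m <= n * m * T.
  by move=> n0 T0; rewrite mulnAC leq_pmull // muln_gt0 n0.
split=> cls => [|_]; apply: ok => n T E k st wfE E0 inp.
  have [n0 T0] := wf_tgraph_gt0 wfE E0; have [_ _ tk] := main_ok wfE strict cls Passive inp.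
  split; last by rewrite (leq_trans (le_m n _ T n0 T0)) ?leq_addl.
    by apply: leq_trans (passive_cost n0 E0 T0); rewrite leq_add2r.
  by rewrite (leq_trans (le_nT n T n0)) ?leq_addr.
have [n0 T0] := wf_tgraph_gt0 wfE E0; have [_ _ tk] := main_ok wfE strict cls Active inp.
split; last by rewrite (leq_trans (le_m n _ T n0 T0)) ?leq_addl.
  by apply: leq_trans (active_cost n0 E0 T0); rewrite leq_add2r.
rewrite (leq_trans (le_nT n T n0)) // (leq_trans _ (leq_addr _ _)) //.
by rewrite leq_mul2l -mulnn leq_pmulr ?orbT.
Qed.
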